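(* Let $d\geq 1$, let $J:\mathbb{Z}^d \to (0,\infty)$ be symmetric and integrable, and suppose that there exist $\alpha < d$, $c>0$, and $r_0<\infty$ such that $J(x)\geq c \|x\|_1^{-d-\alpha}$ for every $x\in \mathbb{Z}^d$ with $\|x\|_1 \geq r_0$. Then there exists a constant $C$ such that \[ \mathbf{P}_{\beta}(|K_0| \geq n) \leq C n^{-(d-\alpha)/(2d+\alpha)} \qquad\text{and}\qquad \frac{1}{|\Lambda_r|}\sum_{x\in \Lambda_r} \mathbf{P}_\beta(0 \leftrightarrow x) \leq C r^{-2(d-\alpha)/3} \] for every $0\le \beta \leq \beta_c$, $n \geq 1$, and $r\geq 1$. In particular, there are almost surely no infinite clusters at the critical parameter $\beta_c$.
   Context: A function $J:\mathbb{Z}^d\to[0,\infty)$ is symmetric if $J(x)=J(-x)$ for every $x$, and integrable if $\sum_{x\in\mathbb{Z}^d}J(x)<\infty$. For $\beta\ge 0$, long-range percolation on $\mathbb{Z}^d$ with intensity $J$ is the random graph with vertex set $\mathbb{Z}^d$ in which each potential edge $\{x,y\}$ is included independently at random with probability $1-\exp(-\beta J(y-x))$; its law is denoted $\mathbf{P}_\beta$. Connected components of this random graph are called clusters. $K_0$ is the cluster of the origin $0$, $|K_0|$ is its number of vertices, $\{x\leftrightarrow y\}$ is the event that $x$ and $y$ belong to the same cluster, and $\Lambda_r=[-r,r]^d\cap\mathbb{Z}^d$. The critical parameter is $\beta_c=\beta_c(J)=\sup\{\beta\ge 0:\ \mathbf{P}_\beta \text{ is supported on configurations with no infinite clusters}\}$.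 *)

(* Defs.v *)
From HB Require Import structures.
From mathcomp Require Import all_boot all_order all_algebra finmap.
From mathcomp Require Import all_classical all_reals all_analysis.

Set Implicit Arguments.
Unset Strict Implicit.
Unset Printing Implicit Defensive.

Import Order.TTheory GRing.Theory Num.Theory.

Local Open Scope classical_set_scope.
Local Open Scope ring_scope.

Notation Zlattice d := 'rV[int]_d.

Definition lattice_norm1 (R : realType) (d : nat) (x : Zlattice d) : R :=
  (\sum_(i < d) `|x ord0 i|)%:~R.

Definition lattice_box (R : realType) (d : nat) (r : R) : set (Zlattice d) :=
  [set x | forall i : 'I_d, (`|x ord0 i|)%:~R <= r].
Arguments lattice_box {R} d r.

(* A potential edge is an unordered pair of distinct vertices. *)
Definition edge (d : nat) : Type :=
  {e : {fset Zlattice d} | #|` e| == 2%N}.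

Definition edge_open (d : nat) (e : edge d) : set (edge d -> bool) :=
  [set w | w e].

Definition edge_events (d : nat) : set (set (edge d -> bool)) :=
  range (@edge_open d).

(* Percolation configurations, with the product sigma-algebra. *)
Definition config (d : nat) := g_sigma_algebraType (@edge_events d).

Definition open_adjacent (d : nat) (w : config d) : rel (Zlattice d) :=
  fun x y => `[< exists2 e : edge d, val e = [fset x; y]%fset & w e >].

Definition open_connected (d : nat) (w : config d) (x y : Zlattice d) : Prop :=
  exists2 s : seq (Zlattice d), path (open_adjacent w) x s & last x s = y.

Definition open_cluster (d : nat) (w : config d) (x : Zlattice d) :
    set (Zlattice d) :=
  [set y | open_connected w x y].

Definition no_infinite_cluster (d : nat) (w : config d) : Prop :=
  forall x : Zlattice d, finite_set (open_cluster w x).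

Definition mutually_independent (dT : measure_display) (T : measurableType dT)
    (R : realType) (P : probability T R) (I : choiceType)
    (A : I -> set T) : Prop :=
  forall F : {fset I},
    P (\bigcap_(i in [set` F]) A i) = (\prod_(i <- F) P (A i))%E.

(* For symmetric J the edge probability does not depend on the order in which
   the endpoints x and y are listed. *)
Definition percolation_law (R : realType) (d : nat) (J : Zlattice d -> R)
    (beta : R) (P : probability (config d) R) : Prop :=
  (forall (e : edge d) (x y : Zlattice d), val e = [fset x; y]%fset ->
     P (edge_open e) = (1 - expR (- (beta * J (y - x))))%:E) /\
  mutually_independent P (@edge_open d).

(* The supremum is taken in the extended reals, so that no junk value arises
   when the set of subcritical parameters is unbounded. *)
Definition beta_c (R : realType) (d : nat)
    (P : R -> probability (config d) R) : \bar R :=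
  ereal_sup [set beta%:E | beta in
    [set beta : R | 0 <= beta /\ {ae P beta, forall w, no_infinite_cluster w}]].

(* Main.v *)
(** For [0 <= beta < beta_c] let [A] be the least constant such that
    [P(|K_0| >= n) <= A n^(- theta)] for all [n], with
    [theta = (d - alpha) / (2 d + alpha)].  It is finite by sharpness of the
    phase transition (Duminil-Copin--Tassion), and a bootstrap bounds it
    uniformly in [beta].

    By Harris' inequality, [P(|K_0| >= n)^2] is at most the average over [y] in
    the box of radius [r] of [P(0 <-> y)], plus the average of the probability
    that [0] and [y] lie in distinct clusters of size at least [n].

    - If a cluster has at least [3 m] vertices in a box, its spanning tree splits
      into two edge-disjoint pieces with at least [m] each; the BK inequality
      then makes the tail of the cluster size in the box decay geometrically
      beyond the scale [m0], where [m0^(1 + theta)] is of order [A r^d]. This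
      bounds the first average by a multiple of [A m0^(1 - theta) / r^d].
    - Merging two clusters of sizes [x] and [y] lowers the sum of [min(size/n, 1)]
      by [f x + f y - f (x + y)], where [f k = min(k/n, 1)], and this is [1] when
      both are at least [n]. Hence the second average equals, up to the edge
      density, the mean of a martingale evaluated at the end of the exploration
      of a cluster; it is at most a multiple of [A r^(alpha/2) n^(- 1/2 - theta)].

    Taking [r^d] of order [(K n)^(1 + theta) / A] gives
    [P(|K_0| >= n) <= (A/2) n^(- theta)] as soon as [A] exceeds a constant. The
    bounds are closed conditions on [beta] for percolation restricted to finite
    boxes, so they extend to [beta_c]. *)

Require Import Defs.
From HB Require Import structures.
From mathcomp Require Import all_boot all_order all_algebra finmap.
From mathcomp Require Import all_classical all_reals all_analysis.
From mathcomp Require Import ring lra zify.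

Import Order.TTheory GRing.Theory Num.Theory.
Import numFieldNormedType.Exports.

Set Implicit Arguments.
Unset Strict Implicit.
Unset Printing Implicit Defensive.

Local Open Scope fset_scope.
Local Open Scope ring_scope.

(** * Expectations under finite products of Bernoulli measures *)

(** The exponent [theta] balances the two errors. With N = K n, r^(alpha/2) is at most N^((1 +
    theta) alpha / (2 d)), and the second error has the power n^(-2 theta) of the first exactly when
    (1 + theta) alpha / (2 d) = 1/2 - theta. Then the first carries A^2 K^(-2 theta) and the second
    only A K, so K is fixed first and a large A beats the second. With m0 as small as allowed, the
    first average alone decays like r^(- 2 d theta / (1 + theta)), which is the second exponent of
    the theorem.

    All estimates concern finite edge sets, uniformly in the region: expectations are polynomials in
    the edge probabilities and finite quantities may be absorbed, but translation invariance is lost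
    and is recovered by averaging over base points in a large box. The a priori constant may depend
    on beta, because it only affects the number of halvings. Small beta is treated by a first-moment
    bound, since the lower bound on edge densities degenerates there. Integrability of J forces
    alpha >= 0, which gives theta <= 1/2. *)

Section BernoulliExpectation.
Context {R : realType} {E : choiceType}.
Implicit Types (p : E -> R) (s : seq E) (f g : {fset E} -> R) (w : {fset E}).

(** A configuration is the finite set of open edges, and conditioning on the head of [s] is
    definitional, so most identities are one-coordinate inductions. A repeated entry would be
    sampled twice, hence the [uniq] hypotheses further on. *)
Fixpoint Ex p s f : R :=
  if s is e :: s' then
    p e * Ex p s' (fun w => f (e |` w)) + (1 - p e) * Ex p s' f
  else f fset0.

Definition Pr p s (A : {fset E} -> bool) : R := Ex p s (fun w => (A w)%:R).

Definition prob p := forall e, 0 <= p e <= 1.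

Definition increasing (A : {fset E} -> bool) :=
  forall w w', w `<=` w' -> A w -> A w'.

Lemma Ex_eq p s f g :
  (forall w, {subset w <= s} -> f w = g w) -> Ex p s f = Ex p s g.
Proof.
elim: s f g => [|e s IH] f g fg /=; first by apply: fg => x; rewrite inE.
congr (_ * _ + _ * _); apply: IH => w ws; apply: fg => x.
  by rewrite !inE => /orP[->//|/ws->]; rewrite orbT.
by move/ws; rewrite inE => ->; rewrite orbT.
Qed.

Lemma Ex_lin p s (a c : R) f g :
  Ex p s (fun w => a * f w + c * g w) = a * Ex p s f + c * Ex p s g.
Proof. by elim: s f g => [|e s IH] f g //=; rewrite !IH; ring. Qed.

Lemma ExZ p s (a : R) f : Ex p s (fun w => a * f w) = a * Ex p s f.
Proof. by elim: s f => [|e s IH] f //=; rewrite !IH; ring. Qed.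

Lemma ExD p s f g : Ex p s (fun w => f w + g w) = Ex p s f + Ex p s g.
Proof. by elim: s f g => [|e s IH] f g //=; rewrite !IH; ring. Qed.

Lemma ExB p s f g : Ex p s (fun w => f w - g w) = Ex p s f - Ex p s g.
Proof. by elim: s f g => [|e s IH] f g //=; rewrite !IH; ring. Qed.

Lemma Ex_cst p s (a : R) : Ex p s (fun=> a) = a.
Proof. by elim: s => [|e s IH] //=; rewrite !IH; ring. Qed.

Lemma Ex_sum (I : Type) (r : seq I) (P : pred I) p s (F : I -> {fset E} -> R) :
  Ex p s (fun w => \sum_(i <- r | P i) F i w) = \sum_(i <- r | P i) Ex p s (F i).
Proof.
elim: r => [|i r IH].
  by rewrite big_nil -[RHS](Ex_cst p s); apply: Ex_eq => w _; rewrite big_nil.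
rewrite big_cons; case: ifPn => Pi.
  by rewrite -IH -ExD; apply: Ex_eq => w _; rewrite big_cons Pi.
by rewrite -IH; apply: Ex_eq => w _; rewrite big_cons (negbTE Pi).
Qed.

Lemma Ex_le p s f g : prob p ->
  (forall w, {subset w <= s} -> f w <= g w) -> Ex p s f <= Ex p s g.
Proof.
move=> p01; elim: s f g => [|e s IH] f g fg /=; first by apply: fg => x; rewrite inE.
have /andP[p0 p1] := p01 e.
apply: lerD; apply: ler_wpM2l; rewrite ?subr_ge0//; apply: IH => w ws; apply: fg => x.
  by rewrite !inE => /orP[->//|/ws->]; rewrite orbT.
by move/ws; rewrite inE => ->; rewrite orbT.
Qed.

Lemma Ex_ge0 p s f : prob p ->
  (forall w, {subset w <= s} -> 0 <= f w) -> 0 <= Ex p s f.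
Proof. by move=> p01 f0; rewrite -(Ex_cst p s 0); exact: Ex_le. Qed.

Lemma Pr_ge0 p s A : prob p -> 0 <= Pr p s A.
Proof. by move=> p01; apply: Ex_ge0 => // w _; case: (A w). Qed.

Lemma Pr_le1 p s A : prob p -> Pr p s A <= 1.
Proof.
by move=> p01; rewrite -(Ex_cst p s 1); apply: Ex_le => // w _; case: (A w).
Qed.

Lemma Pr_sub p s (A B : {fset E} -> bool) : prob p ->
  (forall w, {subset w <= s} -> A w -> B w) -> Pr p s A <= Pr p s B.
Proof.
move=> p01 AB; apply: Ex_le => // w ws.
by case: (A w) (AB w ws) => [->|_] //; case: (B w).
Qed.

Lemma Pr_eq p s (A B : {fset E} -> bool) :
  (forall w, {subset w <= s} -> A w = B w) -> Pr p s A = Pr p s B.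
Proof. by move=> AB; apply: Ex_eq => w ws; rewrite AB. Qed.

Lemma Pr_exists (I : eqType) (r : seq I) p s (A : {fset E} -> bool)
    (B : I -> {fset E} -> bool) : prob p ->
  (forall w, {subset w <= s} -> A w -> exists2 i, i \in r & B i w) ->
  Pr p s A <= \sum_(i <- r) Pr p s (B i).
Proof.
move=> p01 AB; rewrite -Ex_sum; apply: Ex_le => // w ws.
have [/(AB w ws)[i ir Bi]|_] := boolP (A w); last exact: sumr_ge0.
by rewrite (big_rem i)//= Bi lerDl; exact: sumr_ge0.
Qed.

(** Any coordinate can be sampled first; this is how a single edge is conditioned upon. *)
Lemma Ex_rem p s e f : e \in s ->
  Ex p s f = Ex p (e :: rem e s) f.
Proof.
elim: s f => [//|c s IH] f; rewrite inE /=.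
have [<-//|ce] /= := eqVneq c e => es.
rewrite !IH //=.
have -> : Ex p (rem e s) (fun w => f (c |` (e |` w))) =
          Ex p (rem e s) (fun w => f (e |` (c |` w))).
  by apply: Ex_eq => w _; rewrite !fsetUA (fsetUC [fset c]).
ring.
Qed.

Lemma Ex_perm p s s' f : perm_eq s s' -> Ex p s f = Ex p s' f.
Proof.
elim: s s' f => [|e s IH] s' f; first by move/perm_size/esym/size0nil => ->.
move=> ss'.
have es' : e \in s' by rewrite -(perm_mem ss') mem_head.
rewrite (Ex_rem _ _ es') /=.
have ? : perm_eq s (rem e s').
  by rewrite -(perm_cons e) (permPl ss') perm_to_rem.
by rewrite !(IH (rem e s')).
Qed.

Lemma Ex_cons_incr p e s f : prob p ->
  (forall w w', w `<=` w' -> f w <= f w') -> Ex p s f <= Ex p (e :: s) f.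
Proof.
move=> p01 fi /=; have /andP[p0 p1] := p01 e.
have : Ex p s f <= Ex p s (fun w => f (e |` w)).
  by apply: Ex_le => // w _; apply: fi; exact: fsubsetU1.
nra.
Qed.

Lemma Ex_subset p s s' f : prob p -> uniq s -> uniq s' -> {subset s <= s'} ->
  (forall w w', w `<=` w' -> f w <= f w') -> Ex p s f <= Ex p s' f.
Proof.
move=> p01 us us' ss' fi.
have P : perm_eq s' ([seq e <- s' | e \notin s] ++ s).
  apply: uniq_perm => //.
    rewrite cat_uniq us filter_uniq//= andbT.
    by apply/hasPn => x xs; rewrite mem_filter xs.
  by move=> x; rewrite mem_cat mem_filter; have [/ss' ->|] := boolP (x \in s);
    rewrite /= ?orbF ?orbT.
rewrite (Ex_perm _ _ P); elim: [seq _ <- _ | _] => [//|e l IH].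
by rewrite cat_cons; apply: le_trans IH _; exact: Ex_cons_incr.
Qed.

Lemma Pr_subset p s s' A : prob p -> uniq s -> uniq s' -> {subset s <= s'} ->
  increasing A -> Pr p s A <= Pr p s' A.
Proof.
move=> p01 us us' ss' Ai; apply: Ex_subset => // w w' ww'.
by have := Ai _ _ ww'; case: (A w) => [->|] //; case: (A w').
Qed.

Lemma Ex_FKG p s f g : prob p ->
  (forall w w', w `<=` w' -> f w <= f w') ->
  (forall w w', w `<=` w' -> g w <= g w') ->
  Ex p s f * Ex p s g <= Ex p s (fun w => f w * g w).
Proof.
move=> p01; elim: s f g => [|e s IH] f g fi gi //=.
have /andP[p0 p1] := p01 e.
have f1 w w' : w `<=` w' -> f (e |` w) <= f (e |` w').
  by move=> ww'; apply/fi/fsetUS.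
have g1 w w' : w `<=` w' -> g (e |` w) <= g (e |` w').
  by move=> ww'; apply/gi/fsetUS.
have := IH f g fi gi; have := IH _ _ f1 g1.
have : Ex p s f <= Ex p s (fun w => f (e |` w)).
  by apply: Ex_le => // w _; apply: fi; exact: fsubsetU1.
have : Ex p s g <= Ex p s (fun w => g (e |` w)).
  by apply: Ex_le => // w _; apply: gi; exact: fsubsetU1.
move: (p e) p0 p1 => q q0 q1.
set a := Ex p s f; set b := Ex p s g; set a' := Ex p s (fun w => f (e |` w)).
set b' := Ex p s (fun w => g (e |` w)); set ab := Ex p s (fun w => f w * g w).
set ab' := Ex p s _ => bb aa h1 h0.
(* The covariance of the two conditional expectations, as increasing functions of the single
   coordinate [e]. *)
have h2 : 0 <= q * (1 - q) * ((a' - a) * (b' - b)).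
  by apply: mulr_ge0; apply: mulr_ge0; lra.
have h3 : q * (a' * b') <= q * ab' by exact: ler_wpM2l.
have h4 : (1 - q) * (a * b) <= (1 - q) * ab by apply: ler_wpM2l => //; lra.
lra.
Qed.

Lemma Pr_FKG p s A B : prob p -> increasing A -> increasing B ->
  Pr p s A * Pr p s B <= Pr p s (fun w => A w && B w).
Proof.
move=> p01 Ai Bi.
have -> : Pr p s (fun w => A w && B w) = Ex p s (fun w => (A w)%:R * (B w)%:R).
  by apply: Ex_eq => w _; rewrite -natrM mulnb.
apply: Ex_FKG => // w w' ww'.
  by have := Ai _ _ ww'; case: (A w) => [->|] //; case: (A w').
by have := Bi _ _ ww'; case: (B w) => [->|] //; case: (B w').
Qed.

(** [f] depends only on the coordinates in [B] and [g] only on the others. This is expressed by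
    insensitivity to adding an element, a property that survives fixing a coordinate in the
    induction. *)
Lemma Ex_indep p s (B : pred E) f g : uniq s ->
  (forall e w, e \in s -> B e -> g (e |` w) = g w) ->
  (forall e w, e \in s -> ~~ B e -> f (e |` w) = f w) ->
  Ex p s (fun w => f w * g w) = Ex p s f * Ex p s g.
Proof.
elim: s f g => [//|e s IH] f g /= /andP[es us] gB fB.
have sub c : c \in s -> c \in e :: s by rewrite inE => ->; rewrite orbT.
have [Be|Be] := boolP (B e).
  have ge : forall w, g (e |` w) = g w by move=> w; exact: gB (mem_head _ _) Be.
  rewrite IH //; last 2 first.
  - by move=> c w cs Bc; rewrite fsetUCA gB// sub.
  - by move=> c w cs Bc; rewrite fsetUCA fB// sub.
  rewrite IH //; last 2 first.
  - by move=> c w cs Bc; rewrite gB// sub.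
  - by move=> c w cs Bc; rewrite fB// sub.
  have -> : Ex p s (fun w => g (e |` w)) = Ex p s g by apply: Ex_eq.
  ring.
have fe : forall w, f (e |` w) = f w by move=> w; exact: fB (mem_head _ _) Be.
rewrite IH //; last 2 first.
- by move=> c w cs Bc; rewrite fsetUCA gB// sub.
- by move=> c w cs Bc; rewrite fsetUCA fB// sub.
rewrite IH //; last 2 first.
- by move=> c w cs Bc; rewrite gB// sub.
- by move=> c w cs Bc; rewrite fB// sub.
have -> : Ex p s (fun w => f (e |` w)) = Ex p s f by apply: Ex_eq.
ring.
Qed.

Lemma Ex_CauchySchwarz p s f g : prob p ->
  Ex p s (fun w => f w * g w) ^+ 2 <=
  Ex p s (fun w => f w ^+ 2) * Ex p s (fun w => g w ^+ 2).
Proof.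
move=> p01; set a := Ex _ _ (fun w => f w ^+ 2); set b := Ex _ _ (fun w => g w ^+ 2).
set c := Ex _ _ _.
have a0 : 0 <= a by apply: Ex_ge0 => // w _; exact: sqr_ge0.
have b0 : 0 <= b by apply: Ex_ge0 => // w _; exact: sqr_ge0.
have key t : 0 <= t ^+ 2 * a + (2 * t * c + b).
  have -> : t ^+ 2 * a + (2 * t * c + b) = Ex p s (fun w => (t * f w + g w) ^+ 2).
    rewrite -!ExZ -!ExD; apply: Ex_eq => w _; ring.
  by apply: Ex_ge0 => // w _; exact: sqr_ge0.
have [a_eq|a_neq] := eqVneq a 0.
  have [->|c0] := eqVneq c 0; first by rewrite expr2 mul0r mulr_ge0.
  (* Here the quadratic is affine in [t], and this [t] gives it the value -1. *)
  have := key (- (b + 1) / (2 * c)); rewrite a_eq mulr0 add0r.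
  have -> : 2 * (- (b + 1) / (2 * c)) * c = - (b + 1) by field.
  lra.
have a_gt : 0 < a by rewrite lt_neqAle eq_sym a_neq.
have := key (- c / a).
have -> : (- c / a) ^+ 2 * a + (2 * (- c / a) * c + b) = (a * b - c ^+ 2) / a by field.
by rewrite pmulr_lge0 ?invr_gt0// subr_ge0.
Qed.

(* BK: the one-coordinate step uses
   P(U1 \/ U2) <= P(U12)  and  P(U1 \/ U2) <= P(U1) + P(U2) - P(U0),
   weighted by p^2 and p(1-p), where the indices record which of the two
   copies contains the coordinate e. *)
Lemma Pr_BK p s (U : {fset E} -> {fset E} -> bool) : prob p ->
  (forall w1 w1' w2 w2', w1 `<=` w1' -> w2 `<=` w2' -> U w1 w2 -> U w1' w2') ->
  uniq s ->
  Pr p s (fun w => `[< exists I J, [/\ I `<=` w, J `<=` w, [disjoint I & J]%fset & U I J] >])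
  <= Ex p s (fun w1 => Pr p s (U w1)).
Proof.
move=> p01; rewrite /Pr; elim: s U => [|e s IH] U Ui /=.
  move=> _; case: asboolP => [[I [J [I0 J0 _ UIJ]]]|_] /=; last by case: (U _ _).
  by rewrite (Ui _ _ _ _ I0 J0 UIJ).
move=> /andP[es us].
have /andP[p0 p1] := p01 e.
pose D (U : {fset E} -> {fset E} -> bool) w :=
  `[< exists I J, [/\ I `<=` w, J `<=` w, [disjoint I & J]%fset & U I J] >].
(* An arbitrary increasing relation, rather than a product of two events, is stable under putting
   [e] into either copy; this closes the induction. *)
pose U1 I J := U (e |` I) J; pose U2 I J := U I (e |` J).
pose U12 I J := U (e |` I) (e |` J).
have Ui1 : forall w1 w1' w2 w2', w1 `<=` w1' -> w2 `<=` w2' -> U1 w1 w2 -> U1 w1' w2'.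
  by move=> w1 w1' w2 w2' h1 h2; apply: Ui => //; exact: fsetUS.
have Ui2 : forall w1 w1' w2 w2', w1 `<=` w1' -> w2 `<=` w2' -> U2 w1 w2 -> U2 w1' w2'.
  by move=> w1 w1' w2 w2' h1 h2; apply: Ui => //; exact: fsetUS.
have Ui12 : forall w1 w1' w2 w2', w1 `<=` w1' -> w2 `<=` w2' -> U12 w1 w2 -> U12 w1' w2'.
  by move=> w1 w1' w2 w2' h1 h2; apply: Ui => //; exact: fsetUS.
have dis1 w : {subset w <= s} -> D U (e |` w) -> D U1 w \/ D U2 w.
  move=> ws /asboolP[I [J [Iw Jw IJ UIJ]]].
  have DI : I `\ e `<=` w by rewrite fsubDset.
  have DJ : J `\ e `<=` w by rewrite fsubDset.
  have dIJ : [disjoint I `\ e & J `\ e]%fset.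
    exact: fdisjointWl (fsubsetDl _ _) (fdisjointWr (fsubsetDl _ _) IJ).
  have [eJ|eJ] := boolP (e \in J).
    right; apply/asboolP; exists (I `\ e), (J `\ e); split => //.
    rewrite /U2 fsetD1K//; apply: Ui UIJ => //.
    apply/fsubsetP => x xI; rewrite !inE xI andbT; apply: contraTneq xI => ->.
    by apply/negP => eI; have := fdisjointP IJ _ eI; rewrite eJ.
  left; apply/asboolP; exists (I `\ e), (J `\ e); split => //.
  rewrite /U1; apply: Ui UIJ.
    by apply/fsubsetP => x xI; rewrite !inE xI andbT orbN.
  apply/fsubsetP => x xJ; rewrite !inE xJ andbT; apply: contraNneq eJ => <-//.
have d12 w : D U1 w || D U2 w -> D U12 w.
  move=> /orP[] /asboolP[I [J [Iw Jw IJ UIJ]]]; apply/asboolP; exists I, J; split => //.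
  - by apply: Ui UIJ => //; exact: fsubsetU1.
  - by apply: Ui UIJ => //; exact: fsubsetU1.
have d0 w : D U w -> D U1 w && D U2 w.
  move=> /asboolP[I [J [Iw Jw IJ UIJ]]].
  by apply/andP; split; apply/asboolP; exists I, J; split => //;
    apply: Ui UIJ => //; exact: fsubsetU1.
set a := Ex p s (fun w => (D U (e |` w))%:R); set b := Ex p s (fun w => (D U w)%:R).
have ha12 : a <= Ex p s (fun w => (D U12 w)%:R).
  apply: Ex_le => // w ws; have := @dis1 w ws; have := @d12 w.
  case: (D U (e |` w)) => [|_ _]; last by case: (D U12 w).
  by move=> h /(_ isT) /orP /h ->.
have ha1 : a <= Ex p s (fun w => (D U1 w)%:R) + Ex p s (fun w => (D U2 w)%:R) - b.
  rewrite -ExD -ExB; apply: Ex_le => // w ws; have := @dis1 w ws; have := @d0 w.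
  case: (D U (e |` w)); case: (D U w) => [/(_ isT)/andP[-> ->]|_] /=;
    case: (D U1 w); case: (D U2 w) => //=; try lra; by move=> /(_ isT) [].
have := IH _ Ui12 us; have := IH _ Ui1 us; have := IH _ Ui2 us; have := IH _ Ui us.
rewrite !Ex_lin -/(D U) -/(D U1) -/(D U2) -/(D U12) -/b.
move: ha12 ha1; rewrite -/(D U12) -/(D U1) -/(D U2).
set d12' := Ex p s _; set d1 := Ex p s _; set d2 := Ex p s _.
move=> ha12 ha1 h0 h2 h1 h12.
rewrite -/(U12) -/a.
have q1 : 0 <= 1 - p e by lra.
have := ler_wpM2l (mulr_ge0 p0 p0) (le_trans ha12 h12).
have := ler_wpM2l (mulr_ge0 p0 q1) (le_trans ha1 (lerB (lerD h1 h2) (lexx b))).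
have := ler_wpM2l (mulr_ge0 q1 q1) h0.
rewrite /U1 /U2 /U12.
lra.
Qed.

End BernoulliExpectation.

(** * Russo's formula *)

Section Russo.
Context {R : realType} {E : choiceType}.
Implicit Types (J : E -> R) (s : seq E) (f : {fset E} -> R) (w : {fset E}).

Definition open_prob J (beta : R) (e : E) : R := 1 - expR (- (beta * J e)).

(** The integrand of Russo's formula. As d p_e / d beta = J e (1 - p_e), the factor 1 - p_e becomes
    the condition that [e] is closed. *)
Definition closed_pivotal J s f w : R :=
  \sum_(e <- s) J e * (e \notin w)%:R * (f (e |` w) - f w).

Lemma open_prob01 J beta : 0 <= beta -> (forall e, 0 <= J e) ->
  prob (open_prob J beta).
Proof.
move=> b0 J0 e; rewrite /open_prob subr_ge0 gerBl expR_ge0 andbT.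
by rewrite -expR0 ler_expR oppr_le0 mulr_ge0.
Qed.

Lemma Ex_le_prob (p p' : E -> R) s f : prob p -> prob p' ->
  (forall e, e \in s -> p e <= p' e) ->
  (forall w w', w `<=` w' -> f w <= f w') -> Ex p s f <= Ex p' s f.
Proof.
move=> p01 p'01; elim: s f => [//|e s IH] f pp' fi /=.
have pps : forall c, c \in s -> p c <= p' c.
  by move=> c cs; apply: pp'; rewrite inE cs orbT.
have f1 w w' : w `<=` w' -> f (e |` w) <= f (e |` w').
  by move=> ww'; apply/fi/fsetUS.
have h1 := IH _ pps f1; have h0 := IH _ pps fi.
have h : Ex p' s f <= Ex p' s (fun w => f (e |` w)).
  by apply: Ex_le => // w _; apply: fi; exact: fsubsetU1.
have pe := pp' e (mem_head _ _); have /andP[q0 q1] := p01 e.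
have := ler_wpM2l q0 h1; have : 0 <= 1 - p e by lra.
move=> /ler_wpM2l /(_ _ _ h0).
have : 0 <= (p' e - p e) * (Ex p' s (fun w => f (e |` w)) - Ex p' s f).
  by apply: mulr_ge0; lra.
lra.
Qed.

Lemma is_derive_Ex J s f (beta : R) : uniq s ->
  is_derive beta (1 : R) (fun b => Ex (open_prob J b) s f)
    (Ex (open_prob J beta) s (closed_pivotal J s f)).
Proof.
elim: s f => [|e s IH] f /=.
  by move=> _; rewrite /closed_pivotal big_nil; exact: is_derive_cst.
move=> /andP[es us].
have d1 := IH (fun w => f (e |` w)) us.
have d0 := IH f us.
have dp : is_derive beta (1 : R) (fun b => open_prob J b e)
    (J e * (1 - open_prob J beta e)).
  rewrite /open_prob; apply: is_derive_eq.
  by rewrite /GRing.scale /=; ring.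
apply: is_derive_eq.
rewrite /GRing.scale /=.
have -> : Ex (open_prob J beta) s (fun w => closed_pivotal J (e :: s) f (e |` w)) =
  Ex (open_prob J beta) s (closed_pivotal J s (fun w => f (e |` w))).
  apply: Ex_eq => w ws; rewrite /closed_pivotal big_cons !inE eqxx /= mulr0 mul0r add0r.
  apply: eq_big_seq => c cs; rewrite !inE.
  by have [ce|_] := eqVneq c e; [rewrite -ce cs in es|rewrite /= fsetUCA].
have -> : Ex (open_prob J beta) s (closed_pivotal J (e :: s) f) =
  J e * (Ex (open_prob J beta) s (fun w => f (e |` w)) - Ex (open_prob J beta) s f) +
  Ex (open_prob J beta) s (closed_pivotal J s f).
  rewrite -ExB -ExZ -ExD; apply: Ex_eq => w ws.
  rewrite /closed_pivotal big_cons (_ : e \notin w) ?mulr1//.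
  by apply: contra es; exact: ws.
by ring.
Qed.

Lemma continuous_Ex J s f : uniq s -> continuous (fun b => Ex (open_prob J b) s f).
Proof.
move=> us b; apply: differentiable_continuous; apply/derivable1_diffP.
by have [] := is_derive_Ex J f b us.
Qed.

(* [(1 - P(A)) expR (c beta)] is nonincreasing. *)
Lemma Pr_ge_of_Russo J s (A : {fset E} -> bool) (b0 b1 c : R) :
  0 <= b0 -> b0 <= b1 -> (forall e, 0 <= J e) -> uniq s ->
  (forall b, b0 <= b <= b1 ->
    c * (1 - Pr (open_prob J b) s A) <=
    Ex (open_prob J b) s (closed_pivotal J s (fun w => (A w)%:R))) ->
  1 - expR (- (c * (b1 - b0))) <= Pr (open_prob J b1) s A.
Proof.
move=> b0_ge0 b01 J0 us H.
pose G b := (1 - Pr (open_prob J b) s A) * expR (c * b).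
pose dG b := - Ex (open_prob J b) s (closed_pivotal J s (fun w => (A w)%:R)) *
  expR (c * b) + (1 - Pr (open_prob J b) s A) * (c * expR (c * b)).
have GdG b : is_derive b (1 : R) G (dG b).
  rewrite /G /dG /Pr.
  have d := is_derive_Ex J (fun w => (A w)%:R) b us.
  by apply: is_derive_eq; rewrite /GRing.scale /=; ring.
have [x xab] : exists2 x, x \in `[b0, b1] & G b1 - G b0 = dG x * (b1 - b0).
  apply: MVT_segment => //.
  apply: continuous_subspaceT => x; apply: differentiable_continuous; apply/derivable1_diffP.
  by have [] := GdG x.
move=> GE.
have dGle : dG x <= 0.
  have := H x; rewrite in_itv /= in xab => /(_ xab) /(ler_wpM2r (expR_ge0 (c * x))).
  rewrite /dG; lra.
have : G b1 <= G b0.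
  rewrite -subr_le0 GE; apply: mulr_le0_ge0 => //; lra.
rewrite /G => h.
have h0 : (1 - Pr (open_prob J b0) s A) * expR (c * b0) <= expR (c * b0).
  by rewrite ger_pMl ?expR_gt0// gerBl Pr_ge0//; exact: open_prob01.
rewrite lerBlDr -lerBlDl -(ler_pM2r (expR_gt0 (c * b1))).
apply: le_trans h _; apply: le_trans h0 _.
by rewrite -expRD ler_expR; lra.
Qed.

End Russo.

(** * Connectivity *)

Section Connectivity.
Context {V E : choiceType} (a b : E -> V).
Implicit Types (w : {fset E}) (x y z u v : V) (e f : E) (L : seq V).

Definition joins e x y :=
  ((a e == x) && (b e == y)) || ((a e == y) && (b e == x)).

Definition adj w x y := has (fun e => joins e x y) w.

Definition conn w x y : bool :=
  `[< exists2 q, path (adj w) x q & last x q = y >].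

(** Paths may use every edge of [w], and only the vertices listed in [L] are counted: this covers
    both the size of a cluster in its whole region and its size in a smaller box. *)
Definition csize w x L := count (conn w x) L.

Lemma joinsC e x y : joins e x y = joins e y x.
Proof. by rewrite /joins orbC. Qed.

Lemma joins_ab e : joins e (a e) (b e).
Proof. by rewrite /joins !eqxx. Qed.

Lemma adjP w x y : reflect (exists2 e, e \in w & joins e x y) (adj w x y).
Proof. exact: hasP. Qed.

Lemma adjC w x y : adj w x y = adj w y x.
Proof. by apply: eq_has => e; exact: joinsC. Qed.

Lemma adjS w w' x y : w `<=` w' -> adj w x y -> adj w' x y.
Proof.
by move=> /fsubsetP ww' /adjP[e /ww' ew exy]; apply/adjP; exists e.
Qed.

Lemma conn_refl w x : conn w x x.
Proof. by apply/asboolP; exists [::]. Qed.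

Lemma conn_trans w x y z : conn w x y -> conn w y z -> conn w x z.
Proof.
move=> /asboolP[q pq <-] /asboolP[r pr <-]; apply/asboolP; exists (q ++ r).
  by rewrite cat_path pq.
by rewrite last_cat.
Qed.

Lemma conn_adj w x y : adj w x y -> conn w x y.
Proof. by move=> xy; apply/asboolP; exists [:: y]; rewrite //= xy. Qed.

Lemma conn_ind w x (P : V -> Prop) : P x ->
  (forall u v, conn w x u -> P u -> adj w u v -> P v) ->
  forall y, conn w x y -> P y.
Proof.
move=> Px H y /asboolP[q + <-]; elim/last_ind: q => [//|q z IH].
rewrite rcons_path last_rcons => /andP[pq qz]; apply: H qz; last exact: IH.
by apply/asboolP; exists q.
Qed.

Lemma conn_sym w x y : conn w x y = conn w y x.
Proof.
wlog suff: x y / conn w x y -> conn w y x.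
  by move=> H; apply/idP/idP; exact: H.
apply: (@conn_ind w x (fun y => conn w y x)); first exact: conn_refl.
by move=> u v _ ux uv; apply: conn_trans ux; apply: conn_adj; rewrite adjC.
Qed.

Lemma connS w w' x y : w `<=` w' -> conn w x y -> conn w' x y.
Proof.
move=> ww'; move: y; apply: conn_ind; first exact: conn_refl.
by move=> u v _ xu uv; apply: conn_trans xu _; apply: conn_adj; exact: adjS uv.
Qed.

Lemma conn_eq w x y : conn w x y -> conn w x =1 conn w y.
Proof.
move=> xy z; apply/idP/idP; apply: conn_trans => //.
by rewrite conn_sym.
Qed.

Lemma conn_edge w e : e \in w -> conn w (a e) (b e).
Proof. by move=> ew; apply/conn_adj/adjP; exists e => //; exact: joins_ab. Qed.

Lemma conn_joins w e x y : e \in w -> joins e x y -> conn w x y.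
Proof. by move=> ew exy; apply/conn_adj/adjP; exists e. Qed.

Lemma conn_in (s : seq E) (X : {pred V}) w x y : {subset w <= s} ->
  (forall e, e \in s -> (a e \in X) && (b e \in X)) ->
  x \in X -> conn w x y -> y \in X.
Proof.
move=> ws sX xX; move: y; apply: conn_ind => // u v _ _ /adjP[e /ws /sX /andP[aX bX]].
by rewrite /joins => /orP[/andP[_ /eqP<-]|/andP[/eqP<- _]].
Qed.

(** A connection can be chosen to cross [e] at most once, in one of two directions. *)
Lemma conn_add w e x y : conn (e |` w) x y =
  [|| conn w x y, conn w x (a e) && conn w (b e) y |
      conn w x (b e) && conn w (a e) y].
Proof.
apply/idP/idP; last first.
  have S := connS (fsubsetU1 e w).
  have ab : conn (e |` w) (a e) (b e) by apply: conn_edge; rewrite !inE eqxx.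
  move=> /or3P[/S//|/andP[/S xa /S xb]|/andP[/S xb /S xa]].
    exact: conn_trans xa (conn_trans ab xb).
  by apply: conn_trans xb (conn_trans _ xa); rewrite conn_sym.
move: y; apply: conn_ind; first by rewrite conn_refl.
move=> u v _ H /adjP[c]; rewrite !inE => /orP[/eqP->|cw]; last first.
  move=> /(conn_joins cw) uv.
  move: H => /or3P[h|/andP[h h']|/andP[h h']].
  - by rewrite (conn_trans h uv).
  - by rewrite h (conn_trans h' uv) orbT.
  - by rewrite h (conn_trans h' uv) !orbT.
rewrite /joins => /orP[] /andP[/eqP ? /eqP ?]; subst u v; rewrite conn_refl andbT;
  move: H => /or3P[h|/andP[h h']|/andP[h h']]; rewrite ?h ?conn_refl ?orbT //.
Qed.

Lemma csizeE w x L : csize w x L = count (conn w x) L.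
Proof. by []. Qed.

Lemma csizeS w w' x L : w `<=` w' -> (csize w x L <= csize w' x L)%N.
Proof. by move=> ww'; apply: sub_count => y; exact: connS. Qed.

Lemma csize_eq w x y L : conn w x y -> csize w x L = csize w y L.
Proof. by move=> xy; apply: eq_count; exact: conn_eq. Qed.

Lemma csize_le_size w x L : (csize w x L <= size L)%N.
Proof. exact: count_size. Qed.

Lemma csize_increasing m x L : increasing (fun w => m <= csize w x L)%N.
Proof. by move=> w w' ww' h; apply: leq_trans h (csizeS _ _ ww'). Qed.

Lemma conn_increasing x y : increasing (fun w => conn w x y).
Proof. by move=> w w' ww'; exact: connS. Qed.

(* An inclusion-minimal dangling subgraph with at least [m] marked vertices has
   fewer than [2 m] of them: otherwise remove an edge at its root and keep the
   larger of the two sides. *)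
Lemma dangling_subgraph w u L m : (0 < m)%N -> uniq L -> forall k J v,
  (#|` J| <= k)%N -> J `<=` w -> conn (w `\` J) u v ->
  (forall z, conn w u z -> conn (w `\` J) u z || conn J v z) ->
  (m <= csize J v L)%N ->
  exists J' v', [/\ J' `<=` w,
    (forall z, conn w u z -> conn (w `\` J') u z || conn J' v' z),
    (m <= csize J' v' L)%N & (csize J' v' L < m.*2)%N].
Proof.
move=> m0 uL; elim=> [|k IH] J v Jk Jw uv cov mJ.
  exists J, v; split => //; rewrite (leq_ltn_trans (_ : _ <= 1)%N) //; last by lia.
  move: Jk; rewrite leqn0 cardfs_eq0 => /eqP->.
  have -> : csize fset0 v L = count_mem v L.
    apply: eq_count => y; apply/idP/eqP => [|->]; last exact: conn_refl.
    by move: y; apply: conn_ind => // ? ? _ _ /adjP[].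
  by rewrite count_uniq_mem //; case: (v \in L).
have [lt2m|ge2m] := ltnP (csize J v L) m.*2; first by exists J, v.
(* A cluster reduced to [v] would mark at most one vertex, fewer than [m.*2]; so [v] has an edge in
   [J]. *)
have [f [y [fJ fvy]]] : exists f y, f \in J /\ joins f v y.
  have : has [pred z | (z != v) && conn J v z] L.
    apply/negPn/negP => /hasPn H.
    have : (csize J v L <= count_mem v L)%N.
      have -> : csize J v L = count (predI (conn J v) (mem L)) L.
        by apply: eq_in_count => z zL /=; rewrite zL andbT.
      apply: sub_count => z /= /andP[vz zL].
      by have := H z zL; rewrite /= vz andbT negbK.
    by rewrite count_uniq_mem //; case: (v \in L) => /=; lia.
  move=> /hasP[z _ /andP[zv /asboolP[[|y q] /=]]].
    by move=> _ E0; rewrite E0 eqxx in zv.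
  by move=> /andP[/adjP[f fJ fvy] _] _; exists f, y.
pose J1 := J `\ f.
have J1J : J1 `<=` J by exact: fsubD1set.
have JE : J = f |` J1 by rewrite /J1 fsetD1K.
have J1k : (#|` J1| <= k)%N by move: Jk; rewrite (cardfsD1 f J) fJ /=.

have fw : f \in w by exact: (fsubsetP Jw).
have Jconn z : conn J v z -> conn J1 v z || conn J1 y z.
  rewrite JE conn_add; move: fvy; rewrite /joins => /orP[] /andP[/eqP-> /eqP->].
    by move=> /or3P[->//|/andP[_ ->]|/andP[_ ->]]; rewrite ?orbT.
  by move=> /or3P[->//|/andP[_ ->]|/andP[_ ->]]; rewrite ?orbT.
(* In the first case [f] lies on a cycle, and dropping it keeps the whole cluster of [v]. *)
have [vy|nvy] := boolP (conn J1 v y).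
  have KE z : conn J v z -> conn J1 v z.
    by move=> /Jconn /orP[//|]; exact: conn_trans.
  have sub : w `\` J `<=` w `\` J1 by exact: fsetDS.
  apply: (IH J1 v) => //.
  - exact: fsubset_trans J1J Jw.
  - exact: connS uv.
  - move=> z /cov /orP[/(connS sub) ->//|/KE ->]; exact: orbT.
  - by apply: leq_trans mJ _; apply: sub_count => z; exact: KE.
(* Here [t] and [o] are the ends of [f] in either order. [J2] keeps the edges of [J1] in the cluster
   of [t]; the edge [f] and the side of [o] fall back to the complement, where they stay attached to
   [u]. *)
have step t o : joins f t o -> (conn (w `\` J) u t || conn (w `\` J) u o) ->
    ~~ conn J1 t o -> (forall z, conn J v z -> conn J1 t z || conn J1 o z) ->
    (m <= csize J1 t L)%N ->
    exists J' v', [/\ J' `<=` w,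
    (forall z, conn w u z -> conn (w `\` J') u z || conn J' v' z),
    (m <= csize J' v' L)%N & (csize J' v' L < m.*2)%N].
  move=> fto uto nto Jto mt.
  pose J2 := [fset e in J1 | conn J1 t (a e)].
  have J21 : J2 `<=` J1 by apply/fsubsetP => e; rewrite !inE => /andP[].
  have sub : w `\` J `<=` w `\` J2.
    by apply: fsetDS; exact: fsubset_trans J21 J1J.
  have tz z : conn J1 t z -> conn J2 t z.
    move: z; apply: conn_ind; first exact: conn_refl.
    move=> c d tc tc2 /adjP[e eJ ecd]; apply: conn_trans tc2 _.
    apply: (@conn_joins _ e) => //; rewrite /J2 !inE.
    have := eJ; rewrite /J1 !inE => ->/=.
    have td := conn_trans tc (conn_joins eJ ecd).
    by move: ecd; rewrite /joins => /orP[] /andP[/eqP-> _].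
  have fJ2 : f \in w `\` J2 by rewrite !inE fw !eqxx.
  have to2 : conn (w `\` J2) t o by exact: conn_joins fJ2 fto.
  have ut : conn (w `\` J2) u t.
    move: uto => /orP[/(connS sub)//|/(connS sub) uo].
    by apply: conn_trans uo _; rewrite conn_sym.
  apply: (IH J2 t) => //.
  - exact: leq_trans (fsubset_leq_card J21) J1k.
  - exact: fsubset_trans J21 (fsubset_trans J1J Jw).
  - move=> z /cov /orP[/(connS sub) ->//|/Jto /orP[/tz ->|oz]]; first exact: orbT.
    apply/orP; left; apply: conn_trans ut (conn_trans to2 _).
    move: z oz; apply: conn_ind; first exact: conn_refl.
    move=> c d oc oc2 /adjP[e eJ ecd]; apply: conn_trans oc2 _.
    apply: (@conn_joins _ e) => //; rewrite 2!inE.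
    have ewJ : e \in w by apply: (fsubsetP Jw); exact: (fsubsetP J1J).
    rewrite ewJ andbT; apply/negP; rewrite !inE => /andP[_ te].
    move: nto; rewrite (conn_trans te)// conn_sym.
    have od := conn_trans oc (conn_joins eJ ecd).
    by move: ecd; rewrite /joins => /orP[] /andP[/eqP-> _].
  - by apply: leq_trans mt _; apply: sub_count => z; exact: tz.
(* The two sides share at least [m.*2] marked vertices, so one of them has [m]. *)
have [mv|mv] := leqP m (csize J1 v L).
  by apply: (step v y) => //; rewrite uv.
apply: (step y v) => //.
- by rewrite joinsC.
- by rewrite uv orbT.
- by rewrite conn_sym.
- by move=> z /Jconn; rewrite orbC.
have : (csize J v L <= csize J1 v L + csize J1 y L)%N.
  rewrite /csize -count_predUI; apply: leq_trans (leq_addr _ _).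
  by apply: sub_count => z /=; exact: Jconn.
lia.
Qed.

(** A dangling piece with fewer than 2 m of the 3 m marked vertices leaves more than m of them
    connected to [u] in the complement, which serves as the other, disjoint, edge set. *)
Lemma tree_split w u L m : (0 < m)%N -> uniq L -> (3 * m <= csize w u L)%N ->
  exists I J, [/\ I `<=` w, J `<=` w, [disjoint I & J]%fset &
    ((m <= csize I u L) && has (fun v => m <= csize J v L) L)%N].
Proof.
move=> m0 uL m3.
have [||//|J [v [Jw cov mJ J2m]]] := @dangling_subgraph w u L m m0 uL #|` w| w u (leqnn _) (fsubset_refl _).
- exact: conn_refl.
- by move=> z ->; rewrite orbT.
- by apply: leq_trans m3; rewrite leq_pmull.
exists (w `\` J), J; split => //; first exact: fsubsetDl.
  by apply/fdisjointP => x; rewrite inE => /andP[].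
apply/andP; split.
  have : (csize w u L <= csize (w `\` J) u L + csize J v L)%N.
    rewrite /csize -count_predUI; apply: leq_trans (leq_addr _ _).
    by apply: sub_count => z /=; exact: cov.
  lia.
(* The root [v] need not be in [L]; it is exchanged for a marked vertex of its cluster. *)
have : has (conn J v) L by rewrite has_count; exact: leq_trans m0 mJ.
move=> /hasP[z zL vz]; apply/hasP; exists z => //.
by rewrite -(csize_eq _ vz).
Qed.

End Connectivity.

(** * Tightness of the cluster size in a finite set *)

Lemma count_sum (T : Type) (P : pred T) (r : seq T) :
  (count P r = \sum_(x <- r) P x)%N.
Proof. by elim: r => [|x r IH]; rewrite ?big_nil // big_cons -IH. Qed.

Section Tightness.
Context {R : realType} {V E : choiceType} (a b : E -> V).
Context (p : E -> R) (p01 : prob p).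
Implicit Types (s : seq E) (w : {fset E}) (L : seq V).

Local Notation csize := (csize a b).

Lemma Pr_disjoint_occurrence s (A B C : {fset E} -> bool) : uniq s ->
  increasing B -> increasing C ->
  (forall w, {subset w <= s} -> A w ->
    exists I J, [/\ I `<=` w, J `<=` w, [disjoint I & J]%fset & B I && C J]) ->
  Pr p s A <= Pr p s B * Pr p s C.
Proof.
move=> us Bi Ci H.
have -> : Pr p s B * Pr p s C = Ex p s (fun w1 => Pr p s (fun w2 => B w1 && C w2)).
  rewrite mulrC /Pr -ExZ; apply: Ex_eq => w1 _.
  rewrite mulrC -ExZ; apply: Ex_eq => w2 _.
  by rewrite -natrM mulnb.
apply: le_trans (Pr_BK p01 _ us).
  by apply: Pr_sub => // w ws /(H w ws) ?; apply/asboolP.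
move=> w1 w1' w2 w2' h1 h2 /andP[b1 c2].
by rewrite (Bi _ _ h1 b1) (Ci _ _ h2 c2).
Qed.

Lemma has_csize_increasing m L :
  increasing (fun w => has (fun v => m <= csize w v L)%N L).
Proof.
move=> w w' ww' /hasP[v vL mv]; apply/hasP; exists v => //.
exact: csize_increasing ww' mv.
Qed.

Lemma Pr_csize_split s u L m : uniq s -> uniq L -> (0 < m)%N ->
  Pr p s (fun w => 3 * m <= csize w u L)%N <=
  Pr p s (fun w => m <= csize w u L)%N *
  Pr p s (fun w => has (fun v => m <= csize w v L)%N L).
Proof.
move=> us uL m0; apply: Pr_disjoint_occurrence => //.
- exact: csize_increasing.
- exact: has_csize_increasing.
by move=> w _; exact: tree_split.
Qed.

Lemma sum_leq_nat i k c : (\sum_(i <= j < k) (j <= c) = minn c.+1 k - i)%N.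
Proof.
elim: k => [|k IH]; first by rewrite big_geq // minn0.
have [ik|ki] := leqP i k; last by rewrite big_geq //; lia.
by rewrite big_nat_recr //= IH; case: leqP => /=; lia.
Qed.

Lemma Ex_nat_tail s (c : {fset E} -> nat) N :
  (forall w, {subset w <= s} -> (c w <= N)%N) ->
  Ex p s (fun w => (c w)%:R) = \sum_(1 <= j < N.+1) Pr p s (fun w => j <= c w)%N.
Proof.
move=> cN; rewrite -Ex_sum; apply: Ex_eq => w /cN cwN.
rewrite -natr_sum sum_leq_nat; congr _%:R; lia.
Qed.

(** Levels from 3 m0 on are grouped in threes. Splitting gives P(size >= 3 m) <= P(size >= m) / 6
    for m >= m0, so these levels contribute at most 3/6 of the expectation itself, which is absorbed
    in the left-hand side. *)
Lemma Ex_csize_tight s u L m0 : uniq s -> uniq L -> (0 < m0)%N ->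
  Pr p s (fun w => has (fun v => m0 <= csize w v L)%N L) <= 6^-1 ->
  Ex p s (fun w => (csize w u L)%:R) <=
  2 * \sum_(1 <= j < 3 * m0) Pr p s (fun w => j <= csize w u L)%N.
Proof.
move=> us uL m0_gt0 q6; set N := size L.
set S := \sum_(1 <= j < 3 * m0) _; set c := Ex _ _ _.
have cE : c = \sum_(1 <= j < N.+1) Pr p s (fun w => j <= csize w u L)%N.
  by apply: Ex_nat_tail => w _; exact: csize_le_size.
have h1 : c <= S + 3 * \sum_(m0 <= m < N.+1) Pr p s (fun w => 3 * m <= csize w u L)%N.
  rewrite /S -!Ex_sum -ExZ -ExD; apply: Ex_le => // w _.
  rewrite -!natr_sum -natrM -natrD ler_nat.
  have cN : (csize w u L <= N)%N by exact: csize_le_size.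
  have -> : (\sum_(m0 <= m < N.+1) (3 * m <= csize w u L) =
             \sum_(m0 <= m < N.+1) (m <= csize w u L %/ 3))%N.
    by apply: eq_bigr => m _; rewrite leq_divRL 1?mulnC.
  rewrite !sum_leq_nat; lia.
have h2 : \sum_(m0 <= m < N.+1) Pr p s (fun w => 3 * m <= csize w u L)%N <=
    6^-1 * \sum_(m0 <= m < N.+1) Pr p s (fun w => m <= csize w u L)%N.
  rewrite mulr_sumr; apply: ler_sum_nat => m /andP[m0m _].
  have mgt0 : (0 < m)%N by lia.
  apply: le_trans (Pr_csize_split u us uL mgt0) _.
  rewrite mulrC; apply: ler_wpM2r; first exact: Pr_ge0.
  apply: le_trans q6; apply: Pr_sub => // w _ /hasP[v vL mv].
  by apply/hasP; exists v => //; exact: leq_trans mv.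
have h3 : \sum_(m0 <= m < N.+1) Pr p s (fun w => m <= csize w u L)%N <= c.
  have [m0N|Nm0] := leqP m0 N.+1; last first.
    by rewrite big_geq ?cE ?sumr_ge0//; [move=> *; exact: Pr_ge0|exact: ltnW].
  rewrite cE [leRHS](@big_cat_nat _ _ _ m0) //= lerDr; apply: sumr_ge0 => *; exact: Pr_ge0.
lra.
Qed.

(** A cluster with at least [m] marked vertices contributes each of them to the sum on the right. *)
Lemma Pr_has_csize_markov s L m :
  m%:R * Pr p s (fun w => has (fun v => m <= csize w v L)%N L) <=
  \sum_(v <- L) Pr p s (fun w => m <= csize w v L)%N.
Proof.
rewrite -ExZ -Ex_sum; apply: Ex_le => // w _.
rewrite -natrM -natr_sum ler_nat; case: hasP => [[v vL mv]|_] /=; last by rewrite muln0.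
rewrite muln1 -count_sum; apply: leq_trans (mv) _; apply: sub_count => y vy.
by rewrite /= -(csize_eq _ vy).
Qed.

End Tightness.

(** * Distinct large clusters *)

Section LargeDistinctClusters.
Context {R : realType} {V E : choiceType} (a b : E -> V).
Context (p : E -> R) (p01 : prob p).
Implicit Types (s : seq E) (w : {fset E}) (X : seq V).

Local Notation csize := (csize a b).
Local Notation conn := (conn a b).

Definition distinct_large n X e w :=
  [&& ~~ conn w (a e) (b e), n <= csize w (a e) X & n <= csize w (b e) X]%N.

Definition touches w v e := conn w v (a e) || conn w v (b e).

(** Telescoping of 1/k - 1/(k+1). The weight 1/max(n, t) becomes a nonnegative combination of the
    truncations [t <= k], which the exploration can handle. *)
Lemma inv_maxn_sum n t N : (0 < n)%N -> (maxn n t <= N)%N ->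
  (maxn n t)%:R^-1 =
  \sum_(n <= k < N) (t <= k)%:R / (k * k.+1)%:R + N%:R^-1 :> R.
Proof.
move=> n0; elim: N => [|N IH]; first by rewrite leqn0; lia.
rewrite leq_eqVlt ltnS => /orP[/eqP mN|mN].
  rewrite big_nat big1 ?add0r ?mN // => k /andP[nk kN].
  have -> : (t <= k)%N = false by apply/negbTE; lia.
  by rewrite mul0r.
rewrite big_nat_recr /= -?IH //; last by lia.
have -> : (t <= N)%N by lia.
rewrite IH // -!addrA; congr (_ + _).
have N0 : N%:R != 0 :> R by rewrite pnatr_eq0; lia.
have N1 : N.+1%:R != 0 :> R by rewrite pnatr_eq0.
rewrite natrM -natr1 in N1 *.
by rewrite /= mulr1n; field; rewrite N0 N1.
Qed.

Lemma sum_conn w x X (g : nat -> R) :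
  \sum_(v <- X) (conn w v x)%:R * g (csize w v X) = (csize w x X)%:R * g (csize w x X).
Proof.
have -> : (csize w x X)%:R = \sum_(v <- X) (conn w x v)%:R :> R.
  by rewrite csizeE count_sum natr_sum.
rewrite mulr_suml; apply: eq_bigr => v _.
rewrite conn_sym; have [xv|] := boolP (conn w x v); last by rewrite !mul0r.
by rewrite (csize_eq _ xv).
Qed.

Lemma csize_add w e X : ~~ conn w (a e) (b e) ->
  csize (e |` w) (a e) X = (csize w (a e) X + csize w (b e) X)%N.
Proof.
move=> nab; rewrite /csize -count_predUI [X in (_ + X)%N](_ : _ = 0)%N.
  rewrite addn0; apply: eq_count => y; rewrite conn_add conn_refl /=.
  by rewrite (negbTE nab) /= orbF.
apply/eqP; rewrite -leqn0 leqNgt -has_count; apply/hasPn => y _ /=.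
apply: contra nab => /andP[ay bby]; apply: conn_trans ay _.
by rewrite conn_sym.
Qed.

(** Every vertex of a cluster of size c carries the weight 1/max(n, c), so the cluster weighs
    c/max(n, c) = min(c/n, 1). The sum is the weight of the one or two clusters at the ends of
    [e]. *)
Lemma sum_touches w e X n : \sum_(v <- X) (touches w v e)%:R / (maxn n (csize w v X))%:R =
  (csize w (a e) X)%:R / (maxn n (csize w (a e) X))%:R +
  (~~ conn w (a e) (b e))%:R * ((csize w (b e) X)%:R / (maxn n (csize w (b e) X))%:R) :> R.
Proof.
have [ab|nab] := boolP (conn w (a e) (b e)); rewrite /= ?mul0r ?addr0 ?mul1r.
  rewrite -(sum_conn _ _ _ (fun c => (maxn n c)%:R^-1)).
  apply: eq_bigr => v _; rewrite /touches.
  by rewrite 2!(conn_sym _ _ _ v) -(conn_eq ab) orbb.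
rewrite -!(sum_conn _ _ _ (fun c => (maxn n c)%:R^-1)) -big_split /=.
apply: eq_bigr => v _; rewrite -mulrDl -natrD; congr (_%:R / _).
rewrite /touches; have [va|] := boolP (conn w v (a e)) => //=.
have [vb|//] := boolP (conn w v (b e)).
by rewrite (conn_trans _ vb) // conn_sym in nab.
Qed.

Lemma truncated_subadditive n (x y : nat) : (0 < n)%N ->
  (((n <= x) && (n <= y))%N)%:R <=
  x%:R / (maxn n x)%:R + y%:R / (maxn n y)%:R - (x + y)%:R / (maxn n (x + y))%:R :> R.
Proof.
move=> n0.
have n0R : 0 < n%:R :> R by rewrite ltr0n.
have F c : c%:R / (maxn n c)%:R = if (n <= c)%N then 1 else c%:R / n%:R :> R.
  case: leqP => // nc; rewrite divff // pnatr_eq0; lia.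
have lt1 c : (c < n)%N -> c%:R / n%:R <= 1 :> R.
  by move=> cn; rewrite ler_pdivrMr // mul1r ler_nat ltnW.
have ge0 c : 0 <= c%:R / n%:R :> R by rewrite divr_ge0.
rewrite !F; case: (leqP n x) => nx; case: (leqP n y) => ny /=.
- by rewrite (_ : (n <= x + y)%N) //; [lra|lia].
- by rewrite (_ : (n <= x + y)%N) //; [have := ge0 y; lra|lia].
- by rewrite (_ : (n <= x + y)%N) //; [have := ge0 x; lra|lia].
case: leqP => nxy; last by rewrite natrD mulrDl subrr.
rewrite -mulrDl subr_ge0 ler_pdivlMr // mul1r -natrD ler_nat.
exact: nxy.
Qed.

(** Given the other edges, averaging p e - 1{e open} over the state of [e] yields p e (1 - p e)
    times the weight lost when [e] is opened. Only a merging of two clusters loses weight. *)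
Lemma Pr_distinct_large_edge s X n e : (0 < n)%N -> uniq s -> e \in s ->
  p e * Pr p s (distinct_large n X e) <=
  Ex p s (fun w => (p e - (e \in w)%:R) *
    \sum_(v <- X) (touches w v e)%:R / (maxn n (csize w v X))%:R).
Proof.
move=> n0 us es; have /andP[p0 p1] := p01 e.
have es' w : {subset w <= rem e s} -> e \notin w.
  by move=> ws; apply/negP => /ws; rewrite mem_rem_uniqF.
rewrite /Pr !(Ex_rem _ _ es) /=.
have -> : Ex p (rem e s) (fun w => (distinct_large n X e (e |` w))%:R) = 0 :> R.
  rewrite -[RHS](Ex_cst p (rem e s)); apply: Ex_eq => w _.
  by rewrite /distinct_large conn_edge // !inE eqxx.
rewrite mulr0 add0r -!ExZ -ExD; apply: Ex_le => // w /es' ew.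
rewrite !inE eqxx (negbTE ew) /= subr0 !sum_touches.
rewrite conn_edge ?mul0r ?addr0 ?inE ?eqxx //=.
have [ab|nab] := boolP (conn w (a e) (b e)).
  have -> : csize (e |` w) (a e) X = csize w (a e) X.
    apply: eq_count => y; rewrite conn_add conn_refl /= ab /=.
    by rewrite conn_sym in ab; rewrite -(conn_eq ab) !orbb.
  rewrite /distinct_large ab /= !(mulr0, mul0r, addr0).
  set x := _ / _; lra.
rewrite csize_add // /distinct_large nab /= mul1r.
have := truncated_subadditive (csize w (a e) X) (csize w (b e) X) n0.
set f := _ + _ - _ => hf.
have : 0 <= p e * (1 - p e) by apply: mulr_ge0 => //; lra.
move=> /ler_wpM2l /(_ _ _ hf); rewrite /f; lra.
Qed.

Lemma Pr_distinct_large_sum s X n (t : E -> R) : (0 < n)%N -> uniq s ->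
  (forall e, 0 <= t e) ->
  \sum_(e <- s) t e * p e * Pr p s (distinct_large n X e) <=
  \sum_(v <- X) Ex p s (fun w => (maxn n (csize w v X))%:R^-1 *
    \sum_(e <- s | touches w v e) t e * (p e - (e \in w)%:R)).
Proof.
move=> n0 us t0; rewrite -Ex_sum.
apply: le_trans (_ : \sum_(e <- s) Ex p s (fun w => t e * ((p e - (e \in w)%:R) *
    \sum_(v <- X) (touches w v e)%:R / (maxn n (csize w v X))%:R)) <= _).
  rewrite !big_seq; apply: ler_sum => e es.
  by rewrite ExZ -mulrA; apply: ler_wpM2l (Pr_distinct_large_edge _ _ _ _).
rewrite -Ex_sum le_eqVlt; apply/orP; left; apply/eqP; apply: Ex_eq => w _.
rewrite [RHS](eq_bigr (fun v => \sum_(e <- s) (maxn n (csize w v X))%:R^-1 * ((touches w v e)%:R *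
  (t e * (p e - (e \in w)%:R))))); last first.
  move=> v _; rewrite -mulr_sumr big_mkcond; congr (_ * _); apply: eq_bigr => e _.
  by case: touches; rewrite ?mul1r ?mul0r.
rewrite exchange_big /=; apply: eq_bigr => e _.
by rewrite mulrA mulr_sumr; apply: eq_bigr => v _; ring.
Qed.

End LargeDistinctClusters.

(** * Cluster exploration as a martingale *)

Section Exploration.
Context {R : realType} {V E : choiceType} (a b : E -> V).
Context (p : E -> R) (p01 : prob p).
Implicit Types (s : seq E) (w : {fset E}) (X : seq V) (A : {fset V}).

Local Notation csize := (csize a b).
Local Notation conn := (conn a b).
Local Notation touches := (touches a b).

Definition reach w A x := has (fun y => conn w y x) A.

Definition incident A e := (a e \in A) || (b e \in A).

Lemma reachP w A x : reflect (exists2 y, y \in A & conn w y x) (reach w A x).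
Proof. exact: hasP. Qed.

Lemma reach_self w A x : x \in A -> reach w A x.
Proof. by move=> xA; apply/reachP; exists x => //; exact: conn_refl. Qed.

Lemma reach_add w e A x : incident A e ->
  reach (e |` w) A x = reach w (a e |` (b e |` A)) x.
Proof.
move=> eA.
have up y : conn w y x -> conn (e |` w) y x by apply: connS; exact: fsubsetU1.
have ab : conn (e |` w) (a e) (b e) by apply: conn_edge; rewrite !inE eqxx.
apply/reachP/reachP => [[y yA]|[y yA /up yx]].
  rewrite conn_add => /or3P[yx|/andP[_ bx]|/andP[_ ax]].
  - by exists y => //; rewrite !inE yA !orbT.
  - by exists (b e) => //; rewrite !inE eqxx orbT.
  - by exists (a e) => //; rewrite !inE eqxx.
move: yA; rewrite !inE => /or3P[/eqP ye|/eqP ye|yA]; last by exists y.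
  by move: eA => /orP[aA|bA]; [exists (a e)|exists (b e)] => //;
    rewrite -?ye // -(conn_eq ab) -ye.
by move: eA => /orP[aA|bA]; [exists (a e)|exists (b e)] => //;
  rewrite -?ye // (conn_eq ab) -ye.
Qed.

Lemma reach_closed w A x : (forall e, e \in w -> ~~ incident A e) ->
  reach w A x -> x \in A.
Proof.
move=> H /reachP[y yA]; move: x; apply: conn_ind => // u v _ uA /adjP[e ew].
move: (H e ew); rewrite /incident negb_or => /andP[aA bA].
by move=> /orP[] /andP[/eqP ea /eqP eb]; subst u v; rewrite ?uA in aA bA.
Qed.

(* [D] is the martingale of the exploration of the clusters meeting [A], run
   until more than [k] vertices have been found; [B] is the set of vertices
   whose edges have been inspected. *)
Lemma exploration (t : E -> R) X k n s A : size s = n -> uniq s -> uniq X ->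
  (forall e, 0 <= t e) ->
  (forall e, e \in s -> (a e \in X) && (b e \in X)) ->
  {subset A <= X} -> (#|` A| <= k)%N ->
  exists (D : {fset E} -> R) (B : {fset E} -> {fset V}),
  [/\ Ex p s D = 0,
      Ex p s (fun w => D w ^+ 2) <=
        Ex p s (fun w => \sum_(e <- s | incident (B w) e) t e ^+ 2 * p e),
      (forall w, {subset w <= s} -> [/\ (#|` B w| <= k)%N, {subset A <= B w} &
         forall x, x \in B w -> reach w A x]) &
      (forall w, {subset w <= s} -> (count (reach w A) X <= k)%N ->
         D w = \sum_(e <- s | reach w A (a e) || reach w A (b e))
                 t e * ((e \in w)%:R - p e))].
Proof.
move=> + + uX t0; elim: n s A => [|n IH] s A sn us sX AX Ak.
  move: sn us sX => /size0nil -> _ _.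
  exists (fun=> 0), (fun=> A); split => /=.
  - by [].
  - by rewrite big_nil expr0n.
  - by move=> w ws; split => // x; exact: reach_self.
  - by move=> w _ _; rewrite big_nil.
(* An edge meeting [A] is inspected; without one the exploration is over and nothing is added to
   [D]. *)
have [/hasP[e es eA]|/hasPn nA] := boolP (has (incident A) s); last first.
  exists (fun=> 0), (fun=> A); split => /=.
  - by rewrite Ex_cst.
  - rewrite expr0n; apply: Ex_le => // w _; apply: sumr_ge0 => e _.
    by apply: mulr_ge0; [exact: sqr_ge0|have /andP[] := p01 e].
  - by move=> w ws; split => // x; exact: reach_self.
  - move=> w ws _; rewrite big_seq_cond big_pred0 // => e.
    apply/negbTE; rewrite negb_and; have [es|//] := boolP (e \in s) => /=.
    have cl x : reach w A x -> x \in A by apply: reach_closed => c /ws /nA.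
    by have := nA e es; apply: contra => /orP[/cl aA|/cl bA]; rewrite /incident ?aA ?bA ?orbT.
set s' := rem e s.
have us' : uniq s' by exact: rem_uniq.
have s's : {subset s' <= s} by exact: mem_rem.
have ss' : size s' = n by rewrite /s' size_rem // sn.
have es' : e \notin s' by rewrite /s' mem_rem_uniqF.
have s'X c : c \in s' -> (a c \in X) && (b c \in X) by move=> /s's /sX.
have /andP[aX bX] := sX e es.
have /andP[p0 p1] := p01 e.
have ew w : {subset w <= s'} -> e \notin w by move=> ws; apply: contra es' => /ws.
have dw w : {subset w <= s'} -> (e |` w) `\ e = w by move=> /ew; exact: fsetU1K.
have sumS (Q : pred E) (F : E -> R) :
    \sum_(c <- s | Q c) F c = (Q e)%:R * F e + \sum_(c <- s' | Q c) F c.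
  rewrite (perm_big _ (perm_to_rem es)) big_cons /=.
  by case: (Q e); rewrite ?mul1r // mul0r add0r.
have [D0 [B0 [D00 D0v B0P D0E]]] := IH s' A ss' us' s'X AX Ak.
have [D1 [B1 [D10 D1v B1P D1E]]] :
  exists (D1 : {fset E} -> R) (B1 : {fset E} -> {fset V}),
  [/\ Ex p s' D1 = 0,
      Ex p s' (fun w => D1 w ^+ 2) <=
        Ex p s' (fun w => \sum_(c <- s' | incident (B1 w) c) t c ^+ 2 * p c),
      (forall w, {subset w <= s'} -> [/\ (#|` B1 w| <= k)%N, {subset A <= B1 w} &
         forall x, x \in B1 w -> reach (e |` w) A x]) &
      (forall w, {subset w <= s'} -> (count (reach (e |` w) A) X <= k)%N ->
         D1 w = \sum_(c <- s' | reach (e |` w) A (a c) || reach (e |` w) A (b c))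
                 t c * ((c \in w)%:R - p c))].
  set A1 := a e |` (b e |` A).
  have A1X : {subset A1 <= X} by move=> x; rewrite !inE => /or3P[/eqP->|/eqP->|/AX].
  have AA1 : {subset A <= A1} by move=> x xA; rewrite !inE xA !orbT.
  have [A1k|kA1] := leqP #|` A1| k.
    have [D1 [B1 [D10 D1v B1P D1E]]] := IH s' A1 ss' us' s'X A1X A1k.
    exists D1, B1; split => //.
      move=> w ws; have [Bk AB Br] := B1P w ws; split => //.
        by move=> x /AA1 /AB.
      by move=> x /Br; rewrite reach_add.
    move=> w ws; rewrite (eq_count (fun x => reach_add w x eA)) => /(D1E w ws) ->.
    by apply: eq_bigl => c; rewrite !reach_add.
  (* Too many vertices have been found, and the exploration stops. The formula for [D1] is then
     vacuous, since all of [A1] is reached. *)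
  exists (fun=> 0), (fun=> A); split => /=.
  - by rewrite Ex_cst.
  - rewrite expr0n; apply: Ex_le => // w _; apply: sumr_ge0 => c _.
    by apply: mulr_ge0; [exact: sqr_ge0|have /andP[] := p01 c].
  - by move=> w ws; split => // x; exact: reach_self.
  move=> w ws; rewrite (eq_count (fun x => reach_add w x eA)) leqNgt => /negP[].
  apply: leq_trans kA1 _; rewrite -size_filter.
  apply: uniq_leq_size; first exact: fset_uniq.
  by move=> x xA1; rewrite mem_filter A1X // reach_self.
(* The increment of [e] has mean zero, and the exploration continues according to the state of
   [e]. *)
exists (fun w => t e * ((e \in w)%:R - p e) + if e \in w then D1 (w `\ e) else D0 w).
exists (fun w => if e \in w then B1 (w `\ e) else B0 w).
have E1 w : e \in e |` w by rewrite !inE eqxx.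
split.
- rewrite (Ex_rem _ _ es) /= -/s'.
  rewrite (@Ex_eq _ _ _ _ _ (fun w => t e * (1 - p e) + D1 w)); last first.
    by move=> w ws; rewrite E1 dw.
  rewrite [X in _ + _ * X = _](@Ex_eq _ _ _ _ _ (fun w => t e * (0 - p e) + D0 w)); last first.
    by move=> w /ew /negbTE ->.
  rewrite !ExD !Ex_cst D10 D00; ring.
- rewrite !(Ex_rem _ _ es) /= -/s'.
  rewrite (@Ex_eq _ _ _ _ _ (fun w => (t e * (1 - p e)) ^+ 2 + (2 * (t e * (1 - p e)) * D1 w + D1 w ^+ 2))); last first.
    by move=> w ws; rewrite E1 dw //=; ring.
  rewrite [X in _ + _ * X <= _](@Ex_eq _ _ _ _ _ (fun w => (t e * p e) ^+ 2 + (2 * (t e * - p e) * D0 w + D0 w ^+ 2))); last first.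
    by move=> w /ew /negbTE -> /=; ring.
  rewrite !ExD !ExZ !Ex_cst D10 D00 !mulr0 !add0r.
  have inc1 w : {subset w <= s'} -> incident (B1 w) e.
    by move=> /B1P[_ AB _]; move: eA => /orP[/AB|/AB]; rewrite /incident => ->; rewrite ?orbT.
  have inc0 w : {subset w <= s'} -> incident (B0 w) e.
    by move=> /B0P[_ AB _]; move: eA => /orP[/AB|/AB]; rewrite /incident => ->; rewrite ?orbT.
  rewrite [X in _ <= _ * X + _](@Ex_eq _ _ _ _ _ (fun w => t e ^+ 2 * p e + \sum_(c <- s' | incident (B1 w) c) t c ^+ 2 * p c)); last first.
    by move=> w ws; rewrite E1 dw // sumS inc1 // mul1r.
  rewrite [X in _ <= _ + _ * X](@Ex_eq _ _ _ _ _ (fun w => t e ^+ 2 * p e + \sum_(c <- s' | incident (B0 w) c) t c ^+ 2 * p c)); last first.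
    by move=> w ws; rewrite (negbTE (ew w ws)) sumS inc0 // mul1r.
  rewrite !ExD !Ex_cst.
  have q0 : 0 <= 1 - p e by lra.
  have := ler_wpM2l p0 D1v; have := ler_wpM2l q0 D0v.
  (* The increment has variance t^2 p (1 - p), which is t^2 p minus this term; the cross terms
     vanished with the means of [D0] and [D1]. *)
  have : 0 <= t e ^+ 2 * p e ^+ 2 by apply: mulr_ge0; exact: sqr_ge0.
  lra.
- move=> w ws; have [ewi|ewi] := boolP (e \in w).
    have w's : {subset w `\ e <= s'}.
      by move=> x; rewrite !inE => /andP[xe /ws]; rewrite /s' mem_rem_uniq // inE xe.
    by have [? ? H] := B1P _ w's; split => // x /H; rewrite fsetD1K.
  apply: B0P => x xw; rewrite /s' mem_rem_uniq // inE ws // andbT.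
  by apply: contraTneq xw => ->.
- move=> w ws; have [ewi|ewi] := boolP (e \in w); rewrite sumS.
    have w's : {subset w `\ e <= s'}.
      by move=> x; rewrite !inE => /andP[xe /ws]; rewrite /s' mem_rem_uniq // inE xe.
    have -> : reach w A (a e) || reach w A (b e).
      by move: eA => /orP[] /(reach_self w) ->; rewrite ?orbT.
    move: (D1E _ w's); rewrite fsetD1K // => /[apply] ->.
    rewrite mul1r ewi; congr (_ + _).
    rewrite big_seq_cond [RHS]big_seq_cond; apply: eq_bigr => c /andP[cs' _].
    by rewrite !inE; have [ce|//] := eqVneq c e; rewrite -ce cs' in es'.
  have w's : {subset w <= s'}.
    move=> x xw; rewrite /s' mem_rem_uniq // inE ws // andbT.
    by apply: contraTneq xw => ->.
  have -> : reach w A (a e) || reach w A (b e).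
    by move: eA => /orP[] /(reach_self w) ->; rewrite ?orbT.
  by move=> /(D0E _ w's) ->; rewrite mul1r (negbTE ewi).
Qed.

End Exploration.

(** * Two distinct large clusters: the second-moment bound *)

Section TwoGhost.
Context {R : realType} {V E : choiceType} (a b : E -> V).
Context (p : E -> R) (p01 : prob p) (s : seq E) (X : seq V) (t : E -> R) (lam : R).
Hypotheses (us : uniq s) (uX : uniq X) (t0 : forall e, 0 <= t e).
Hypothesis sX : forall e, e \in s -> (a e \in X) && (b e \in X).
Hypothesis lamP : forall x, x \in X ->
  \sum_(e <- s | (a e == x) || (b e == x)) t e ^+ 2 * p e <= lam.

Local Notation csize := (csize a b).
Local Notation conn := (conn a b).
Local Notation touches := (touches a b).

(** On size <= k the score is -D; as D has mean zero, the expectation equals that of D on size > k,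
    and Cauchy-Schwarz applies. The variance is at most [lam] per inspected vertex, and these number
    at most min(size, k). *)
Lemma Ex_score_truncated v k : v \in X -> (0 < k)%N ->
  Ex p s (fun w => (csize w v X <= k)%N%:R *
    \sum_(e <- s | touches w v e) t e * (p e - (e \in w)%:R)) <=
  Num.sqrt (lam * Ex p s (fun w => (minn (csize w v X) k)%:R) *
            Pr p s (fun w => k < csize w v X)%N).
Proof.
move=> vX k0.
have AX : {subset [fset v] <= X} by move=> x; rewrite inE => /eqP->.
have Ak : (#|` [fset v]| <= k)%N by rewrite cardfs1.
have [D [B [D0 Dv BP DE]]] := @exploration _ _ _ a b _ p01 t X k _ s [fset v]
  erefl us uX t0 sX AX Ak.
have rE w x : reach a b w [fset v] x = conn w v x.
  apply/reachP/idP => [[y yv yx]|vx]; last by exists v; rewrite ?in_fset1.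
  by move: yv; rewrite in_fset1 => /eqP <-.
have cE w : count (reach a b w [fset v]) X = csize w v X.
  by rewrite csizeE; apply: eq_count.
have lam0 : 0 <= lam.
  apply: le_trans (lamP vX); apply: sumr_ge0 => e _.
  by apply: mulr_ge0; [exact: sqr_ge0|have /andP[] := p01 e].
rewrite (@Ex_eq _ _ _ _ _ (fun w => (k < csize w v X)%N%:R * D w - D w)); last first.
  move=> w ws; case: leqP => kc; rewrite ?mul0r ?mul1r ?subrr // sub0r.
  rewrite DE ?cE // -sumrN [RHS](eq_bigl (touches w v)); last by move=> e; rewrite !rE.
  by apply: eq_bigr => e _; rewrite -mulrN opprB.
rewrite ExB D0 subr0.
apply: le_trans (ler_norm _) _; rewrite -sqrtr_sqr; apply: ler_wsqrtr.
apply: le_trans (Ex_CauchySchwarz _ _ _ p01) _; rewrite mulrC.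
have -> : Ex p s (fun w => (k < csize w v X)%N%:R ^+ 2) = Pr p s (fun w => k < csize w v X)%N.
  by apply: Ex_eq => w _; case: (_ < _)%N; rewrite ?expr1n ?expr0n.
apply: ler_wpM2r; first exact: Pr_ge0.
apply: le_trans Dv _; rewrite -ExZ; apply: Ex_le => // w ws.
have [Bk AB Br] := BP w ws.
have BX x : x \in B w -> x \in X.
  by move=> /Br; rewrite rE; apply: conn_in ws sX vX.
have Bc : (#|` B w| <= csize w v X)%N.
  rewrite csizeE -size_filter; apply: uniq_leq_size; first exact: fset_uniq.
  by move=> x xB; rewrite mem_filter BX // -rE Br.
apply: (@le_trans _ _ (\sum_(x <- B w) lam)); last first.
  rewrite big_const_seq iter_addr addr0 count_predT -[lam *+ _]mulr_natr.
  by apply: ler_wpM2l => //; rewrite ler_nat leq_min Bc.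
(* Each edge incident to [B w] is charged to an endpoint in [B w]. *)
apply: (@le_trans _ _ (\sum_(x <- B w) \sum_(e <- s | (a e == x) || (b e == x)) t e ^+ 2 * p e)).
  rewrite (exchange_big_dep xpredT) //= big_mkcond; apply: ler_sum => e _.
  have g0 : 0 <= t e ^+ 2 * p e by apply: mulr_ge0; [exact: sqr_ge0|have /andP[] := p01 e].
  case: ifPn => [ince|_]; last exact: sumr_ge0.
  have [x xB ex] : exists2 x, x \in B w & (a e == x) || (b e == x).
    by move: ince => /orP[aB|bB]; [exists (a e)|exists (b e)]; rewrite ?eqxx ?orbT.
  by rewrite (big_rem x) //= ex lerDl; apply: sumr_ge0.
by rewrite !big_seq; apply: ler_sum => x /BX /lamP.
Qed.

Lemma Pr_distinct_large_le n : (0 < n)%N ->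
  \sum_(e <- s) t e * p e * Pr p s (distinct_large a b n X e) <=
  \sum_(v <- X) \sum_(n <= k < size X) (k * k.+1)%:R^-1 *
    Num.sqrt (lam * Ex p s (fun w => (minn (csize w v X) k)%:R) *
              Pr p s (fun w => k < csize w v X)%N).
Proof.
move=> n0; have [Nn|nN] := ltnP (size X) n.
  rewrite [leLHS]big1; first last.
    move=> e _; rewrite [X in _ * X](_ : _ = 0) ?mulr0 //.
    rewrite -[RHS](Ex_cst p s); apply: Ex_eq => w _; rewrite /distinct_large.
    have := csize_le_size a b w (a e) X.
    by case: (leqP n (csize w (a e) X)) => [?|]; [lia|rewrite /= andbF].
  apply: sumr_ge0 => v _; apply: sumr_ge0 => k _.
  by apply: mulr_ge0; rewrite ?invr_ge0 ?ler0n ?sqrtr_ge0.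
apply: (le_trans (Pr_distinct_large_sum a b p01 X n0 us t0)).
rewrite !big_seq; apply: ler_sum => v vX.
set h := fun w => \sum_(e <- s | touches w v e) t e * (p e - (e \in w)%:R).
have -> : Ex p s (fun w => (maxn n (csize w v X))%:R^-1 * h w) =
   \sum_(n <= k < size X) (k * k.+1)%:R^-1 * Ex p s (fun w => (csize w v X <= k)%N%:R * h w) +
   (size X)%:R^-1 * Ex p s (fun w => (csize w v X <= size X)%N%:R * h w).
  rewrite -ExZ -(eq_bigr _ (fun k _ => ExZ _ _ _ _)) -Ex_sum -ExD.
  apply: Ex_eq => w _.
  rewrite (@inv_maxn_sum R n (csize w v X) (size X)) //; last first.
    by rewrite geq_max nN csize_le_size.
  rewrite mulrDl csize_le_size mul1r; congr (_ + _).
  by rewrite mulr_suml; apply: eq_bigr => k _; ring.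
rewrite -[leRHS]addr0; apply: lerD.
  apply: ler_sum_nat => k /andP[nk kN].
  apply: ler_wpM2l; first by rewrite invr_ge0.
  by apply: Ex_score_truncated => //; exact: leq_trans nk.
(* The boundary term of the telescoping sum: no cluster has more than [size X] vertices in [X], so
   its square root is zero. *)
rewrite -(mulr0 (size X)%:R^-1); apply: ler_wpM2l; first by rewrite invr_ge0.
apply: le_trans (Ex_score_truncated vX (leq_trans n0 nN)) _.
rewrite [X in _ * X](_ : _ = 0) ?mulr0 ?sqrtr0 //.
rewrite -[RHS](Ex_cst p s); apply: Ex_eq => w _.
by rewrite ltnNge csize_le_size.
Qed.

End TwoGhost.

(** * Exits from a finite set *)

Section Sharpness.
Context {R : realType} {V E : choiceType} (a b : E -> V).
Implicit Types (p : E -> R) (s : seq E) (w : {fset E}) (X : seq V) (S : {fset V}).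

Local Notation csize := (csize a b).
Local Notation conn := (conn a b).

Definition restrict (T : pred V) w := [fset e in w | T (a e) && T (b e)].

Definition conn_within S w x y := conn (restrict (fun z => z \in S) w) x y.

Definition exits S e x y := [&& joins a b e x y, x \in S & y \notin S].

(** The Duminil-Copin--Tassion functional: the mean number of open edges leaving [S] from the
    cluster of [o] inside [S]. Edges carry no orientation, so both are listed; at most one is an
    exit. *)
Definition phi p s S o : R :=
  \sum_(e <- s) p e *
    ((exits S e (a e) (b e))%:R * Pr p s (fun w => conn_within S w o (a e)) +
     (exits S e (b e) (a e))%:R * Pr p s (fun w => conn_within S w o (b e))).

Lemma mem_restrict T w e :
  (e \in restrict T w) = [&& e \in w, T (a e) & T (b e)].
Proof. by rewrite !inE. Qed.

Lemma restrictS T w w' : w `<=` w' -> restrict T w `<=` restrict T w'.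
Proof.
by move=> /fsubsetP ww'; apply/fsubsetP => e; rewrite !mem_restrict => /andP[/ww' -> ->].
Qed.

Lemma conn_within_increasing S x y : increasing (fun w => conn_within S w x y).
Proof. by move=> w w' ww'; apply: connS; exact: restrictS. Qed.

Lemma restrict_add T w e : ~~ (T (a e) && T (b e)) ->
  restrict T (e |` w) = restrict T w.
Proof.
move=> eT; apply/fsetP => c; rewrite !mem_restrict !inE.
by have [->|//] := eqVneq c e; rewrite (negbTE eT) !andbF.
Qed.

Lemma path_restrict w (T : seq V) x q : {subset x :: q <= T} ->
  path (adj a b w) x q -> path (adj a b (restrict (fun x => x \in T) w)) x q.
Proof.
elim: q x => [//|y q IH] x xqT /= /andP[/adjP[e ew exy] pq].
apply/andP; split; last by apply: IH => // z zq; apply: xqT; rewrite inE zq orbT.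
apply/adjP; exists e => //; rewrite mem_restrict ew /=.
have xT : x \in T by apply: xqT; rewrite mem_head.
have yT : y \in T by apply: xqT; rewrite !inE eqxx orbT.
by move: exy => /orP[] /andP[/eqP-> /eqP->]; rewrite xT yT.
Qed.

(** A simple path is cut at its first vertex outside [S]: the part before stays in [S], and the part
    after shares no vertex with it. *)
Lemma exit_split w S o y : o \in S -> y \notin S -> conn w o y ->
  exists e u v, [/\ e \in w, exits S e u v &
    exists I J, [/\ I `<=` w, J `<=` w, [disjoint I & J]%fset &
      ((e \in I) && conn_within S I o u) && conn J v y]].
Proof.
move=> oS yS /asboolP[q0 /shortenP[q pq uq _] ql].
have hq : has [pred z | z \notin S] q.
  apply/hasP; exists y => //=.
  by move: (mem_last o q); rewrite ql inE => /orP[/eqP yo|//]; rewrite yo oS in yS.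
case: (split_find hq) pq uq ql => v q1 q2 /= vS q1S.
rewrite cat_path rcons_path last_rcons last_cat last_rcons => /andP[/andP[pq1 uv] pq2] uq ql.
move: uv => /adjP[e ew euv]; set u := last o q1 in euv.
have oq1S z : z \in o :: q1 -> z \in S.
  rewrite inE => /orP[/eqP->//|zq1]; have /hasPn /(_ z zq1) /= := q1S.
  by rewrite negbK.
have uo : u \in o :: q1 by exact: mem_last.
have dis z : z \in o :: q1 -> z \notin v :: q2.
  have : uniq ((o :: q1) ++ v :: q2) by rewrite cat_cons -cat_rcons.
  by rewrite cat_uniq => /and3P[_ /hasPn nq _] zq; apply/negP => /nq; rewrite zq.
exists e, u, v; split => //; first by rewrite /exits euv oq1S.
(* The witnesses are all open edges spanned by each half; they are disjoint because the halves have
   no common vertex, and [e] has an end in each half. *)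
exists (e |` restrict (fun x => x \in o :: q1) w), (restrict (fun x => x \in v :: q2) w); split.
- by apply/fsubsetP => c; rewrite in_fset1U mem_restrict => /orP[/eqP->|/andP[]].
- by apply/fsubsetP => c; rewrite mem_restrict => /andP[].
- apply/fdisjointP => c; rewrite in_fset1U !mem_restrict.
  move=> /orP[/eqP->|/and3P[_ /dis aq _]]; last first.
    by rewrite (negbTE aq) andbF.
  move: euv => /orP[] /andP[/eqP ea /eqP eb].
    by rewrite ea (negbTE (dis _ uo)) andbF.
  by rewrite eb (negbTE (dis _ uo)) !andbF.
- rewrite fset1U1 /=; apply/andP; split.
    apply/asboolP; exists q1 => //.
    apply: sub_path (path_restrict (fun z zq => zq) pq1) => x z; apply: adjS.
    apply/fsubsetP => c; rewrite !mem_restrict in_fset1U mem_restrict => /and3P[cw ac bc].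
    by rewrite cw ac bc orbT /= !oq1S.
  apply/asboolP; exists q2 => //; exact: path_restrict pq2.
Qed.

Lemma Pr_open_conn_within p s S e o x : prob p -> uniq s -> e \in s ->
  ~~ ((a e \in S) && (b e \in S)) ->
  Pr p s (fun w => (e \in w) && conn_within S w o x) =
  p e * Pr p s (fun w => conn_within S w o x).
Proof.
move=> p01 us es eS; rewrite /Pr !(Ex_rem _ _ es) /=.
have add w : conn_within S (e |` w) o x = conn_within S w o x.
  by rewrite /conn_within restrict_add.
have -> : Ex p (rem e s) (fun w => ((e \in e |` w) && conn_within S (e |` w) o x)%:R) =
          Ex p (rem e s) (fun w => (conn_within S w o x)%:R).
  by apply: Ex_eq => w _; rewrite add fset1U1.
have -> : Ex p (rem e s) (fun w => ((e \in w) && conn_within S w o x)%:R) = 0.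
  rewrite -[RHS](Ex_cst p (rem e s)); apply: Ex_eq => w ws.
  by rewrite (_ : e \in w = false) //; apply/negP => /ws; rewrite mem_rem_uniqF.
have -> : Ex p (rem e s) (fun w => (conn_within S (e |` w) o x)%:R) =
          Ex p (rem e s) (fun w => (conn_within S w o x)%:R).
  by apply: Ex_eq => w _; rewrite add.
ring.
Qed.

Lemma Ex_csize_Pr p s o X :
  Ex p s (fun w => (csize w o X)%:R) = \sum_(y <- X) Pr p s (fun w => conn w o y).
Proof.
rewrite -Ex_sum; apply: Ex_eq => w _.
by rewrite csizeE count_sum natr_sum.
Qed.

Lemma exits_not_inside S e x y : exits S e x y -> ~~ ((a e \in S) && (b e \in S)).
Proof.
move=> /and3P[/orP[] /andP[/eqP-> /eqP->] xS yS]; first by rewrite (negbTE yS) andbF.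
by rewrite (negbTE yS).
Qed.

Lemma Pr_conn_exit p s S o y : prob p -> uniq s -> o \in S -> y \notin S ->
  Pr p s (fun w => conn w o y) <=
  \sum_(e <- s) p e *
    ((exits S e (a e) (b e))%:R * Pr p s (fun w => conn_within S w o (a e)) *
       Pr p s (fun w => conn w (b e) y) +
     (exits S e (b e) (a e))%:R * Pr p s (fun w => conn_within S w o (b e)) *
       Pr p s (fun w => conn w (a e) y)).
Proof.
move=> p01 us oS yS.
pose D e u v w := `[< exists I J, [/\ I `<=` w, J `<=` w, [disjoint I & J]%fset &
      ((e \in I) && conn_within S I o u) && conn J v y] >].
have DP e u v : e \in s -> exits S e u v -> Pr p s (D e u v) <=
    p e * Pr p s (fun w => conn_within S w o u) * Pr p s (fun w => conn w v y).
  move=> es ex; rewrite -Pr_open_conn_within //; last exact: exits_not_inside ex.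
  apply: Pr_disjoint_occurrence => //.
  - move=> w w' ww' /andP[ew c]; rewrite (fsubsetP ww') //=.
    exact: conn_within_increasing c.
  - exact: conn_increasing.
  - by move=> w _ /asboolP.
apply: (@le_trans _ _ (\sum_(e <- s) Pr p s (fun w =>
   (exits S e (a e) (b e) && D e (a e) (b e) w) || (exits S e (b e) (a e) && D e (b e) (a e) w)))).
  apply: Pr_exists => // w ws /(exit_split oS yS)[e [u [v [ew ex H]]]].
  exists e; first exact: ws.
  have Dw : D e u v w by apply/asboolP.
  by move: (ex) => /and3P[/orP[] /andP[/eqP eu /eqP ev] _ _]; subst u v; rewrite ex Dw ?orbT.
rewrite !big_seq; apply: ler_sum => e es.
apply: (@le_trans _ _ ((exits S e (a e) (b e))%:R * Pr p s (D e (a e) (b e)) +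
   (exits S e (b e) (a e))%:R * Pr p s (D e (b e) (a e)))).
  rewrite -!ExZ -ExD; apply: Ex_le => // w _.
  case: (exits S e (a e) (b e)); case: (exits S e (b e) (a e));
    case: (D e (a e) (b e) w); case: (D e (b e) (a e) w) => //=; lra.
rewrite mulrDr; apply: lerD.
  have [ex|] := boolP (exits S e (a e) (b e)); last by rewrite !mul0r mulr0.
  by rewrite !mul1r mulrA; exact: DP.
have [ex|] := boolP (exits S e (b e) (a e)); last by rewrite !mul0r mulr0.
by rewrite !mul1r mulrA; exact: DP.
Qed.

(** Vertices in [S] number at most |S|; for the others, [Pr_conn_exit] is summed over the target,
    and each exit edge starts a new cluster of mean size at most [chi]. *)
Lemma Ex_csize_exit p s S o X chi : prob p -> uniq s -> uniq X -> o \in S ->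
  (forall e, e \in s -> (a e \in X) && (b e \in X)) ->
  (forall v, v \in X -> Ex p s (fun w => (csize w v X)%:R) <= chi) ->
  Ex p s (fun w => (csize w o X)%:R) <= #|` S|%:R + phi p s S o * chi.
Proof.
move=> p01 us uX oS sX chiP; rewrite Ex_csize_Pr.
rewrite (bigID (mem S)) /=; apply: lerD.
  apply: (@le_trans _ _ (\sum_(y <- X | y \in S) 1)); first by apply: ler_sum => y _; exact: Pr_le1.
  rewrite big_const_seq iter_addr addr0 ler_nat -size_filter; apply: uniq_leq_size; first exact: filter_uniq.
  by move=> y; rewrite mem_filter => /andP[].
apply: (@le_trans _ _ (\sum_(y <- X) \sum_(e <- s) p e *
    ((exits S e (a e) (b e))%:R * Pr p s (fun w => conn_within S w o (a e)) *
       Pr p s (fun w => conn w (b e) y) +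
     (exits S e (b e) (a e))%:R * Pr p s (fun w => conn_within S w o (b e)) *
       Pr p s (fun w => conn w (a e) y)))).
  rewrite big_mkcond; apply: ler_sum => y _; case: ifPn => [yS|_]; first exact: Pr_conn_exit.
  apply: sumr_ge0 => e _; have /andP[p0 _] := p01 e.
  by rewrite mulr_ge0 // addr_ge0 // !mulr_ge0 // Pr_ge0.
rewrite exchange_big /phi /= mulr_suml !big_seq; apply: ler_sum => e es.
have /andP[aX bX] := sX e es; have /andP[p0 _] := p01 e.
rewrite -mulr_sumr -mulrA; apply: ler_wpM2l => //.
rewrite big_split /= mulrDl -!mulr_sumr -!Ex_csize_Pr; apply: lerD; apply: ler_wpM2l;
  by rewrite ?chiP // mulr_ge0 // Pr_ge0.
Qed.

(** The largest mean chi over starting points satisfies chi <= M + kappa chi, which can be solved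
    since [X] is finite. The set depends on [o] because a finite region has no symmetry; translates
    of one set will be used. *)
Lemma Ex_csize_subcritical p s X (S : V -> {fset V}) (M : nat) (kappa : R) :
  prob p -> uniq s -> uniq X -> kappa < 1 ->
  (forall e, e \in s -> (a e \in X) && (b e \in X)) ->
  (forall o, o \in X -> [/\ o \in S o, (#|` S o| <= M)%N & phi p s (S o) o <= kappa]) ->
  forall o, o \in X -> Ex p s (fun w => (csize w o X)%:R) <= M%:R / (1 - kappa).
Proof.
move=> p01 us uX k1 sX SP o0 o0X.
have kappa0 : 0 <= kappa.
  have [_ _] := SP o0 o0X; apply: le_trans; apply: sumr_ge0 => e _.
  have /andP[p0 _] := p01 e.
  by rewrite mulr_ge0 // addr_ge0 // !mulr_ge0 // Pr_ge0.
pose chi := \big[Num.max/0]_(v <- X) Ex p s (fun w => (csize w v X)%:R).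
have chiP v : v \in X -> Ex p s (fun w => (csize w v X)%:R) <= chi.
  move=> vX.
  exact: (@le_bigmax_seq _ R _ _ 0 v xpredT (fun v => Ex p s (fun w => (csize w v X)%:R))).
have chi0 : 0 <= chi by apply: bigmax_ge_id.
suff : chi <= M%:R / (1 - kappa) by apply: le_trans; exact: chiP.
rewrite ler_pdivlMr ?subr_gt0 //.
suff : chi <= M%:R + kappa * chi by lra.
rewrite {1}/chi big_seq; apply: bigmax_le => [|o oX].
  by rewrite addr_ge0 ?mulr_ge0.
have [oS SM phik] := SP o oX.
apply: le_trans (Ex_csize_exit p01 us uX oS sX chiP) _.
by apply: lerD; [rewrite ler_nat|exact: ler_wpM2r].
Qed.

End Sharpness.

(** * Sharpness *)

Section Escape.
Context {R : realType} {V E : choiceType} (a b : E -> V).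
Context (J : E -> R) (J0 : forall e, 0 <= J e) (s : seq E) (X : seq V).
Context (Lam : {fset V}) (o : V).
Hypotheses (us : uniq s) (oLam : o \in Lam).
Hypothesis sX : forall e, e \in s -> (a e \in X) && (b e \in X).

Local Notation conn := (conn a b).

Definition escapes (w : {fset E}) y := has (fun z => (z \notin Lam) && conn w y z) X.

(** The random set of Duminil-Copin--Tassion: discovering it from the outside leaves the edges
    inside it unexplored. *)
Definition confined (w : {fset E}) := [fset y in Lam | ~~ escapes w y].

Lemma escapes_conn w x y : conn w x y -> escapes w x = escapes w y.
Proof. by move=> xy; apply: eq_has => z; rewrite (conn_eq xy). Qed.

Lemma escapesS w w' y : w `<=` w' -> escapes w y -> escapes w' y.
Proof.
move=> ww' /hasP[z zX /andP[zL yz]]; apply/hasP; exists z => //.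
by rewrite zL /=; exact: connS yz.
Qed.

(** Neither end of [e] escapes, with or without [e], so [e] helps no vertex to escape. Hence the
    event that [confined] equals [S] is independent of connections inside [S]. *)
Lemma confined_add e w (S : {fset V}) : (a e \in S) && (b e \in S) ->
  (confined (e |` w) == S) = (confined w == S).
Proof.
move=> /andP[aS bS].
have up := escapesS (fsubsetU1 e w).
have key y : y \in Lam -> escapes (e |` w) y ->
    [|| escapes w y, escapes w (a e) | escapes w (b e)].
  move=> yL /hasP[z zX /andP[zL]]; rewrite conn_add => /or3P[yz|/andP[_ bz]|/andP[_ az]];
    apply/or3P; [apply: Or31|apply: Or33|apply: Or32]; apply/hasP; exists z => //; rewrite zL //=.
have inC : forall v x, (x \in confined v) = (x \in Lam) && ~~ escapes v x.
  by move=> v x; rewrite !inE.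
apply/eqP/eqP => CS; rewrite -CS !inC in aS bS.
  move: aS bS => /andP[aL na] /andP[bL nb].
  apply/fsetP => y; rewrite -CS !inC; have [yL|//] := boolP (y \in Lam) => /=.
  apply/idP/idP; last by apply: contra => /up.
  apply: contra => /(key _ yL) /or3P[//|/up|/up] h; first by rewrite h in na.
  by rewrite h in nb.
move: aS bS => /andP[aL na] /andP[bL nb].
apply/fsetP => y; rewrite -CS !inC; have [yL|//] := boolP (y \in Lam) => /=.
apply/idP/idP; first by apply: contra => /up.
by apply: contra => /(key _ yL) /or3P[//|h|h]; rewrite h in na nb.
Qed.

(** The end [y] escapes or lies outside [Lam]. Were [e] open, [o] would escape through it; opening
    it makes [o] escape. *)
Lemma pivotal_exits w e x y : {subset w <= s} -> e \in s -> o \in confined w ->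
  exits a b (confined w) e x y -> conn_within a b (confined w) w o x ->
  (e \notin w) && escapes (e |` w) o.
Proof.
move=> ws es oC /and3P[exy xC yC] ox.
have no : ~~ escapes w o by move: oC; rewrite !inE => /andP[].
have {}ox : conn w o x.
  move: ox; rewrite /conn_within; apply: connS.
  by apply/fsubsetP => c; rewrite mem_restrict => /andP[].
have yX : y \in X.
  by have /andP[aX bX] := sX es; move: exy => /orP[] /andP[/eqP ? /eqP ?]; subst x y.
have yesc : escapes w y.
  move: yC; rewrite !inE negb_and negbK => /orP[yL|//].
  by apply/hasP; exists y => //; rewrite yL conn_refl.
apply/andP; split.
  apply: contra no => ew; rewrite (escapes_conn ox) (escapes_conn (conn_joins ew exy)).
  exact: yesc.
have up := fsubsetU1 e w.
rewrite (escapes_conn (connS up ox)) (@escapes_conn _ x y) //.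
  exact: escapesS up yesc.
by apply: conn_joins exy; exact: fset1U1.
Qed.

(** Split according to the value [S] of [confined]. By independence the exit edges contribute at
    least phi(S) / beta, because p e <= beta J e. The values containing [o] make up exactly the
    event that [o] does not escape, hence the factor 1 - P. *)
Lemma closed_pivotal_escape (beta kappa : R) : 0 < beta ->
  (forall S, S `<=` Lam -> o \in S -> kappa <= phi a b (open_prob J beta) s S o) ->
  kappa / beta * (1 - Pr (open_prob J beta) s (escapes ^~ o)) <=
  Ex (open_prob J beta) s (closed_pivotal J s (fun w => (escapes w o)%:R)).
Proof.
move=> b0 phiP; set p := open_prob J beta.
have p01 : prob p by exact: open_prob01 (ltW b0) J0.
pose W (S : {fset V}) w : R := \sum_(e <- s) J e *
    ((exits a b S e (a e) (b e))%:R * (conn_within a b S w o (a e))%:R +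
     (exits a b S e (b e) (a e))%:R * (conn_within a b S w o (b e))%:R).
pose Ss : seq {fset V} := [seq S : {fset V} <- enum_fset (fpowerset Lam) | o \in S].
have step1 : Ex p s (fun w => \sum_(S <- Ss) (confined w == S)%:R * W S w) <=
    Ex p s (closed_pivotal J s (fun w => (escapes w o)%:R)).
  apply: Ex_le => // w ws.
  have cp0 : 0 <= closed_pivotal J s (fun w => (escapes w o)%:R) w.
    apply: sumr_ge0 => e _; rewrite !mulr_ge0 // subr_ge0 ler_nat.
    by have := @escapesS w (e |` w) o (fsubsetU1 e w);
      case: (escapes w o) => [->|] //; case: (escapes _ _).
  have [CS|CS] := boolP (confined w \in Ss); last first.
    rewrite big_seq big1 // => S SS; case: eqP => [CE|_]; rewrite ?mul0r //.
    by rewrite CE SS in CS.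
  rewrite (big_rem _ CS) /= eqxx mul1r big1_seq ?addr0; last first.
    move=> S /= SS; case: eqP => [CE|_]; last by rewrite mul0r.
    by move: SS; rewrite -CE mem_rem_uniqF // filter_uniq // fset_uniq.
  have oC : o \in confined w by move: CS; rewrite mem_filter => /andP[].
  have no : escapes w o = false.
    by move: oC; rewrite !inE => /andP[_ /negbTE].
  rewrite /W /closed_pivotal !big_seq; apply: ler_sum => e es.
  rewrite no subr0 -mulrA; apply: ler_wpM2l => //.
  have h1 := @pivotal_exits w e (a e) (b e) ws es oC.
  have h2 := @pivotal_exits w e (b e) (a e) ws es oC.
  have h3 : ~~ (exits a b (confined w) e (a e) (b e) && exits a b (confined w) e (b e) (a e)).
    by rewrite /exits; case: (a e \in _); case: (b e \in _); rewrite /= ?andbF.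
  move: h1 h2 h3; case: exits; case: exits => //=.
  - move=> + _ _; case: conn_within => [/(_ isT isT) /andP[-> ->]|_];
      by rewrite !(mul0r, mul1r, addr0) // mulr_ge0.
  - move=> _ + _; case: conn_within => [/(_ isT isT) /andP[-> ->]|_];
      by rewrite !(mul0r, mul1r, add0r) // mulr_ge0.
  - by rewrite !mul0r addr0 mulr_ge0.
apply: le_trans step1; rewrite Ex_sum.
have step2 S : S \in Ss ->
   kappa / beta * Pr p s (fun w => confined w == S) <=
   Ex p s (fun w => (confined w == S)%:R * W S w).
  rewrite mem_filter fpowersetE => /andP[oS SL].
  have ind x : Ex p s (fun w => (confined w == S)%:R * (conn_within a b S w o x)%:R) =
      Pr p s (fun w => confined w == S) * Pr p s (fun w => conn_within a b S w o x).
    apply: (@Ex_indep _ _ _ _ (fun e => ~~ ((a e \in S) && (b e \in S)))) => //.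
      by move=> e w _ eS; rewrite /conn_within restrict_add.
    by move=> e w _; rewrite negbK => eS; rewrite confined_add.
  have -> : Ex p s (fun w => (confined w == S)%:R * W S w) =
     Pr p s (fun w => confined w == S) * \sum_(e <- s) J e *
    ((exits a b S e (a e) (b e))%:R * Pr p s (fun w => conn_within a b S w o (a e)) +
     (exits a b S e (b e) (a e))%:R * Pr p s (fun w => conn_within a b S w o (b e))).
    rewrite /W mulr_sumr.
    rewrite (@Ex_eq _ _ _ _ _ (fun w => \sum_(e <- s) (J e * (exits a b S e (a e) (b e))%:R *
        ((confined w == S)%:R * (conn_within a b S w o (a e))%:R) +
        J e * (exits a b S e (b e) (a e))%:R *
        ((confined w == S)%:R * (conn_within a b S w o (b e))%:R)))); last first.
      by move=> w _; rewrite mulr_sumr; apply: eq_bigr => e _; ring.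
    rewrite Ex_sum; apply: eq_bigr => e _.
    by rewrite ExD !ExZ !ind; ring.
  rewrite mulrC; apply: ler_wpM2l; first exact: Pr_ge0.
  rewrite ler_pdivrMr //; apply: le_trans (phiP S SL oS) _.
  rewrite /phi mulr_suml; apply: ler_sum => e _; rewrite mulrAC.
  apply: ler_wpM2r; first by rewrite addr_ge0 // mulr_ge0 // Pr_ge0.
  rewrite /p /open_prob lerBlDr mulrC -lerBlDl.
  by have := expR_ge1Dx (- (beta * J e)); lra.
apply: (@le_trans _ _ (\sum_(S <- Ss) kappa / beta * Pr p s (fun w => confined w == S))); last first.
  by rewrite !big_seq; apply: ler_sum => S; exact: step2.
rewrite -mulr_sumr le_eqVlt; apply/orP; left; apply/eqP; congr (_ * _).
rewrite -[1](Ex_cst p s) -ExB -Ex_sum; apply: Ex_eq => w _.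
have [oC|oC] := boolP (o \in confined w).
  have CS : confined w \in Ss.
    by rewrite mem_filter oC fpowersetE; apply/fsubsetP => y; rewrite !inE => /andP[].
  rewrite (big_rem _ CS) /= eqxx big1_seq ?addr0; last first.
    move=> S /= SS; case: eqP => [CE|_] //.
    by move: SS; rewrite -CE mem_rem_uniqF // filter_uniq // fset_uniq.
  by move: oC; rewrite !inE => /andP[_ /negbTE ->]; rewrite subr0.
rewrite big1_seq; last first.
  by move=> S; rewrite mem_filter => /andP[_ /andP[oS _]]; case: eqP => // CE; rewrite CE oS in oC.
by move: oC; rewrite !inE oLam /= negbK => ->; rewrite subrr.
Qed.

End Escape.

Section EscapeBound.
Context {R : realType} {V E : choiceType} (a b : E -> V).

(** As [phi] is nondecreasing in beta, the lower bound at [b0] persists up to [b1], where moreover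
    kappa / beta >= kappa / b1; the differential inequality is then integrated. *)
Lemma Pr_escape_ge (J : E -> R) (s : seq E) (X : seq V) (Lam : {fset V}) (o : V)
    (b0 b1 kappa : R) : (forall e, 0 <= J e) -> uniq s -> o \in Lam ->
  (forall e, e \in s -> (a e \in X) && (b e \in X)) ->
  0 < b0 -> b0 <= b1 -> 0 <= kappa ->
  (forall S, S `<=` Lam -> o \in S -> kappa <= phi a b (open_prob J b0) s S o) ->
  1 - expR (- (kappa / b1 * (b1 - b0))) <=
  Pr (open_prob J b1) s (fun w => escapes a b X Lam w o).
Proof.
move=> J0 us oL sX b00 b01 k0 phiP.
apply: Pr_ge_of_Russo => //; first exact: ltW.
move=> beta /andP[b0b bb1].
have bt0 : 0 < beta by exact: lt_le_trans b0b.
have p0 := open_prob01 (ltW b00) J0; have p1 := open_prob01 (ltW bt0) J0.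
have pp e : open_prob J b0 e <= open_prob J beta e.
  by rewrite lerB // ler_expR lerN2 ler_wpM2r.
apply: le_trans (closed_pivotal_escape J0 us oL sX bt0 (kappa := kappa) _); last first.
  move=> S SL oS; apply: le_trans (phiP S SL oS) _; apply: ler_sum => e _.
  have Ple x : Pr (open_prob J b0) s (fun w => conn_within a b S w o x) <=
      Pr (open_prob J beta) s (fun w => conn_within a b S w o x).
    apply: Ex_le_prob => // w w' ww'; rewrite ler_nat.
    by have := @conn_within_increasing _ _ a b S o x w w' ww';
      case: (conn_within _ _ _ w _ _) => [->|].
  apply: ler_pM => //; first by have /andP[] := p0 e.
    by rewrite addr_ge0 // mulr_ge0 // Pr_ge0.
  by apply: lerD; apply: ler_wpM2l.
apply: ler_wpM2r; first by rewrite subr_ge0 Pr_le1.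
by apply: ler_wpM2l => //; rewrite lef_pV2 ?posrE //; exact: lt_le_trans bb1.
Qed.

End EscapeBound.

(** * The lattice *)

Section LatticeEdges.
Context {d : nat}.
Local Notation V := (Zlattice d).

(** The order of the two endpoints is that of an enumeration and carries no meaning; [joins] is
    symmetric and [J] is even. *)
Definition src (e : edge d) : V := nth 0 (enum_fset (val e)) 0.
Definition dst (e : edge d) : V := nth 0 (enum_fset (val e)) 1.

Lemma src_dst_neq e : src e != dst e.
Proof.
have /eqP c2 := valP e; rewrite /src /dst nth_uniq ?fset_uniq //; rewrite cardfE in c2.
all: by rewrite -cardfE in c2; rewrite [size _]c2.
Qed.

Lemma val_edge e : val e = [fset src e; dst e].
Proof.
have /eqP c2 := valP e.
apply/esym/eqP; rewrite eqEfcard; apply/andP; split.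
  apply/fsubsetP => x; rewrite !inE => /orP[] /eqP->; apply: mem_nth;
    by rewrite [size _]c2.
by rewrite c2 cardfs2 src_dst_neq.
Qed.

Lemma joins_val e x y : joins src dst e x y = (val e == [fset x; y]).
Proof.
rewrite val_edge /joins; apply/idP/eqP => [/orP[] /andP[/eqP-> /eqP->]//|E].
  by rewrite fsetUC.
have xE : x \in [fset src e; dst e] by rewrite E !inE eqxx.
have yE : y \in [fset src e; dst e] by rewrite E !inE eqxx orbT.
have aE : src e \in [fset x; y] by rewrite -E !inE eqxx.
have bE : dst e \in [fset x; y] by rewrite -E !inE eqxx orbT.
have neq := src_dst_neq e.
move: xE yE; rewrite !inE => /orP[] /eqP xe /orP[] /eqP ye; subst x y.
- by move: bE; rewrite !inE orbb eq_sym (negbTE neq).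
- by rewrite !eqxx.
- by rewrite !eqxx orbT.
- by move: aE; rewrite !inE orbb (negbTE neq).
Qed.

(** [insub] discards the pairs with equal entries, and [undup] the reversed copies. *)
Definition edges (X : seq V) : seq (edge d) :=
  undup (pmap insub [seq [fset x; y] | x <- X, y <- X]).

Lemma edges_uniq X : uniq (edges X).
Proof. exact: undup_uniq. Qed.

Lemma mem_edges X e : (e \in edges X) = (src e \in X) && (dst e \in X).
Proof.
rewrite /edges mem_undup mem_pmap_sub; apply/allpairsP/andP => [[[x y] /= [xX yX E]]|[aX bX]].
  have : joins src dst e x y by rewrite joins_val; apply/eqP; exact: E.
  by move=> /orP[] /andP[/eqP-> /eqP->].
by exists (src e, dst e); split => //=; exact: val_edge.
Qed.

Definition open_in (s : seq (edge d)) (w : config d) : {fset edge d} :=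
  [fset e in s | w e].

Lemma mem_open_in s w e : (e \in open_in s w) = (e \in s) && w e.
Proof. by rewrite !inE. Qed.

Lemma open_in_cons e s w : open_in (e :: s) w =
  if w e then e |` open_in s w else open_in s w.
Proof.
apply/fsetP => c; rewrite mem_open_in inE; case: ifPn => we; rewrite ?in_fset1U mem_open_in.
  by have [->|] := eqVneq c e.
by have [->|] := eqVneq c e; rewrite //= (negbTE we) !andbF.
Qed.

End LatticeEdges.

(** * Cylinder events of the percolation measure *)

Section Cylinders.
Context {R : realType} {d : nat} (J : Zlattice d -> R) (beta : R).
Context (P : probability (config d) R) (PJ : percolation_law J beta P).
Local Open Scope classical_set_scope.

Definition edge_rate (e : edge d) : R := J (dst e - src e).

Lemma measurable_edge_open (e : edge d) : measurable (edge_open e : set (config d)).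
Proof. by apply: sub_sigma_algebra; exists e. Qed.

Lemma cylinder_cons (A : {fset edge d} -> bool) e s :
  [set w : config d | A (open_in (e :: s) w)] =
  ([set w : config d | A (e |` open_in s w)%fset] `&` edge_open e) `|`
  ([set w : config d | A (open_in s w)] `&` ~` edge_open e).
Proof.
apply/seteqP; split => w /=; rewrite open_in_cons /edge_open /=.
  by case: ifPn => we Aw; [left|right].
by case: ifPn => we [[Aw //]|[Aw //]].
Qed.

Lemma measurable_cylinder s (A : {fset edge d} -> bool) :
  measurable [set w : config d | A (open_in s w)].
Proof.
elim: s A => [|e s IH] A.
  rewrite (_ : [set w | _] = if A fset0 then setT else set0).
    by case: (A fset0).
  have o0 w : open_in [::] w = fset0 :> {fset edge d} by apply/fsetP => c; rewrite mem_open_in.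
  by apply/seteqP; split => w /=; rewrite o0; case: (A fset0).
rewrite cylinder_cons; apply: measurableU; apply: measurableI.
- exact: (IH (fun v => A (e |` v)%fset)).
- exact: measurable_edge_open.
- exact: IH.
- by apply: measurableC; exact: measurable_edge_open.
Qed.

Lemma P_edge_open e : P (edge_open e) = (open_prob edge_rate beta e)%:E.
Proof. by rewrite (PJ.1 _ _ _ (val_edge e)). Qed.

(** The law prescribes only the probabilities of intersections of open events. So [F] collects the
    edges already required to be open, and a closed edge is treated by subtracting the event where
    it is open. *)
Lemma P_cylinder_open s (A : {fset edge d} -> bool) (F : {fset edge d}) :
  uniq s -> (forall e, e \in s -> e \notin F) ->
  P ([set w | A (open_in s w)] `&` \bigcap_(i in [set` F]) edge_open i) =
  (Pr (open_prob edge_rate beta) s A * \prod_(i <- F) open_prob edge_rate beta i)%:E.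
Proof.
elim: s A F => [|e s IH] A F /=.
  move=> _ _; have o0 w : open_in [::] w = fset0 :> {fset edge d}.
    by apply/fsetP => c; rewrite mem_open_in.
  rewrite (_ : [set w | _] = if A fset0 then setT else set0); last first.
    by apply/seteqP; split => w /=; rewrite o0; case: (A fset0).
  rewrite /Pr /=; case: (A fset0); rewrite ?mul0r ?set0I ?measure0 // setTI mul1r.
  rewrite PJ.2 -prodEFin; apply: eq_bigr => i _; exact: P_edge_open.
move=> /andP[es us] sF.
have mcap (G : {fset edge d}) : measurable (\bigcap_(i in [set` G]) edge_open i : set (config d)).
  by apply: fin_bigcap_measurable => // i _; exact: measurable_edge_open.
have eF : e \notin F by apply: sF; rewrite mem_head.
have sF' c : c \in s -> c \notin F by move=> cs; apply: sF; rewrite inE cs orbT.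
have seF c : c \in s -> c \notin (e |` F)%fset.
  move=> cs; rewrite in_fset1U negb_or sF' // andbT.
  by apply: contraNneq es => <-.
set G := \bigcap_(i in _) _.
have GE : edge_open e `&` G = \bigcap_(i in [set` (e |` F)%fset]) edge_open i.
  apply/seteqP; split => w.
    by move=> [we wG] i /=; rewrite in_fset1U => /orP[/eqP->|/wG].
  move=> H; split; first by apply: H => /=; rewrite in_fset1U eqxx.
  by move=> i /= iF; apply: H => /=; rewrite in_fset1U iF orbT.
rewrite cylinder_cons setIUl measureU; last 3 first.
- apply: measurableI; last exact: mcap.
  apply: measurableI; last exact: measurable_edge_open.
  exact: (measurable_cylinder s (fun v => A (e |` v)%fset)).
- apply: measurableI; last exact: mcap.
  apply: measurableI; first exact: measurable_cylinder.
  by apply: measurableC; exact: measurable_edge_open.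
- by apply/seteqP; split => // w [[[_ we] _] [[_ nwe] _]].
set B := [set w | A (open_in s w)].
have mB : measurable B by exact: measurable_cylinder.
have H1 := IH (fun v => A (e |` v)%fset) (e |` F)%fset us seF.
rewrite -GE setIA /= in H1.
rewrite [X in (X + _)%E](H1 : P _ = _).
have H2 : (P (B `&` ~` edge_open e `&` G) = P (B `&` G) - P (B `&` (edge_open e `&` G)))%E.
  have mBG : measurable (B `&` G) by apply: measurableI => //; exact: mcap.
  have fBG : (P (B `&` G) < +oo)%E by rewrite ltey_eq fin_num_measure.
  rewrite setIAC -setDE setIA (setIAC B).
  exact: (measureD (mu := P) mBG (measurable_edge_open e) fBG).
have H3 : P (B `&` G) = _ := IH A F us sF'.
have H4 := IH A (e |` F)%fset us seF; rewrite -GE -/B in H4.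
rewrite H3 H4 in H2; rewrite [X in (_ + X)%E](H2 : P _ = _).
rewrite -EFinB -EFinD; congr EFin; rewrite big_fsetU1 //=.
by rewrite /Pr /=; ring.
Qed.

Lemma P_cylinder s (A : {fset edge d} -> bool) : uniq s ->
  P [set w | A (open_in s w)] = (Pr (open_prob edge_rate beta) s A)%:E.
Proof.
move=> us; have := @P_cylinder_open s A fset0 us (fun _ _ => isT).
rewrite big_seq_fset0 mulr1 => <-; congr (P _).
apply/seteqP; split => w /=; last by case.
by move=> Aw; split => // i.
Qed.

End Cylinders.

(** * Translation invariance *)

Lemma Ex_relabel (R : realType) (E E' : choiceType) (p : E -> R) (p' : E' -> R) (phi : E -> E') s f :
  (forall e, e \in s -> p' (phi e) = p e) ->
  Ex p' (map phi s) f = Ex p s (fun w => f (phi @` w)).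
Proof.
elim: s f => [|e s IH] f pp /=; first by rewrite imfset0.
have pps c : c \in s -> p' (phi c) = p c by move=> cs; apply: pp; rewrite inE cs orbT.
rewrite pp ?mem_head // !IH //; congr (_ * _ + _).
by apply: Ex_eq => w _; rewrite imfsetU1.
Qed.

Section Translation.
Context {R : realType} {d : nat}.
Local Notation V := (Zlattice d).
Implicit Types (e : edge d) (t x y : V).

Lemma shift_edge_subproof t e : #|` [fset src e + t; dst e + t]| == 2%N.
Proof. by rewrite cardfs2 (inj_eq (addIr t)) src_dst_neq. Qed.

Definition shift_edge t e : edge d :=
  exist (fun E : {fset V} => #|` E| == 2%N) _ (shift_edge_subproof t e).

Lemma joins_shift t e x y : joins src dst e x y ->
  joins src dst (shift_edge t e) (x + t) (y + t).
Proof.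
move=> exy; rewrite joins_val /=; move: exy.
by move=> /orP[] /andP[/eqP<- /eqP<-] //; rewrite fsetUC.
Qed.

Lemma edge_eq e e' x y : joins src dst e x y -> joins src dst e' x y -> e = e'.
Proof. by rewrite !joins_val => /eqP E1 /eqP E2; apply: val_inj; rewrite E1 E2. Qed.

Lemma shift_edgeK t e : shift_edge t (shift_edge (- t) e) = e.
Proof.
have := joins_shift t (joins_shift (- t) (joins_ab src dst e)).
by rewrite !subrK => h; apply: edge_eq h (joins_ab src dst e).
Qed.

Definition shift_set t (X : {fset V}) : {fset V} := [fset x + t | x in X].

Lemma mem_shift_set t X x : (x + t \in shift_set t X) = (x \in X).
Proof.
rewrite /shift_set; apply/imfsetP/idP => [[y yX /addIr ->//]|xX].
by exists x.
Qed.

Lemma edges_shift t (X : {fset V}) : perm_eq (map (shift_edge t) (edges X)) (edges (shift_set t X)).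
Proof.
have inj : injective (shift_edge t).
  apply: (can_inj (g := shift_edge (- t))) => e.
  by rewrite -{2}[e](shift_edgeK (- t)) opprK.
apply: uniq_perm; rewrite ?map_inj_uniq ?edges_uniq // => e.
rewrite -[e](shift_edgeK t) mem_map // !mem_edges.
set c := shift_edge (- t) e.
have := joins_shift t (joins_ab src dst c).
by move=> /orP[] /andP[/eqP-> /eqP->]; rewrite !mem_shift_set // andbC.
Qed.

Lemma conn_shift t (w : {fset edge d}) x y :
  conn src dst (shift_edge t @` w) (x + t) (y + t) = conn src dst w x y.
Proof.
have sub t' (v : {fset edge d}) x' y' : conn src dst v x' y' ->
    conn src dst (shift_edge t' @` v) (x' + t') (y' + t').
  move: y'; apply: conn_ind; first exact: conn_refl.
  move=> u z _ h /adjP[e ev euz]; apply: conn_trans h _.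
  apply: (@conn_joins _ _ _ _ _ (shift_edge t' e)); last exact: joins_shift.
  by apply/imfsetP; exists e.
apply/idP/idP; last exact: sub.
move=> /(sub (- t)); rewrite !addrK.
suff -> : shift_edge (- t) @` (shift_edge t @` w) = w by [].
have K e : shift_edge (- t) (shift_edge t e) = e.
  by rewrite -{2}[t]opprK shift_edgeK.
apply/fsetP => e; apply/imfsetP/idP => [[e' /= /imfsetP[e'' /= ew ->] ->]|ew].
  by rewrite K.
by exists (shift_edge t e); rewrite ?K //=; apply/imfsetP; exists e.
Qed.

Lemma csize_shift t (w : {fset edge d}) x (X : {fset V}) :
  csize src dst (shift_edge t @` w) (x + t) (shift_set t X) = csize src dst w x X.
Proof.
rewrite !csizeE.
have P : perm_eq (shift_set t X) (map (fun x => x + t) X).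
  apply: uniq_perm; rewrite ?map_inj_uniq ?fset_uniq //; try exact: addIr.
  move=> z; apply/imfsetP/mapP => -[y yX ->]; exists y => //.
rewrite (permP P) count_map; apply: eq_count => y /=; exact: conn_shift.
Qed.

Context (J : V -> R) (J_sym : forall x, J (- x) = J x).

Lemma edge_rate_joins e x y : joins src dst e x y -> edge_rate J e = J (y - x).
Proof.
rewrite /edge_rate => /orP[] /andP[/eqP-> /eqP->] //.
by rewrite -J_sym opprB.
Qed.

Lemma edge_rate_shift t e : edge_rate J (shift_edge t e) = edge_rate J e.
Proof.
rewrite (edge_rate_joins (joins_shift t (joins_ab src dst e))).
by rewrite opprD addrACA subrr addr0.
Qed.

Lemma Pr_shift t beta (X : {fset V}) (A B : {fset edge d} -> bool) :
  (forall w, A (shift_edge t @` w) = B w) ->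
  Pr (open_prob (edge_rate J) beta) (edges (shift_set t X)) A =
  Pr (open_prob (edge_rate J) beta) (edges X) B.
Proof.
move=> AB; rewrite /Pr -(Ex_perm _ _ (edges_shift t X)) (Ex_relabel (p := open_prob (edge_rate J) beta)).
  by apply: Ex_eq => w _; rewrite AB.
by move=> e _; rewrite /open_prob edge_rate_shift.
Qed.

End Translation.

(** * Boxes *)

Section Boxes.
Context {d : nat}.
Local Notation V := (Zlattice d).

Definition box_point n (f : {ffun 'I_d -> 'I_n.*2.+1}) : V :=
  \row_i ((f i : nat)%:Z - n%:Z).

Definition box n : {fset V} := [fset box_point f | f : {ffun 'I_d -> 'I_n.*2.+1}].

Lemma mem_box n (x : V) : reflect (forall i, `|x ord0 i| <= n%:Z) (x \in box n).
Proof.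
apply: (iffP (imfsetP _ _ _ _)) => [[f _ ->] i|H].
  rewrite mxE; move: (nat_of_ord (f i)) (ltn_ord (f i)) => k kn. rewrite ler_norml; apply/andP; split. lia. lia.
exists [ffun i => inord (absz (x ord0 i + n%:Z))] => //.
apply/rowP => i; have := H i; rewrite ler_norml => /andP[h1 h2].
have -> : (0 : 'I_1) = ord0 by exact: val_inj.
by rewrite mxE ffunE inordK; move: h1 h2; move: (x ord0 i : int) => z h1 h2; lia.
Qed.

Lemma card_box n : #|` box n| = (n.*2.+1 ^ d)%N.
Proof.
rewrite card_imfset /=; last first.
  move=> f g /rowP fg; apply/ffunP => i; have := fg i; rewrite !mxE => h.
  apply: val_inj => /=; lia.
by rewrite -cardE card_ffun !card_ord.
Qed.

Lemma box0 n : 0 \in box n.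
Proof. by apply/mem_box => i; rewrite mxE normr0. Qed.

Lemma box_add m n x y : x \in box m -> y \in box n -> x + y \in box (m + n).
Proof.
move=> /mem_box xm /mem_box yn; apply/mem_box => i; rewrite mxE.
have := xm i; have := yn i.
move: (x ord0 i : int) (y ord0 i : int) => u v; rewrite !ler_norml.
move=> /andP[h1 h2] /andP[h3 h4]; apply/andP; split; lia.
Qed.

Lemma box_opp n x : (- x \in box n) = (x \in box n).
Proof.
by apply/mem_box/mem_box => H i; have := H i; rewrite mxE normrN.
Qed.

Lemma boxS m n : (m <= n)%N -> {subset box m <= box n}.
Proof. by move=> mn x /mem_box H; apply/mem_box => i; have := H i; lia. Qed.

Lemma sub_box (X : {fset V}) : exists n, {subset X <= box n}.
Proof.
exists (\max_(x <- X) \max_(i < d) absz (x ord0 i)) => x xX; apply/mem_box => i.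
have h1 : (absz (x ord0 i) <= \max_(i < d) absz (x ord0 i))%N.
  exact: (leq_bigmax (F := fun i => absz (x ord0 i))).
have h2 : (\max_(i < d) `|x ord0 i| <= \max_(x <- X) \max_(i < d) absz (x ord0 i))%N.
  exact: (leq_bigmax_seq (F := fun x : V => \max_(i < d) absz (x ord0 i))).
by rewrite -abszE lez_nat; exact: leq_trans h1 h2.
Qed.

End Boxes.

(** * The bootstrap *)

Section PowerSums.
Context {R : realType}.
Implicit Types (th : R).

Lemma powR_addr (x r s : R) : 0 < x -> x `^ (r + s) = x `^ r * x `^ s.
Proof. by move=> x0; rewrite powRD // (gt_eqF x0) implybT. Qed.

Lemma sum_powRN th k : 0 <= th <= 2^-1 ->
  \sum_(1 <= j < k.+1) j%:R `^ (- th) <= 2 * k%:R `^ (1 - th).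
Proof.
move=> /andP[th0 th1]; elim: k => [|k IH].
  by rewrite big_geq // mulr_ge0 ?powR_ge0.
rewrite big_nat_recr //=; apply: (le_trans (lerD IH (lexx _))).
set m : R := k.+1%:R.
have m0 : 0 < m by rewrite ltr0n.
have kE : k%:R = m * (1 - m^-1) by rewrite mulrBr mulr1 divff ?gt_eqF // /m -natr1 addrK.
have m1 : 0 <= m^-1 <= 1 by rewrite invr_ge0 ltW //= invf_le1 // ler1n.
have /andP[mi0 mi1] := m1.
have -> : m `^ (- th) = m `^ (1 - th) * m^-1.
  by rewrite -powR_inv1 ?ltW // -powR_addr //; congr powR; ring.
rewrite kE powRM; [|exact: ltW|by rewrite subr_ge0].
move: mi0 mi1; move: (m^-1) (m `^ (1 - th)) (powR_ge0 m (1 - th)) => u v v0 u0 u1.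
(* As 1 - th >= 1/2 and the base is at most 1, the power is at most a square root; this is where th
   <= 1/2 enters. *)
have q : (1 - u) `^ (1 - th) <= 1 - u / 2.
  apply: (@le_trans _ _ ((1 - u) `^ 2^-1)).
    have [->|ne] := eqVneq u 1; first by rewrite subrr !powR0 //; lra.
    have lt1 : u < 1 by rewrite lt_neqAle ne.
    by apply: ger_powR; [apply/andP; split|]; lra.
  rewrite powR12_sqrt ?subr_ge0 // -(ler_pXn2r (n := 2)) ?nnegrE ?sqrtr_ge0 //; last lra.
  by rewrite sqr_sqrtr ?subr_ge0 //; nra.
have := ler_wpM2l v0 q.
lra.
Qed.

Lemma sum_sqrt_tail n N : (0 < n)%N ->
  \sum_(n <= k < N) (k * k.+1)%:R^-1 * Num.sqrt k%:R <= 2 * (Num.sqrt n%:R)^-1 :> R.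
Proof.
move=> n0; have [Nn|nN] := leqP N n.
  by rewrite big_geq // mulr_ge0 ?invr_ge0 ?sqrtr_ge0.
suff : \sum_(n <= k < N) (k * k.+1)%:R^-1 * Num.sqrt k%:R <=
    2 * ((Num.sqrt n%:R)^-1 - (Num.sqrt N%:R)^-1) :> R.
  move/le_trans; apply; apply: ler_wpM2l => //.
  by rewrite gerBl invr_ge0 sqrtr_ge0.
move/ltnW: nN; elim: N => [|N IH]; first by rewrite leqn0; lia.
rewrite leq_eqVlt ltnS => /orP[/eqP <-|nN].
  by rewrite big_geq // subrr mulr0.
rewrite big_nat_recr //=; apply: (le_trans (lerD (IH nN) (lexx _))).
set x := Num.sqrt N%:R; set y := Num.sqrt N.+1%:R.
have N0 : 0 < N%:R :> R by rewrite ltr0n; exact: leq_trans nN.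
have x0 : 0 < x by rewrite sqrtr_gt0.
have y0 : 0 < y by rewrite sqrtr_gt0.
have xx : N%:R = x ^+ 2 by rewrite sqr_sqrtr ?ltW.
have yy : y ^+ 2 = x ^+ 2 + 1 by rewrite sqr_sqrtr // -xx -natr1.
have xy : x <= y by apply: ler_wsqrtr; rewrite ler_nat.
have yE : N.+1%:R = y ^+ 2 by rewrite sqr_sqrtr.
rewrite natrM xx yE.
have -> : (x ^+ 2 * y ^+ 2)^-1 * x = (x * y ^+ 2)^-1.
  by field; rewrite !gt_eqF.
suff : (x * y ^+ 2)^-1 <= 2 * (x^-1 - y^-1) by lra.
have -> : x^-1 - y^-1 = (x * y * (x + y))^-1.
  have -> : x^-1 - y^-1 = (y - x) / (x * y) by field; rewrite !gt_eqF.
  apply: (mulIf (x := x * y * (x + y))); first by rewrite gt_eqF // !mulr_gt0 // addr_gt0.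
  rewrite mulVf; last by rewrite gt_eqF // !mulr_gt0 // addr_gt0.
  have -> : (y - x) / (x * y) * (x * y * (x + y)) = y ^+ 2 - x ^+ 2.
    by field; rewrite !gt_eqF.
  by rewrite yy; ring.
rewrite -[2]invrK -invfM lef_pV2 ?posrE; last 2 first.
- by rewrite !mulr_gt0 ?exprn_gt0 // ?invr_gt0 // ?addr_gt0.
- by rewrite !mulr_gt0 ?invr_gt0 // ?addr_gt0.
have : 0 <= x * y * (y - x) by apply: mulr_ge0; [apply: mulr_ge0; exact: ltW|rewrite subr_ge0].
lra.
Qed.

End PowerSums.

(** * Consequences of a power-law tail *)

Section PowerTail.
Context {R : realType} {d : nat} (J : Zlattice d -> R).
Local Notation V := (Zlattice d).
Context (J_gt0 : forall x : V, 0 < J x) (J_sym : forall x : V, J (- x) = J x).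
Context (th : R) (th01 : 0 <= th <= 2^-1).
Implicit Types (X L : {fset V}) (beta A : R).

Local Notation csize := (csize src dst).
Local Notation conn := (conn src dst).

Definition perc_prob beta : edge d -> R := open_prob (edge_rate J) beta.

Definition tail beta X x m : R :=
  Pr (perc_prob beta) (edges X) (fun w => m <= csize w x X)%N.

(** Uniformity over finite regions replaces the infinite-volume bound, as the tail increases with
    the region. For each region the condition is closed in [beta]. *)
Definition power_tail beta A :=
  forall X x m, x \in X -> (0 < m)%N -> tail beta X x m <= A * m%:R `^ (- th).

Lemma perc_prob01 beta : 0 <= beta -> prob (perc_prob beta).
Proof. by move=> b0; apply: open_prob01 => // e; move: (J_gt0 (dst e - src e)) => /ltW. Qed.

Lemma csize_subset (w : {fset edge d}) x X L : {subset L <= X} ->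
  (csize w x L <= csize w x X)%N.
Proof.
move=> LX; rewrite !csizeE -!size_filter; apply: uniq_leq_size.
  by rewrite filter_uniq.
by move=> y; rewrite !mem_filter => /andP[-> /LX].
Qed.

Lemma edges_endpoints X e : e \in edges X -> (src e \in X) && (dst e \in X).
Proof. by rewrite mem_edges. Qed.

Lemma tail_subset beta X X' x m : 0 <= beta -> {subset X <= X'} ->
  tail beta X x m <= tail beta X' x m.
Proof.
move=> b0 XX'.
apply: (@le_trans _ _ (Pr (perc_prob beta) (edges X) (fun w => m <= csize w x X')%N)).
  apply: Pr_sub; first exact: perc_prob01.
  by move=> w _ h; apply: leq_trans h (csize_subset _ _ XX').
apply: Pr_subset; rewrite ?edges_uniq //; first exact: perc_prob01.
  by move=> e; rewrite !mem_edges => /andP[/XX' -> /XX' ->].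
exact: csize_increasing.
Qed.

Lemma tail_shift beta X x t m :
  tail beta (shift_set t X) (x + t) m = tail beta X x m.
Proof. by apply: Pr_shift => // w; rewrite csize_shift. Qed.

(** The condition on [m0] is what Markov's inequality needs to make a cluster with [m0] vertices in
    [L] have probability at most 1/6. Below 3 m0 the tails are summed. *)
Lemma Ex_csize_power_tail beta A X o L m0 : 0 <= beta -> 0 < A ->
  power_tail beta A -> o \in X -> {subset L <= X} -> (0 < m0)%N ->
  6 * A * #|` L|%:R <= m0%:R `^ (1 + th) ->
  Ex (perc_prob beta) (edges X) (fun w => (csize w o L)%:R) <=
  4 * A * (3 * m0)%:R `^ (1 - th).
Proof.
move=> b0 A0 PT oX LX m00 m0A; have /andP[th0 th1] := th01; have p01 := perc_prob01 b0.
have m0R : 0 < m0%:R :> R by rewrite ltr0n.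
have PL x m : x \in X -> (0 < m)%N ->
    Pr (perc_prob beta) (edges X) (fun w => m <= csize w x L)%N <= A * m%:R `^ (- th).
  move=> xX mgt0; apply: le_trans (PT X x m xX mgt0); apply: Pr_sub => // w _ h.
  exact: leq_trans h (csize_subset _ _ LX).
have q6 : Pr (perc_prob beta) (edges X)
    (fun w => has (fun v => m0 <= csize w v L)%N L) <= 6^-1.
  rewrite -(ler_pM2l m0R).
  apply: le_trans (Pr_has_csize_markov _ _ p01 _ _ _) _.
  apply: (@le_trans _ _ (\sum_(v <- L) A * m0%:R `^ (- th))).
    by rewrite !big_seq; apply: ler_sum => v /LX vX; exact: PL.
  rewrite big_const_seq iter_addr addr0 count_predT -[_ *+ _]mulr_natr powRN.
  rewrite mulrAC ler_pdivrMr ?powR_gt0 // mulrAC ler_pdivlMr //.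
  have -> : m0%:R * m0%:R `^ th = m0%:R `^ (1 + th) :> R.
    by rewrite powR_addr // powRr1 // ltW.
  by apply: le_trans m0A; rewrite le_eqVlt; apply/orP; left; apply/eqP; ring.
apply: (le_trans (@Ex_csize_tight _ _ _ src dst _ p01 _ o _ m0 (edges_uniq _) (fset_uniq _) m00 q6)).
have -> : 4 * A * (3 * m0)%:R `^ (1 - th) = 2 * (A * (2 * (3 * m0)%:R `^ (1 - th))) by ring.
apply: ler_wpM2l => //.
apply: (@le_trans _ _ (\sum_(1 <= j < 3 * m0) A * j%:R `^ (- th))).
  by apply: ler_sum_nat => j /andP[j0 _]; exact: PL.
rewrite -mulr_sumr; apply: ler_wpM2l; first exact: ltW.
case: (3 * m0)%N (leq_mul (leqnn 3) m00) => // k _.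
apply: le_trans (sum_powRN k th01) _; apply: ler_wpM2l => //.
apply: ge0_ler_powR; rewrite ?nnegrE ?ler0n ?ler_nat ?leqnSn //; lra.
Qed.

(** An edge at [x] is determined by its displacement from [x]. Both signs are required in [B]
    because [x] may be either endpoint. *)
Lemma count_incident_edges X (B : {fset V}) x :
  (count (fun e : edge d => [&& (dst e - src e)%R \in B, (- (dst e - src e))%R \in B &
      (src e == x) || (dst e == x)]) (edges X) <= #|` B|)%N.
Proof.
rewrite -size_filter.
pose g (e : edge d) := if src e == x then dst e - x else src e - x.
rewrite -(size_map g); apply: uniq_leq_size.
  rewrite map_inj_in_uniq; first by rewrite filter_uniq // edges_uniq.
  move=> e e'; rewrite !mem_filter => /andP[/and3P[_ _ ex] _] /andP[/and3P[_ _ ex'] _].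
  rewrite /g => H.
  have jE c : (src c == x) || (dst c == x) -> joins src dst c x (g c + x).
    rewrite /joins /g; case: eqP => [->|_] /=; first by rewrite subrK eqxx.
    by move=> ->; rewrite subrK eqxx.
  apply: edge_eq (jE e ex) _; rewrite {1}/g H; exact: jE.
move=> z /mapP[e]; rewrite mem_filter => /andP[/and3P[h1 h2 ex] _] ->.
rewrite /g; case: eqP ex h1 h2 => [->//|_] /= /eqP ->.
by rewrite opprB.
Qed.

Lemma sum_distinct_large beta A q r X n : 0 <= beta -> 0 < A -> power_tail beta A ->
  0 < q -> (0 < n)%N ->
  (forall e, dst e - src e \in @box d r -> q <= perc_prob beta e) ->
  \sum_(e <- edges X | dst e - src e \in @box d r)
     Pr (perc_prob beta) (edges X) (distinct_large src dst n X e) <=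
  #|` X|%:R * (2 * A * Num.sqrt (2 * (r.*2.+1 ^ d)%:R / q) * n%:R `^ (- (2^-1 + th))).
Proof.
move=> b0 A0 PT q0 n0 qp; have p01 := perc_prob01 b0.
have n0R : 0 < n%:R :> R by rewrite ltr0n.
(* This weight gives every short edge the same value t p = q whatever its length, and t^2 p <= q
   because q <= p; hence [lam] is q D. *)
pose t (e : edge d) : R := if dst e - src e \in @box d r then q / perc_prob beta e else 0.
have tp e : dst e - src e \in @box d r -> t e * perc_prob beta e = q.
  move=> er; rewrite /t er divfK // gt_eqF //; exact: lt_le_trans (qp e er).
have t0 e : 0 <= t e.
  by rewrite /t; case: ifP => // _; apply: divr_ge0; [exact: ltW|have /andP[] := p01 e].
set D : R := (r.*2.+1 ^ d)%:R.
have lamP x : x \in X ->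
    \sum_(e <- edges X | (src e == x) || (dst e == x)) t e ^+ 2 * perc_prob beta e <= q * D.
  move=> xX; apply: (@le_trans _ _ (\sum_(e <- edges X | [&& dst e - src e \in @box d r,
      - (dst e - src e) \in @box d r & (src e == x) || (dst e == x)]) q)); last first.
    rewrite big_const_seq iter_addr addr0 -[_ *+ _]mulr_natr; apply: ler_wpM2l; first exact: ltW.
    by rewrite /D ler_nat -card_box; exact: count_incident_edges.
  rewrite big_mkcond [leRHS]big_mkcond; apply: ler_sum => e _.
  rewrite box_opp andbA andbb.
  case: ifP => [ex|_]; last by case: ifP => // _; exact: ltW.
  rewrite andbT; case: ifPn => er; last by rewrite /t (negbTE er) expr0n mul0r.
  rewrite expr2 -mulrA tp // /t er -[leRHS]mul1r; apply: ler_wpM2r; first exact: ltW.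
  by rewrite ler_pdivrMr ?mul1r ?qp // (lt_le_trans q0) ?qp.
have := Pr_distinct_large_le p01 (edges_uniq X) (fset_uniq X) t0 (@edges_endpoints X) lamP n0.
set S := \sum_(e <- edges X) _; set S' := \sum_(v <- X) _ => SS'.
set T := \sum_(e <- edges X | _) _.
have ST : S = q * T.
  rewrite /S /T mulr_sumr [RHS]big_mkcond; apply: eq_bigr => e _.
  by case: ifPn => er; [rewrite tp|rewrite /t (negbTE er) !mul0r].
have S'le : S' <= #|` X|%:R * (A * Num.sqrt (2 * (q * D)) * n%:R `^ (- th) * (2 * (Num.sqrt n%:R)^-1)).
  rewrite mulr_natl -[_ *+ _]addr0 -iter_addr -(count_predT X) -big_const_seq /S' !big_seq.
  apply: ler_sum => v vX.
  apply: (@le_trans _ _ (\sum_(n <= k < size X) A * Num.sqrt (2 * (q * D)) * n%:R `^ (- th) *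
      ((k * k.+1)%:R^-1 * Num.sqrt k%:R))); last first.
    rewrite -mulr_sumr; apply: ler_wpM2l; last exact: sum_sqrt_tail.
    by rewrite !mulr_ge0 ?sqrtr_ge0 ?powR_ge0 // ltW.
  apply: ler_sum_nat => k /andP[nk _].
  have k0 : (0 < k)%N by exact: leq_trans nk.
  have k0R : 0 < k%:R :> R by rewrite ltr0n.
  rewrite mulrCA; apply: ler_wpM2l; first by rewrite invr_ge0.
  have Emin : Ex (perc_prob beta) (edges X) (fun w => (minn (csize w v X) k)%:R) <=
      A * (2 * k%:R `^ (1 - th)).
    rewrite (Ex_nat_tail _ (N := k)); last by move=> w _; exact: geq_minr.
    apply: (@le_trans _ _ (\sum_(1 <= j < k.+1) A * j%:R `^ (- th))).
      apply: ler_sum_nat => j /andP[j0 jk]; apply: le_trans (PT X v j vX j0).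
      by apply: Pr_sub => // w _; rewrite leq_min => /andP[].
    by rewrite -mulr_sumr; apply: ler_wpM2l (sum_powRN k th01); exact: ltW.
  have Pk : Pr (perc_prob beta) (edges X) (fun w => k < csize w v X)%N <= A * k%:R `^ (- th).
    apply: le_trans (PT X v k vX k0); apply: Pr_sub => // w _; exact: ltnW.
  (* The truncated mean is at most 2 A k^(1 - th) and the tail at most A k^(- th), so the root is of
     order A k^(1/2 - th). Bounding k^(- th) by n^(- th) leaves sqrt k / (k (k + 1)), which sums to
     order n^(- 1/2). *)
  apply: (@le_trans _ _ (Num.sqrt ((A * k%:R `^ (- th)) ^+ 2 * (2 * (q * D)) * k%:R))).
    apply: ler_wsqrtr.
    have -> : (A * k%:R `^ (- th)) ^+ 2 * (2 * (q * D)) * k%:R =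
        q * D * (A * (2 * k%:R `^ (1 - th))) * (A * k%:R `^ (- th)).
      by rewrite powR_addr // powRr1 ?ltW //; ring.
    have D0 : 0 <= q * D by rewrite mulr_ge0 // ltW.
    apply: ler_pM => //; rewrite ?Pr_ge0 //.
      by rewrite mulr_ge0 // Ex_ge0.
    exact: ler_wpM2l.
  rewrite sqrtrM; last by rewrite !mulr_ge0 ?sqr_ge0 // ltW.
  rewrite sqrtrM ?sqr_ge0 // sqrtr_sqr ger0_norm; last by rewrite mulr_ge0 ?powR_ge0 // ltW.
  apply: ler_wpM2r; first exact: sqrtr_ge0.
  rewrite mulrAC; apply: ler_wpM2l; first by rewrite mulr_ge0 ?sqrtr_ge0 // ltW.
  rewrite !powRN lef_pV2 ?posrE ?powR_gt0 //.
  by apply: ge0_ler_powR; rewrite ?nnegrE ?ler_nat //; case/andP: th01.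
rewrite -(ler_pM2l q0) -ST; apply: le_trans SS' (le_trans S'le _).
rewrite [leRHS]mulrCA; apply: ler_wpM2l; first by [].
have -> : 2 * (q * D) = q ^+ 2 * (2 * D / q) by field; rewrite gt_eqF.
rewrite sqrtrM ?sqr_ge0 // sqrtr_sqr ger0_norm; last exact: ltW.
have -> : - (2^-1 + th) = - th + - 2^-1 by ring.
have h12 : n%:R `^ (- 2^-1) = (Num.sqrt n%:R)^-1 :> R by rewrite powRN powR12_sqrt ?ltW.
rewrite powR_addr // h12.
rewrite le_eqVlt; apply/orP; left; apply/eqP; ring.
Qed.

End PowerTail.

Lemma edge_between (d : nat) (x y : Zlattice d) : x != y ->
  exists e : edge d, joins src dst e x y.
Proof.
move=> xy; have c2 : #|` [fset x; y]| == 2%N by rewrite cardfs2 xy.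
exists (exist (fun E : {fset Zlattice d} => #|` E| == 2%N) _ c2).
by rewrite joins_val.
Qed.

Lemma sum_pred1 (R : realType) (T : choiceType) (X : {fset T}) (x : T) :
  \sum_(y <- X) (y == x)%:R = (x \in X)%:R :> R.
Proof. by rewrite -natr_sum -count_sum count_uniq_mem ?fset_uniq. Qed.

Lemma perm_shift (d : nat) (t : Zlattice d) (X : {fset Zlattice d}) :
  perm_eq (shift_set t X) (map (fun x => x + t) X).
Proof.
apply: uniq_perm; rewrite ?map_inj_uniq ?fset_uniq //; try exact: addIr.
by move=> z; apply/imfsetP/mapP => -[y yX ->]; exists y.
Qed.

(** * Averaging over base points *)

Section Averaging.
Context {R : realType} {d : nat} (J : Zlattice d -> R).
Local Notation V := (Zlattice d).
Context (J_gt0 : forall x : V, 0 < J x) (J_sym : forall x : V, J (- x) = J x).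
Implicit Types (X L : {fset V}) (beta A : R).

Local Notation csize := (csize src dst).
Local Notation conn := (conn src dst).
Local Notation perc_prob := (perc_prob J).
Local Notation tail := (tail J).

Definition separated n X (w : {fset edge d}) x y :=
  [&& ~~ conn w x y, n <= csize w x X & n <= csize w y X]%N.

Lemma separatedC n X w x y : separated n X w x y = separated n X w y x.
Proof. by rewrite /separated conn_sym andbA andbAC -andbA. Qed.

(** Each edge arises from at most two pairs (x, z), one per orientation; z = 0 contributes nothing,
    as a vertex is not separated from itself. *)
Lemma sum_separated beta M r X n : 0 <= beta -> {subset box (M + r) <= X} ->
  \sum_(x <- @box d M) \sum_(z <- @box d r)
    Pr (perc_prob beta) (edges X) (fun w => separated n X w x (z + x)) <=
  2 * \sum_(e <- edges X | dst e - src e \in @box d r)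
     Pr (perc_prob beta) (edges X) (distinct_large src dst n X e).
Proof.
move=> b0 MrX; have p01 := perc_prob01 J_gt0 b0.
set S := fun e => Pr (perc_prob beta) (edges X) (distinct_large src dst n X e).
have S0 e : 0 <= S e by exact: Pr_ge0.
(* Counts the orientations of [e] that start at [x] with displacement [z]. *)
pose c (e : edge d) x z : R := (x == src e)%:R * (z == dst e - src e)%:R +
  (x == dst e)%:R * (z == src e - dst e)%:R.
have c0 e x z : 0 <= S e * c e x z.
  by rewrite mulr_ge0 // addr_ge0 // mulr_ge0 // ler0n.
apply: (@le_trans _ _ (\sum_(x <- @box d M) \sum_(z <- @box d r)
    \sum_(e <- edges X) S e * c e x z)).
  rewrite !big_seq; apply: ler_sum => x xM; rewrite !big_seq; apply: ler_sum => z zr.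
  have [->|z0] := eqVneq z 0.
    rewrite add0r [leLHS](_ : _ = 0); first by apply: sumr_ge0 => e _; exact: c0.
    rewrite -[RHS](Ex_cst (perc_prob beta) (edges X)); apply: Ex_eq => w _.
    by rewrite /separated conn_refl.
  have xz : x != z + x by rewrite -subr_eq0 opprD addrCA subrr addr0 oppr_eq0.
  have [e exz] := edge_between xz.
  have zx : z + x \in X by apply: MrX; rewrite addrC; exact: box_add.
  have xX : x \in X by apply: MrX; apply: boxS xM; exact: leq_addr.
  have eX : e \in edges X.
    by rewrite mem_edges; move: exz => /orP[] /andP[/eqP-> /eqP->]; rewrite xX zx.
  rewrite (big_rem e) //= -[leLHS]addr0; apply: lerD; last by apply: sumr_ge0 => c' _; exact: c0.
  have -> : Pr (perc_prob beta) (edges X) (fun w => separated n X w x (z + x)) = S e.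
    apply: Pr_eq => w _; rewrite /distinct_large.
    by move: exz => /orP[] /andP[/eqP-> /eqP->] //; exact: separatedC.
  rewrite -[leLHS]mulr1; apply: ler_wpM2l => //; rewrite /c.
  move: exz => /orP[] /andP[/eqP-> /eqP->]; rewrite addrK !eqxx /= mulr1n mul1r.
    by rewrite lerDl mulr_ge0 // ler0n.
  by rewrite lerDr mulr_ge0 // ler0n.
have swap e : \sum_(x <- @box d M) \sum_(z <- @box d r) c e x z <=
    2 * (dst e - src e \in @box d r)%:R.
  under eq_bigr => x _ do rewrite big_split /= -!mulr_sumr !sum_pred1.
  rewrite big_split /= -!mulr_suml !sum_pred1 -[src e - dst e]opprB box_opp.
  by case: (_ \in box M); case: (_ \in box M); case: (_ \in _) => /=; lra.
have -> : \sum_(x <- @box d M) \sum_(z <- @box d r) \sum_(e <- edges X) S e * c e x z =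
   \sum_(e <- edges X) S e * \sum_(x <- @box d M) \sum_(z <- @box d r) c e x z.
  under eq_bigr => x _ do rewrite exchange_big /=.
  rewrite exchange_big /=; apply: eq_bigr => e _.
  rewrite mulr_sumr; apply: eq_bigr => x _; by rewrite mulr_sumr.
rewrite mulr_sumr [leRHS]big_mkcond; apply: ler_sum => e _.
apply: le_trans (ler_wpM2l (S0 e) (swap e)) _.
by case: (_ \in _); rewrite /= ?mulr0 // mulr1 mulrC.
Qed.

Lemma Pr_both_le beta X x y n (v : R) : 0 <= beta -> 0 <= v ->
  v <= tail beta X x n -> v <= tail beta X y n ->
  v ^+ 2 <= Pr (perc_prob beta) (edges X) (fun w => conn w x y) +
    Pr (perc_prob beta) (edges X) (fun w => separated n X w x y).
Proof.
move=> b0 v0 vx vy; have p01 := perc_prob01 J_gt0 b0.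
apply: (@le_trans _ _ (tail beta X x n * tail beta X y n)).
  by rewrite expr2; exact: ler_pM.
apply: le_trans (Pr_FKG _ p01 (@csize_increasing _ _ _ _ _ _ _) (@csize_increasing _ _ _ _ _ _ _)) _.
rewrite -ExD; apply: Ex_le => // w _; rewrite /separated.
by case: (conn w x y); case: (n <= csize w x X)%N; case: (n <= csize w y X)%N => /=; lra.
Qed.

(** Base points range over the box of radius M inside the region X of radius 2 M. Since M = R0 + r,
    every vertex within r of a base point has in X the translate of X0 based at it, so its tail is
    at least that of [x0]. The factor 2^d compares |X| with the number of base points. *)
Lemma tail_sq_le beta (B Y : R) r X0 x0 n : 0 <= beta -> 0 <= Y -> x0 \in X0 ->
  (forall X o, {subset shift_set o (box r) <= X} ->
     Ex (perc_prob beta) (edges X) (fun w => (csize w o (shift_set o (box r)))%:R) <= B) ->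
  (forall X, \sum_(e <- edges X | dst e - src e \in @box d r)
     Pr (perc_prob beta) (edges X) (distinct_large src dst n X e) <= #|` X|%:R * Y) ->
  tail beta X0 x0 n ^+ 2 * (r.*2.+1 ^ d)%:R <= B + 2 * 2 ^+ d * Y.
Proof.
move=> b0 Y0 x0X0 HB HY; have p01 := perc_prob01 J_gt0 b0.
have [R0 X0R0] := sub_box (shift_set (- x0) X0).
set M := (R0 + r)%N; pose X : {fset V} := box (M + M).
have far y : y \in box (M + r) -> tail beta X0 x0 n <= tail beta X y n.
  move=> yM; have yE : x0 + (y - x0) = y by rewrite addrC subrK.
  rewrite -(tail_shift J_sym beta X0 x0 (y - x0)) yE.
  apply: tail_subset => // z /imfsetP[v /= vX0 ->].
  have -> : v + (y - x0) = y + (v - x0) by rewrite addrCA.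
  apply: boxS (box_add yM (X0R0 _ _)); first by rewrite /M; lia.
  by rewrite mem_shift_set.
set v := tail beta X0 x0 n in far *.
have v0 : 0 <= v by exact: Pr_ge0.
have cM : #|` @box d M|%:R = (M.*2.+1 ^ d)%:R :> R by rewrite card_box.
have cr : #|` @box d r|%:R = (r.*2.+1 ^ d)%:R :> R by rewrite card_box.
have h1 : \sum_(x <- @box d M) \sum_(z <- @box d r) v ^+ 2 <=
    \sum_(x <- @box d M) B + 2 * (#|` X|%:R * Y).
  apply: (@le_trans _ _ (\sum_(x <- @box d M) \sum_(z <- @box d r)
     (Pr (perc_prob beta) (edges X) (fun w => conn w x (z + x)) +
      Pr (perc_prob beta) (edges X) (fun w => separated n X w x (z + x))))).
    rewrite !big_seq; apply: ler_sum => x xM; rewrite !big_seq; apply: ler_sum => z zr.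
    apply: Pr_both_le => //; apply: far; last by rewrite addrC; exact: box_add.
    by apply: boxS xM; exact: leq_addr.
  under eq_bigr => x _ do rewrite big_split /=.
  rewrite big_split /=; apply: lerD; last first.
    apply: le_trans (sum_separated _ b0 _) _; last by apply: ler_wpM2l => //; exact: HY.
    by apply: boxS; rewrite /M; lia.
  rewrite !big_seq; apply: ler_sum => x xM.
  apply: le_trans (HB X x _); last first.
    move=> z /imfsetP[y /= yr ->]; rewrite addrC.
    by apply: boxS (box_add xM yr); rewrite /M; lia.
  by rewrite Ex_csize_Pr (perm_big _ (perm_shift x _)) big_map.
move: h1; rewrite !big_const_seq !iter_addr !addr0 !count_predT.
rewrite -mulrnA -[_ *+ _]mulr_natr -[B *+ _]mulr_natr natrM cM cr.
have cX : #|` X|%:R <= 2 ^+ d * (M.*2.+1 ^ d)%:R :> R.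
  rewrite /X card_box -natrX -natrM -expnMn ler_nat.
  by have [->//|d0] := posnP d; rewrite leq_exp2r //; lia.
set m : R := (M.*2.+1 ^ d)%:R in cM cX *; set D : R := (r.*2.+1 ^ d)%:R => h1.
have m0 : 0 < m by rewrite ltr0n expn_gt0.
rewrite -(ler_pM2l m0); apply: le_trans (_ : B * m + 2 * (#|` X|%:R * Y) <= _).
  by apply: le_trans h1; lra.
have := ler_wpM2r Y0 cX; lra.
Qed.

End Averaging.

Lemma leq_double_succ r : (r <= r.*2.+1)%N.
Proof. by rewrite leqW // -addnn leq_addr. Qed.

Lemma double_succ_leq r : (0 < r)%N -> (r.*2.+1 <= 3 * r)%N.
Proof. lia. Qed.

(** * Choice of scales *)

Section Bootstrap.
Context {R : realType} {d : nat} (J : Zlattice d -> R).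
Local Notation V := (Zlattice d).
Context (J_gt0 : forall x : V, 0 < J x) (J_sym : forall x : V, J (- x) = J x).
Context (alpha c1 beta0 : R).
Hypotheses (d_ge1 : (1 <= d)%N) (alpha0 : 0 <= alpha) (alpha_d : alpha < d%:R).
Hypotheses (c1_gt0 : 0 < c1) (beta0_gt0 : 0 < beta0).
Hypothesis J_box : forall r (x : V), (1 <= r)%N -> x \in box r -> x != 0 ->
  c1 * r%:R `^ (- (d%:R + alpha)) <= J x.

Definition theta : R := (d%:R - alpha) / (2 * d%:R + alpha).

Local Notation tail := (tail J).
Local Notation power_tail := (power_tail J theta).

Let dR : 1 <= d%:R :> R. Proof. by rewrite ler1n. Qed.

Lemma theta_gt0 : 0 < theta.
Proof. have h1 := dR; have h2 := alpha_d; have h3 := alpha0. by apply: divr_gt0; lra. Qed.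

Lemma theta_le_half : theta <= 2^-1.
Proof. have h1 := dR; have h2 := alpha_d; have h3 := alpha0. by rewrite /theta ler_pdivrMr; lra. Qed.

(** The equation that determines [theta]: for r^d of order n^(1 + theta), it turns r^(alpha/2) n^(-
    1/2 - theta) into n^(- 2 theta), the square of the desired tail. *)
Lemma theta_scaling : (1 + theta) * (alpha / (2 * d%:R)) = 2^-1 - theta.
Proof. have h1 := dR; have h2 := alpha_d; have h3 := alpha0. by rewrite /theta; field; apply/andP; split; rewrite gt_eqF //; lra. Qed.

Let th01 : 0 <= theta <= 2^-1.
Proof. by rewrite (ltW theta_gt0) theta_le_half. Qed.

(** Comes from 1 - exp(-y) >= y / (1 + y) with y <= beta0 c1. *)
Definition edge_lb_coef : R := beta0 * c1 / (1 + beta0 * c1).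

Lemma edge_lb_coef_gt0 : 0 < edge_lb_coef.
Proof. by rewrite /edge_lb_coef divr_gt0 ?addr_gt0 // mulr_gt0. Qed.

Definition edge_lb r : R := 1 - expR (- (beta0 * (c1 * r%:R `^ (- (d%:R + alpha))))).

Lemma edge_lb_ge r : (1 <= r)%N -> edge_lb_coef * r%:R `^ (- (d%:R + alpha)) <= edge_lb r.
Proof.
move=> r1; set x := r%:R `^ _; rewrite /edge_lb -/x.
have x0 : 0 <= x by exact: powR_ge0.
have x1 : x <= 1.
  rewrite /x -[leRHS](powRr0 r%:R); apply: ler_powR; first by rewrite ler1n.
  by have h1 := dR; have h3 := alpha0; lra.
set y := beta0 * (c1 * x).
have y0 : 0 <= y by rewrite /y !mulr_ge0 // ltW.
have b1 : 0 < beta0 * c1 by exact: mulr_gt0.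
have yb : y <= beta0 * c1 by rewrite /y mulrA ler_piMr // ltW.
have e1 : expR (- y) <= (1 + y)^-1.
  rewrite expRN lef_pV2 ?posrE ?expR_gt0 //; last by lra.
  exact: expR_ge1Dx.
apply: (@le_trans _ _ (1 - (1 + y)^-1)); last by rewrite lerB.
have -> : 1 - (1 + y)^-1 = y / (1 + y) by field; rewrite gt_eqF //; lra.
have -> : edge_lb_coef * x = y / (1 + beta0 * c1) by rewrite /edge_lb_coef /y; ring.
by apply: ler_wpM2l => //; rewrite lef_pV2 ?posrE; lra.
Qed.

Lemma edge_lb_le beta r (e : edge d) : beta0 <= beta -> (1 <= r)%N ->
  dst e - src e \in @box d r -> edge_lb r <= perc_prob J beta e.
Proof.
move=> bb r1 er; rewrite /edge_lb /perc_prob /open_prob lerB // ler_expR lerN2.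
have x0 : 0 <= c1 * r%:R `^ (- (d%:R + alpha)) by rewrite mulr_ge0 ?powR_ge0 // ltW.
have b0 := ltW beta0_gt0.
apply: ler_pM => //; apply: J_box => //.
by rewrite subr_eq0 eq_sym src_dst_neq.
Qed.

Definition step_coef : R := 4 * 2 ^+ d * Num.sqrt (2 / edge_lb_coef).

Lemma step_coef_ge0 : 0 <= step_coef.
Proof. by rewrite /step_coef !mulr_ge0 ?sqrtr_ge0 // exprn_ge0. Qed.

Lemma tail_sq_step beta A r m0 n X0 x0 : beta0 <= beta -> 0 < A ->
  power_tail beta A -> (1 <= r)%N -> (1 <= m0)%N -> (1 <= n)%N -> x0 \in X0 ->
  6 * A * (r.*2.+1 ^ d)%:R <= m0%:R `^ (1 + theta) ->
  tail beta X0 x0 n ^+ 2 <=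
    4 * A * (3 * m0)%:R `^ (1 - theta) / r%:R ^+ d +
    step_coef * A * r%:R `^ (alpha / 2) * n%:R `^ (- (2^-1 + theta)).
Proof.
move=> bb A0 PT r1 m01 n1 x0X0 m0A.
have b0 : 0 <= beta by apply: le_trans bb; exact: ltW.
have r0R : 0 < r%:R :> R by rewrite ltr0n.
set q := edge_lb r; set D : R := (r.*2.+1 ^ d)%:R.
have q0 : 0 < q.
  apply: lt_le_trans (edge_lb_ge r1); rewrite mulr_gt0 ?powR_gt0 //; exact: edge_lb_coef_gt0.
set Y := 2 * A * Num.sqrt (2 * D / q) * n%:R `^ (- (2^-1 + theta)).
set B := 4 * A * (3 * m0)%:R `^ (1 - theta).
have Y0 : 0 <= Y by rewrite /Y !mulr_ge0 ?sqrtr_ge0 ?powR_ge0 // ltW.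
have B0 : 0 <= B by rewrite /B !mulr_ge0 ?powR_ge0 // ltW.
have H := @tail_sq_le _ _ J J_gt0 J_sym beta B Y r X0 x0 n b0 Y0 x0X0.
have {H} H : tail beta X0 x0 n ^+ 2 * D <= B + 2 * 2 ^+ d * Y.
  apply: H.
    move=> X o sX; apply: (@Ex_csize_power_tail _ _ J J_gt0 theta th01) => //.
      by apply: sX; rewrite -[X in X \in _](add0r o) mem_shift_set box0.
    by rewrite (perm_size (perm_shift _ _)) size_map card_box.
  move=> X; apply: (@sum_distinct_large _ _ J J_gt0 theta th01) => // e.
  exact: edge_lb_le.
have rdD : r%:R ^+ d <= D.
  by rewrite /D -natrX ler_nat leq_exp2r // leq_double_succ.
have rd0 : 0 < r%:R ^+ d :> R by exact: exprn_gt0.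
have D0 : 0 < D by exact: lt_le_trans rdD.
have {}H : tail beta X0 x0 n ^+ 2 <= B / D + 2 * 2 ^+ d * Y / D.
  by rewrite -mulrDl ler_pdivlMr.
apply: le_trans H _; apply: lerD.
  by apply: ler_wpM2l => //; rewrite lef_pV2 ?posrE.
(* The left side is the root of 2 / (q D), and q D is at least [edge_lb_coef] times r^(- d - alpha)
   r^d = r^(- alpha). *)
have sq : Num.sqrt (2 * D / q) / D <= Num.sqrt (2 / edge_lb_coef) * r%:R `^ (alpha / 2).
  have -> : Num.sqrt (2 * D / q) / D = Num.sqrt (2 / (q * D)).
    have q_neq0 : q != 0 by rewrite gt_eqF.
    have D_neq0 : D != 0 by rewrite gt_eqF.
    have -> : 2 / (q * D) = (2 * D / q) * (D^-1) ^+ 2.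
      by field; rewrite q_neq0 D_neq0.
    have DQ0 : 0 <= 2 * D / q.
      by apply: divr_ge0; [apply: mulr_ge0 => //|]; exact: ltW.
    by rewrite [RHS]sqrtrM // sqrtr_sqr ger0_norm // invr_ge0; exact: ltW.
  have -> : r%:R `^ (alpha / 2) = Num.sqrt (r%:R `^ alpha).
    by rewrite -powR12_sqrt ?powR_ge0 // -powRrM.
  rewrite -sqrtrM; last by rewrite divr_ge0 // ltW // edge_lb_coef_gt0.
  apply: ler_wsqrtr.
  rewrite -mulrA; apply: ler_wpM2l => //.
  have qD0 : 0 < q * D by exact: mulr_gt0.
  have cr0 : 0 < edge_lb_coef * r%:R `^ (- alpha).
    by apply: mulr_gt0; [exact: edge_lb_coef_gt0|exact: powR_gt0].
  rewrite -[X in _ <= _ * X]invrK -invfM -powRN lef_pV2 ?posrE //.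
  apply: (@le_trans _ _ (edge_lb_coef * r%:R `^ (- (d%:R + alpha)) * r%:R ^+ d)).
    rewrite -powR_mulrn; last exact: ltW.
    rewrite -mulrA -powR_addr //.
    by rewrite opprD addrAC addNr add0r.
  apply: ler_pM; [|exact: exprn_ge0|exact: edge_lb_ge|exact: rdD].
  by apply: mulr_ge0; [exact/ltW/edge_lb_coef_gt0|exact: powR_ge0].
have -> : 2 * 2 ^+ d * Y / D = 4 * 2 ^+ d * A * n%:R `^ (- (2^-1 + theta)) *
    (Num.sqrt (2 * D / q) / D) by rewrite /Y; ring.
have -> : step_coef * A * r%:R `^ (alpha / 2) * n%:R `^ (- (2^-1 + theta)) =
  4 * 2 ^+ d * A * n%:R `^ (- (2^-1 + theta)) * (Num.sqrt (2 / edge_lb_coef) * r%:R `^ (alpha / 2)).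
  by rewrite /step_coef; ring.
by apply: ler_wpM2l => //; rewrite !mulr_ge0 ?powR_ge0 ?exprn_ge0 // ltW.
Qed.

(** 72 6^d is the constant 4 18 3^d 2^d of the first error term; [K] reduces that term to A^2 n^(- 2
    theta) / 8. *)
Lemma exists_scale : exists2 K : nat, (1 <= K)%N & 72 * 6 ^+ d <= 8^-1 * K%:R `^ (2 * theta).
Proof.
have t2 : 0 < 2 * theta by have := theta_gt0; lra.
set a : R := 8 * (72 * 6 ^+ d).
have a0 : 0 <= a by rewrite /a !mulr_ge0 ?exprn_ge0.
exists (Num.truncn (a `^ (2 * theta)^-1)).+1 => //.
have h : a <= (Num.truncn (a `^ (2 * theta)^-1)).+1%:R `^ (2 * theta).
  have aE : a = (a `^ (2 * theta)^-1) `^ (2 * theta).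
    by rewrite -powRrM mulVf ?powRr1 // gt_eqF.
  rewrite [leLHS]aE.
  apply: ge0_ler_powR; rewrite ?nnegrE ?powR_ge0 //; first exact: ltW.
  by apply/ltW; exact: truncnS_gt.
by move: h; rewrite /a; lra.
Qed.

(* With [N = K n], [r^d] is of order [N^(1 + theta) / A]; then [m0 = 6 3^d N],
   and both error terms are at most [A^2 n^(-2 theta) / 8]. *)
Lemma bootstrap : exists2 C3 : R, 1 <= C3 &
  forall beta A, beta0 <= beta -> C3 <= A -> power_tail beta A -> power_tail beta (A / 2).
Proof.
have [K K1 KP] := exists_scale.
have th_gt0 := theta_gt0; have th_half := theta_le_half; have Hd := dR.
have a0 := alpha0; have ad := alpha_d; have C10 := step_coef_ge0.
have CK0 : 0 <= step_coef * K%:R by rewrite mulr_ge0.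
(* The first summand makes the second error at most A^2 n^(- 2 theta) / 8; the 4 gives A <= (A/2)^2
   for the case Q < 1. *)
exists (8 * step_coef * K%:R + 4); first by lra.
move=> beta A bb AC PT X x n xX n0.
have b0 : 0 <= beta by apply: le_trans bb; exact: ltW.
have A4 : 4 <= A by lra.
have A0 : 0 < A by lra.
have n0R : 0 < n%:R :> R by rewrite ltr0n.
have K0R : 0 < K%:R :> R by rewrite ltr0n.
set N : R := (K * n)%:R.
have N1 : 1 <= N by rewrite ler1n muln_gt0 K1.
have N0 : 0 < N by lra.
have tail0 : 0 <= tail beta X x n by apply: Pr_ge0; exact: perc_prob01.
have tail1 : tail beta X x n <= 1 by apply: Pr_le1; exact: perc_prob01.
set Q := N `^ (1 + theta) / A.
have Q0 : 0 < Q by rewrite divr_gt0 ?powR_gt0.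
have nNth : n%:R `^ theta <= N `^ theta.
  apply: ge0_ler_powR; rewrite ?nnegrE ?(ltW n0R) ?(ltW N0) ?(ltW th_gt0) //.
  by rewrite ler_nat leq_pmull.
(* If Q < 1, no box of radius at least 1 is available, but the claim is trivial: n^(2 theta) <= N^(1
   + theta) < A <= (A/2)^2. *)
have [Q1|Q1] := ltP Q 1.
  apply: (le_trans tail1); rewrite powRN ler_pdivlMr ?powR_gt0 // mul1r.
  apply: le_trans nNth _.
  rewrite -(ler_pXn2r (n := 2)) ?nnegrE ?powR_ge0 //; last lra.
  rewrite -powR_mulrn ?powR_ge0 // -powRrM.
  apply: (@le_trans _ _ (N `^ (1 + theta))); first by apply: ler_powR => //; lra.
  by move: Q1; rewrite /Q ltr_pdivrMr // mul1r => /ltW /le_trans; apply; nra.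
(* The radius is the integer part of [rho]: rounding costs 2^d, and the side 2 r + 1 <= 3 r costs
   3^d. *)
pose rho := Q `^ (d%:R)^-1.
have d0R : 0 < d%:R :> R by lra.
have rho1 : 1 <= rho.
  rewrite /rho -[leLHS](powRr0 Q); apply: ler_powR => //; rewrite invr_ge0; exact: ltW.
have rhod : rho ^+ d = Q.
  rewrite -powR_mulrn ?powR_ge0 // /rho -powRrM mulVf ?gt_eqF // powRr1 //; exact: ltW.
set r := Num.truncn rho.
have r1 : (1 <= r)%N by rewrite /r truncn_gt0.
have r1R : 1 <= r%:R :> R by rewrite ler1n.
have r_le : r%:R <= rho by rewrite /r truncn_le; lra.
have r_gt : rho <= 2 * r%:R.
  by have := truncnS_gt rho; rewrite -/r -natr1; lra.
have rdQ : r%:R ^+ d <= Q by rewrite -rhod; apply: lerXn2r; rewrite ?nnegrE //; lra.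
have Qrd : Q <= 2 ^+ d * r%:R ^+ d.
  by rewrite -rhod -exprMn; apply: lerXn2r; rewrite ?nnegrE //; lra.
have DQ : (r.*2.+1 ^ d)%:R <= 3 ^+ d * Q.
  apply: (@le_trans _ _ (3 ^+ d * r%:R ^+ d)); last by apply: ler_wpM2l => //; exact: exprn_ge0.
  by rewrite -exprMn -natrM -natrX ler_nat leq_exp2r // double_succ_leq.
(* The factor 6 3^d is at least 1, so raising it to 1 + theta only helps against 6 A (2 r + 1)^d <=
   6 3^d N^(1 + theta). *)
set m0 := (6 * 3 ^ d * (K * n))%N.
have m0E : m0%:R = (6 * 3 ^+ d) * N :> R by rewrite /m0 natrM natrM natrX.
have s1 : 1 <= 6 * 3 ^+ d :> R.
  have : 1 <= 3 ^+ d :> R by apply: exprn_ege1; lra.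
  lra.
have m01 : (1 <= m0)%N by rewrite !muln_gt0 expn_gt0 /= K1 n0.
have m0A : 6 * A * (r.*2.+1 ^ d)%:R <= m0%:R `^ (1 + theta).
  apply: (@le_trans _ _ (6 * A * (3 ^+ d * Q))).
    by apply: ler_wpM2l => //; rewrite mulr_ge0 // ltW.
  have -> : 6 * A * (3 ^+ d * Q) = (6 * 3 ^+ d) * N `^ (1 + theta).
    by rewrite /Q; field; rewrite gt_eqF.
  have s0 : 0 <= 6 * 3 ^+ d :> R by lra.
  rewrite m0E (powRM _ s0 (ltW N0)).
  apply: ler_wpM2r; first exact: powR_ge0.
  by apply: le1r_powR => //; lra.
have H := tail_sq_step bb A0 PT r1 m01 n0 xX m0A.
have nth2 : n%:R `^ (- (2 * theta)) = (n%:R `^ (- theta)) ^+ 2 :> R.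
  by rewrite -powR_mulrn ?powR_ge0 // -powRrM; congr powR; ring.
set g := n%:R `^ (- theta) in nth2 *.
have g0 : 0 <= g by exact: powR_ge0.
have T1 : 4 * A * (3 * m0)%:R `^ (1 - theta) / r%:R ^+ d <= A ^+ 2 / 8 * g ^+ 2.
  have s2 : (3 * m0)%:R `^ (1 - theta) <= (18 * 3 ^+ d) * N `^ (1 - theta).
    have -> : (3 * m0)%:R = (18 * 3 ^+ d) * N :> R by rewrite natrM m0E; ring.
    have s0 : 0 <= 18 * 3 ^+ d :> R by lra.
    rewrite (powRM _ s0 (ltW N0)).
    by apply: ler_wpM2r; [exact: powR_ge0|apply: ler1_powR; lra].
  have rd0 : 0 < r%:R ^+ d :> R by apply: exprn_gt0; lra.
  have s3 : (r%:R ^+ d)^-1 <= 2 ^+ d / Q.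
    rewrite ler_pdivlMr // mulrC ler_pdivrMr //.
  apply: (@le_trans _ _ (4 * A * ((18 * 3 ^+ d) * N `^ (1 - theta)) * (2 ^+ d / Q))).
    have A40 : 0 <= 4 * A by lra.
    apply: ler_pM; [|by rewrite invr_ge0; exact: ltW| |exact: s3].
      by apply: mulr_ge0 => //; exact: powR_ge0.
    exact: ler_wpM2l.
  have -> : 4 * A * ((18 * 3 ^+ d) * N `^ (1 - theta)) * (2 ^+ d / Q) =
      A ^+ 2 * (72 * 6 ^+ d * N `^ (- (2 * theta))).
    have -> : - (2 * theta) = (1 - theta) + - (1 + theta) by ring.
    rewrite (powR_addr (1 - theta) (- (1 + theta)) N0) powRN /Q (_ : 6 ^+ d = 3 ^+ d * 2 ^+ d :> R); last first.
      by rewrite -exprMn; congr (_ ^+ _); ring.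
    have y0 : N `^ (1 + theta) != 0 by rewrite gt_eqF ?powR_gt0.
    move: (3 ^+ d : R) (2 ^+ d : R) (N `^ (1 - theta)) (N `^ (1 + theta)) y0 => u v h y y0.
    by field; rewrite y0 gt_eqF.
  rewrite -[leRHS]mulrA; apply: ler_wpM2l; first exact: sqr_ge0.
  have NE : N `^ (- (2 * theta)) = (K%:R `^ (2 * theta))^-1 * g ^+ 2.
    by rewrite /N natrM powRM ?ler0n // nth2 -powRN.
  rewrite NE mulrA; apply: ler_wpM2r; first exact: sqr_ge0.
  by rewrite ler_pdivrMr ?powR_gt0.
have T2 : step_coef * A * r%:R `^ (alpha / 2) * n%:R `^ (- (2^-1 + theta)) <= A ^+ 2 / 8 * g ^+ 2.
  have s4 : r%:R `^ (alpha / 2) <= K%:R * n%:R `^ (2^-1 - theta).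
    have -> : alpha / 2 = d%:R * (alpha / (2 * d%:R)) by field; rewrite gt_eqF.
    rewrite powRrM powR_mulrn; last lra.
    have e0 : 0 <= alpha / (2 * d%:R) by apply: divr_ge0; lra.
    apply: (@le_trans _ _ ((N `^ (1 + theta)) `^ (alpha / (2 * d%:R)))).
      apply: ge0_ler_powR => //; rewrite ?nnegrE ?powR_ge0 ?exprn_ge0 //.
      apply: (le_trans rdQ); rewrite /Q ler_pdivrMr // ler_peMr ?powR_ge0 //; lra.
    rewrite -powRrM theta_scaling /N natrM powRM ?ler0n //.
    apply: ler_wpM2r; first exact: powR_ge0.
    by apply: ler1_powR; [rewrite ler1n|lra].
  apply: (@le_trans _ _ (step_coef * A * (K%:R * n%:R `^ (2^-1 - theta)) * n%:R `^ (- (2^-1 + theta)))).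
    by apply: ler_wpM2r; [exact: powR_ge0|apply: ler_wpM2l => //; apply: mulr_ge0 => //; exact: ltW].
  have gg : n%:R `^ (2^-1 - theta) * n%:R `^ (- (2^-1 + theta)) = g ^+ 2 :> R.
    by rewrite -nth2 -powR_addr //; congr powR; ring.
  have -> : step_coef * A * (K%:R * n%:R `^ (2^-1 - theta)) * n%:R `^ (- (2^-1 + theta)) =
      step_coef * A * K%:R * (n%:R `^ (2^-1 - theta) * n%:R `^ (- (2^-1 + theta))) by ring.
  rewrite gg; apply: ler_wpM2r; first exact: sqr_ge0.
  have : 0 <= A * (A - 8 * (step_coef * K%:R)) by apply: mulr_ge0; lra.
  lra.
rewrite -(ler_pXn2r (n := 2)) ?nnegrE //; last by rewrite mulr_ge0 // divr_ge0 // ltW.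
apply: le_trans H _; rewrite exprMn.
have -> : (A / 2) ^+ 2 = A ^+ 2 / 8 + A ^+ 2 / 8 by field.
by rewrite [leRHS]mulrDl; apply: lerD.
Qed.

(** The initial constant may depend on [beta]; it is halved until it falls below a threshold that
    does not. *)
Lemma power_tail_universal : exists2 C3 : R, 1 <= C3 &
  forall beta A, beta0 <= beta -> power_tail beta A -> power_tail beta C3.
Proof.
have [C3 C31 H] := bootstrap; exists C3 => // beta A bb.
have C30 : 0 < C3 by lra.
have [k Ak] : exists k : nat, A <= C3 * 2 ^+ k.
  exists (Num.truncn (A / C3)).+1; rewrite mulrC -ler_pdivrMr //.
  apply: (@le_trans _ _ (Num.truncn (A / C3)).+1%:R); first exact/ltW/truncnS_gt.
  by rewrite -natrX ler_nat ltnW // ltn_expl.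
elim: k A Ak => [|k IH] A Ak PT.
  move=> X x m xX m0; apply: le_trans (PT X x m xX m0) _.
  apply: ler_wpM2r; first exact: powR_ge0.
  by rewrite expr0 mulr1 in Ak.
have [AC|CA] := leP A C3.
  move=> X x m xX m0; apply: le_trans (PT X x m xX m0) _.
  by apply: ler_wpM2r => //; exact: powR_ge0.
apply: (IH (A / 2)); first by rewrite exprS in Ak; lra.
by apply: H => //; exact: ltW.
Qed.

End Bootstrap.

(** * The intensity *)

Lemma leq_double_sub u v z : (2 * z <= v -> u <= v -> u <= 2 * (v - z))%N.
Proof. lia. Qed.

Section Intensity.
Context {R : realType} {d : nat} (J : Zlattice d -> R).
Local Notation V := (Zlattice d).
Context (alpha c r0 Jtot : R).
Hypotheses (d_ge1 : (1 <= d)%N) (J_gt0 : forall x : V, 0 < J x) (c_gt0 : 0 < c).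
Hypothesis J_lb : forall x : V, r0 <= lattice_norm1 R x ->
  c * lattice_norm1 R x `^ (- d%:R - alpha) <= J x.
Hypothesis J_sum : forall F : {fset V}, \sum_(x <- F) J x <= Jtot.

Local Notation norm1 := (lattice_norm1 R).

Lemma norm1E (x : V) : norm1 x = \sum_(i < d) (`|x ord0 i|)%:~R.
Proof. by rewrite /lattice_norm1 rmorph_sum. Qed.

Lemma norm1_box r (x : V) : x \in box r -> norm1 x <= (d * r)%:R.
Proof.
move=> /mem_box H; rewrite norm1E.
apply: (@le_trans _ _ (\sum_(i < d) (r%:R : R))); last first.
  by rewrite sumr_const card_ord -mulrnA mulnC.
by apply: ler_sum => i _; rewrite [leRHS]pmulrn ler_int; exact: H.
Qed.

Lemma coord_le_norm1 (x : V) i : (`|x ord0 i|)%:~R <= norm1 x.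
Proof.
rewrite norm1E (bigD1 i) //= lerDl; apply: sumr_ge0 => j _.
by rewrite ler0z.
Qed.

Lemma box_norm1 r (x : V) : norm1 x <= r%:R -> x \in box r.
Proof.
move=> xr; apply/mem_box => i; rewrite -(ler_int R) -pmulrn.
exact: le_trans (coord_le_norm1 x i) xr.
Qed.

Lemma norm1_ge1 (x : V) : x != 0 -> 1 <= norm1 x.
Proof.
move=> x0; have [i xi] : exists i, x ord0 i != 0.
  apply/existsP; apply: contraNT x0; rewrite negb_exists => /forallP H.
  apply/eqP/rowP => i; rewrite mxE; have := H i; rewrite negbK => /eqP.
  by have -> : (0 : 'I_1) = ord0 by exact: val_inj.
apply: le_trans (coord_le_norm1 x i); rewrite ler1z.
by rewrite -gtz0_ge1 normr_gt0.
Qed.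

(** Far points have l1 norm at most d r, which costs d^(- d - alpha). Points of norm below [r0] lie
    in a fixed box, where the positive minimum [mu] of [J] suffices because r^(- d - alpha) <= 1. *)
Lemma J_power_lb : exists2 c1 : R, 0 < c1 & 0 <= d%:R + alpha ->
  forall r (x : V), (1 <= r)%N -> x \in box r -> x != 0 ->
    c1 * r%:R `^ (- (d%:R + alpha)) <= J x.
Proof.
set m := (Num.truncn r0).+1.
set mu := \big[Num.min/1]_(x <- @box d m) J x.
have mu0 : 0 < mu.
  by rewrite /mu; elim/big_ind: _ => // u v u0 v0; rewrite lt_min u0.
have muP x : x \in @box d m -> mu <= J x.
  by move=> xm; rewrite /mu; exact: (@ge_bigmin_seq _ R _ _ 1 x xpredT J).
have dd : 0 < d%:R :> R by rewrite ltr0n.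
exists (Num.min (c * d%:R `^ (- (d%:R + alpha))) mu).
  by rewrite lt_min mu0 mulr_gt0 ?powR_gt0.
move=> da r x r1 xr x0.
have r0R : 0 < r%:R :> R by rewrite ltr0n.
have rp : r%:R `^ (- (d%:R + alpha)) <= 1.
  by rewrite -[leRHS](powRr0 r%:R); apply: ler_powR; rewrite ?ler1n ?oppr_le0.
have [xbig|xsmall] := leP r0 (norm1 x).
  apply: le_trans (J_lb xbig).
  apply: (@le_trans _ _ (c * d%:R `^ (- (d%:R + alpha)) * r%:R `^ (- (d%:R + alpha)))).
    by apply: ler_wpM2r; [exact: powR_ge0|rewrite ge_min lexx].
  rewrite -mulrA; apply: ler_wpM2l; first exact: ltW.
  rewrite -powRM ?ler0n // -natrM -opprD !powRN.
  have n0 : 0 < norm1 x by apply: lt_le_trans (norm1_ge1 x0).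
  rewrite lef_pV2 ?posrE ?powR_gt0 ?ltr0n ?muln_gt0 ?d_ge1 //.
  apply: ge0_ler_powR => //; rewrite ?nnegrE ?ler0n //; first exact: ltW.
  exact: norm1_box.
have xm : x \in box m.
  apply: box_norm1; apply: ltW; apply: lt_trans xsmall _; exact: truncnS_gt.
apply: le_trans (muP x xm).
apply: (@le_trans _ _ (mu * r%:R `^ (- (d%:R + alpha)))).
  by apply: ler_wpM2r; [exact: powR_ge0|rewrite ge_min lexx orbT].
by rewrite ler_piMr // ltW.
Qed.

(* If [alpha < 0] then, with [al = max(alpha, - d / 2)], the sum of [J] over
   the annulus between radii [m] and [k] is at least of order [k^(- al)]. *)
Lemma alpha_ge0 : 0 <= alpha.
Proof.
rewrite leNgt; apply/negP => aneg.
have d1 : 1 <= d%:R :> R by rewrite ler1n.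
(* Raising alpha weakens the lower bound at points of norm at least 1; staying above - d/2 keeps d +
   al positive, so the bound decreases with the norm. *)
set al := Num.max alpha (- (d%:R / 2)).
have al0 : al < 0 by rewrite /al gt_max aneg /=; lra.
have al1 : - (d%:R / 2) <= al by rewrite le_max lexx orbT.
have al2 : alpha <= al by rewrite le_max lexx.
set m := (Num.truncn r0).+2.
have m1 : 1 <= m%:R :> R by rewrite ler1n.
have mr0 : r0 <= m%:R.
  by apply: ltW; apply: lt_trans (truncnS_gt r0) _; rewrite ltr_nat.
set g := d%:R + al.
have g0 : 0 < g by rewrite /g; lra.
set K : R := c * d%:R `^ (- g) / 2.
have K0 : 0 < K by rewrite /K divr_gt0 // mulr_gt0 // powR_gt0 // ltr0n.
have lower k : (m.*2.+1 <= k)%N -> K * k%:R `^ (- al) <= Jtot.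
  move=> mk; have k0 : (0 < k)%N by exact: leq_trans mk.
  have k0R : 0 < k%:R :> R by rewrite ltr0n.
  pose F := (@box d k) `\` (@box d m).
  apply: le_trans (J_sum F).
  apply: (@le_trans _ _ (\sum_(x <- F) c * (d * k)%:R `^ (- g))); last first.
    rewrite !big_seq; apply: ler_sum => x; rewrite inE => /andP[xm xk].
    have mx : m%:R <= norm1 x.
      by rewrite leNgt; apply: contra xm => /ltW /box_norm1.
    apply: le_trans (J_lb (le_trans mr0 mx)); apply: ler_wpM2l; first exact: ltW.
    apply: (@le_trans _ _ (norm1 x `^ (- g))).
      rewrite !powRN lef_pV2 ?posrE ?powR_gt0 ?ltr0n ?muln_gt0 ?d_ge1 //; last by lra.
      apply: ge0_ler_powR; rewrite ?nnegrE ?ler0n //; [exact: ltW|lra|exact: norm1_box].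
    by apply: ler_powR; [lra|rewrite /g; lra].
  rewrite big_const_seq iter_addr addr0 count_predT -[(c * _) *+ _]mulr_natr.
  have cF : (k ^ d <= 2 * #|` F|)%N.
    have c1 : (#|` F| = k.*2.+1 ^ d - m.*2.+1 ^ d)%N.
      rewrite /F cardfsD (fsetIidPr _) ?card_box //.
      by apply/fsubsetP; apply: boxS; apply: leq_trans mk; rewrite leqW // -addnn leq_addr.
    have c2 : (2 * m.*2.+1 ^ d <= k.*2.+1 ^ d)%N.
      apply: (@leq_trans ((2 * m.*2.+1) ^ d)%N).
        rewrite expnMn leq_mul2r; apply/orP; right.
        by rewrite -{1}(expn1 2) leq_exp2l.
      rewrite leq_exp2r // mul2n; apply: leq_trans (_ : k.*2 <= _)%N => //.
      by rewrite leq_double.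
    have c3 : (k ^ d <= k.*2.+1 ^ d)%N by rewrite leq_exp2r // leq_double_succ.
    by rewrite c1; exact: leq_double_sub.
  have cFR : k%:R ^+ d <= 2 * (size F)%:R :> R.
    by rewrite -natrX -natrM ler_nat.
  have -> : K * k%:R `^ (- al) = c * (d * k)%:R `^ (- g) * (k%:R ^+ d / 2).
    rewrite natrM powRM ?ler0n // /K -powR_mulrn ?(ltW k0R) //.
    have -> : k%:R `^ (- al) = k%:R `^ (- g) * k%:R `^ d%:R :> R.
      by rewrite -powR_addr //; congr powR; rewrite /g; ring.
    by field.
  apply: ler_wpM2l; first by rewrite mulr_ge0 ?powR_ge0 // ltW.
  lra.
set T : R := `|Jtot| / K + 1.
have T0 : 0 <= T by rewrite addr_ge0 // divr_ge0 // ltW.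
have b0 : 0 < - al by lra.
set k := maxn m.*2.+1 (Num.truncn (T `^ (- al)^-1)).+1.
have := lower k (leq_maxl _ _); apply/negP; rewrite -ltNge.
have TE : T = (T `^ (- al)^-1) `^ (- al) by rewrite -powRrM mulVf ?powRr1 // gt_eqF.
have kT : T <= k%:R `^ (- al).
  rewrite [leLHS]TE; apply: ge0_ler_powR; rewrite ?nnegrE ?powR_ge0 ?ler0n //.
    exact: ltW.
  apply: (@le_trans _ _ (Num.truncn (T `^ (- al)^-1)).+1%:R).
    by apply/ltW; exact: truncnS_gt.
  by rewrite ler_nat leq_maxr.
apply: lt_le_trans (ler_wpM2l (ltW K0) kT).
rewrite /T mulrDr mulrCA divff ?gt_eqF // mulr1.
by have := ler_norm Jtot; lra.
Qed.

End Intensity.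

(** * Subcritical mean cluster size *)

Section Subcritical.
Context {R : realType} {d : nat} (J : Zlattice d -> R).
Local Notation V := (Zlattice d).
Context (J_gt0 : forall x : V, 0 < J x) (J_sym : forall x : V, J (- x) = J x).
Implicit Types (X S : {fset V}) (beta : R).

Local Notation csize := (csize src dst).
Local Notation conn := (conn src dst).
Local Notation perc_prob := (perc_prob J).

Definition phiX beta X S o : R := phi src dst (perc_prob beta) (edges X) S o.

(** The summand of [phi] as a symmetric function of an ordered pair, since a translation may
    exchange [src] and [dst]. *)
Definition exit_flow (S : {fset V}) (F : V -> R) (e : edge d) x y : R :=
  (exits src dst S e x y)%:R * F x + (exits src dst S e y x)%:R * F y.

Lemma phiXE beta X S o : phiX beta X S o = \sum_(e <- edges X) perc_prob beta e *
  exit_flow S (fun x => Pr (perc_prob beta) (edges X) (fun w => conn_within src dst S w o x))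
    e (src e) (dst e).
Proof. by []. Qed.

Lemma exit_flow_joins S F e x y : joins src dst e x y ->
  exit_flow S F e (src e) (dst e) = exit_flow S F e x y.
Proof. by rewrite /exit_flow => /orP[] /andP[/eqP-> /eqP->] //; rewrite addrC. Qed.

Lemma conn_within_shift t S (w : {fset edge d}) x y :
  conn_within src dst (shift_set t S) (shift_edge t @` w) (x + t) (y + t) =
  conn_within src dst S w x y.
Proof.
rewrite /conn_within -[RHS](conn_shift t); congr (_ _ _ _).
apply/fsetP => e; rewrite mem_restrict; apply/idP/idP.
  move=> /and3P[/imfsetP[c /= cw ->] sc dc]; apply/imfsetP; exists c => //=.
  rewrite mem_restrict cw /=; move: sc dc.
  by have := joins_shift t (joins_ab src dst c); move=> /orP[] /andP[/eqP-> /eqP->];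
    rewrite !mem_shift_set => -> ->.
move=> /imfsetP[c /=]; rewrite mem_restrict => /and3P[cw sc dc] ->.
have H := joins_shift t (joins_ab src dst c).
apply/and3P; split; first by apply/imfsetP; exists c.
  by move: H => /orP[] /andP[/eqP E1 /eqP E2]; rewrite ?E1 ?E2 mem_shift_set.
by move: H => /orP[] /andP[/eqP E1 /eqP E2]; rewrite ?E1 ?E2 mem_shift_set.
Qed.

Lemma phiX_shift beta t X S o :
  phiX beta (shift_set t X) (shift_set t S) (o + t) = phiX beta X S o.
Proof.
rewrite !phiXE -(perm_big _ (edges_shift t X)) big_map; apply: eq_bigr => e _.
have js := joins_shift t (joins_ab src dst e).
rewrite (exit_flow_joins _ _ js) /perc_prob {1}/open_prob edge_rate_shift //; congr (_ * _).
have exE x y : exits src dst (shift_set t S) (shift_edge t e) (x + t) (y + t) =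
    joins src dst (shift_edge t e) (x + t) (y + t) && (x \in S) && (y \notin S).
  by rewrite /exits !mem_shift_set andbA.
have PE x : Pr (perc_prob beta) (edges (shift_set t X)) (fun w =>
      conn_within src dst (shift_set t S) w (o + t) (x + t)) =
    Pr (perc_prob beta) (edges X) (fun w => conn_within src dst S w o x).
  by apply: Pr_shift => // w; rewrite conn_within_shift.
rewrite /exit_flow !PE !exE js joinsC js /exits (joins_ab src dst e).
by rewrite joinsC (joins_ab src dst e) /= .
Qed.

Lemma exit_flow_ge0 S F e x y : (forall z, 0 <= F z) -> 0 <= exit_flow S F e x y.
Proof. by move=> F0; rewrite addr_ge0 // mulr_ge0 // ler0n. Qed.

Lemma phiX_subset beta X X' S o : 0 <= beta -> {subset X <= X'} ->
  phiX beta X S o <= phiX beta X' S o.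
Proof.
move=> b0 XX'; have p01 := perc_prob01 J_gt0 b0.
have eXX : {subset edges X <= edges X'}.
  by move=> e; rewrite !mem_edges => /andP[/XX' -> /XX' ->].
have P : perm_eq (edges X') ([seq e <- edges X' | e \notin edges X] ++ edges X).
  apply: uniq_perm; rewrite ?edges_uniq //.
    rewrite cat_uniq edges_uniq filter_uniq ?edges_uniq //= andbT.
    by apply/hasPn => e eX; rewrite mem_filter eX.
  by move=> e; rewrite mem_cat mem_filter; have [/eXX ->|] := boolP (e \in edges X);
    rewrite ?orbF ?orbT.
have F0 Z z : 0 <= Pr (perc_prob beta) (edges Z) (fun w => conn_within src dst S w o z).
  exact: Pr_ge0.
rewrite !phiXE [leRHS](perm_big _ P) big_cat /= -[leLHS]add0r; apply: lerD.
  by apply: sumr_ge0 => e _; rewrite mulr_ge0 ?exit_flow_ge0 //; case/andP: (p01 e).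
apply: ler_sum => e _; apply: ler_wpM2l; first by case/andP: (p01 e).
by apply: lerD; apply: ler_wpM2l => //; apply: Pr_subset; rewrite ?edges_uniq //;
  exact: conn_within_increasing.
Qed.

Lemma Ex_csize_of_phi beta S kappa : 0 <= beta -> 0 \in S -> kappa < 1 ->
  (forall X, phiX beta X S 0 <= kappa) ->
  forall X o, o \in X ->
    Ex (perc_prob beta) (edges X) (fun w => (csize w o X)%:R) <= #|` S|%:R / (1 - kappa).
Proof.
move=> b0 S0 k1 phiP X; have p01 := perc_prob01 J_gt0 b0.
apply: (@Ex_csize_subcritical _ _ _ src dst _ _ _ (fun o => shift_set o S)) => //.
- exact: edges_uniq.
- exact: edges_endpoints.
move=> o oX; split.
- by rewrite -[X in X \in _]add0r mem_shift_set.
- by rewrite (perm_size (perm_shift _ _)) size_map.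
rewrite -/(phiX beta X (shift_set o S) o) -(phiX_shift beta (- o)).
have -> : shift_set (- o) (shift_set o S) = S.
  by apply/fsetP => x; rewrite -{1}[x](addrK o) !mem_shift_set.
by rewrite subrr; exact: phiP.
Qed.

(** With S = {0}, [phi] is at most beta times the total intensity, hence at most 1/2, and the mean
    is at most 1 / (1 - 1/2). *)
Lemma Ex_csize_small beta Jtot : (forall F : {fset V}, \sum_(x <- F) J x <= Jtot) ->
  0 <= beta -> beta * Jtot <= 2^-1 ->
  forall X o, o \in X ->
    Ex (perc_prob beta) (edges X) (fun w => (csize w o X)%:R) <= 2.
Proof.
move=> Jsum b0 bJ X o oX; have p01 := perc_prob01 J_gt0 b0.
have h2 : 2^-1 < 1 :> R by lra.
have -> : 2 = #|` [fset (0 : V)]|%:R / (1 - 2^-1) :> R by rewrite cardfs1; field.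
apply: Ex_csize_of_phi => //; first by rewrite inE.
move=> {oX o}X; apply: le_trans bJ; rewrite phiXE.
(* The other end of an edge at 0; it determines the edge, so the sum over edges is a sum of [J] over
   distinct points. *)
pose g (e : edge d) : V := if src e == 0 then dst e else src e.
pose T (e : edge d) := (src e == 0) || (dst e == 0).
have jg e : T e -> joins src dst e 0 (g e).
  rewrite /T /joins /g; have [->|_ /= /eqP ->] := eqVneq (src e) 0; first by rewrite !eqxx.
  by rewrite !eqxx.
apply: (@le_trans _ _ (\sum_(e <- edges X | T e) beta * J (g e))).
  rewrite [leRHS]big_mkcond; apply: ler_sum => e _; case: ifPn => Te.
    rewrite -[leRHS]mulr1; apply: ler_pM.
    - by case/andP: (p01 e).
    - by apply: exit_flow_ge0 => z; exact: Pr_ge0.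
    - rewrite /perc_prob /open_prob (edge_rate_joins J_sym (jg e Te)) subr0.
      by have := expR_ge1Dx (- (beta * J (g e))); lra.
    rewrite (exit_flow_joins _ _ (jg e Te)) /exit_flow /exits !inE eqxx /= !andbF mul0r addr0.
    have := Pr_le1 (edges X) (fun w => conn_within src dst [fset 0] w 0 0) p01.
    by case: (_ && _); rewrite ?mul1r ?mul0r.
  rewrite /exit_flow /exits !inE; move: Te; rewrite /T negb_or => /andP[/negbTE -> /negbTE ->].
  by rewrite !andbF !mul0r addr0 mulr0.
rewrite -mulr_sumr; apply: ler_wpM2l => //; apply: le_trans (Jsum X).
rewrite -big_filter -(big_map g xpredT J).
have ug : uniq (map g [seq e <- edges X | T e]).
  rewrite map_inj_in_uniq ?filter_uniq ?edges_uniq // => e e'.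
  rewrite !mem_filter => /andP[Te _] /andP[Te' _] gg.
  by apply: (edge_eq (jg e Te)); rewrite gg; exact: jg.
have sg : {subset map g [seq e <- edges X | T e] <= X}.
  move=> z /mapP[e]; rewrite mem_filter mem_edges => /andP[_ /andP[sX dX]] ->.
  by rewrite /g; case: ifP.
have P : perm_eq X ([seq x <- X | x \notin map g [seq e <- edges X | T e]] ++
    map g [seq e <- edges X | T e]).
  apply: uniq_perm; rewrite ?fset_uniq //.
    rewrite cat_uniq ug filter_uniq ?fset_uniq //= andbT.
    by apply/hasPn => z zg; rewrite mem_filter zg.
  move=> z; rewrite mem_cat mem_filter.
  by have [/sg ->|] := boolP (z \in map g _); rewrite ?orbF ?orbT.
rewrite [leRHS](perm_big _ P) big_cat /= lerDr; apply: sumr_ge0 => z _; exact: ltW.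
Qed.

End Subcritical.

(** * Passage to infinite volume *)

Local Open Scope classical_set_scope.
Local Open Scope ring_scope.
Local Open Scope card_scope.

Lemma card_ge_fsetP (T : choiceType) (S : set T) m :
  (`I_m #<= S) <-> exists2 F : {fset T}, [set` F] `<=` S & (m <= #|` F|)%N.
Proof.
split=> [mS|[F FS mF]].
  have [/finite_fsetP[X SX]|/(@infinite_set_fset _ _ m)[F FS mF]] := pselect (finite_set S).
    exists X; first by rewrite SX.
    rewrite -card_le_II; apply: card_le_trans mS _; rewrite SX.
    by have /card_eq_fsetP := erefl #|` X|; rewrite card_eq_le => /andP[].
  by exists F.
apply: card_le_trans (subset_card_le FS).
rewrite -card_le_II in mF; apply: card_le_trans mF _.
by have /card_eq_fsetP := erefl #|` F|; rewrite card_eq_le => /andP[].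
Qed.

Section InfiniteVolume.
Context {R : realType} {d : nat} (J : Zlattice d -> R) (beta : R).
Context (P : probability (config d) R) (PJ : percolation_law J beta P).
Local Notation V := (Zlattice d).
Implicit Types (w : config d) (X : {fset V}).

Local Notation csize := (csize src dst).
Local Notation conn := (conn src dst).
Local Notation openX X w := (open_in (edges X) w).

Lemma conn_open_connected X w x y : conn (openX X w) x y -> open_connected w x y.
Proof.
move=> /asboolP[q pq ql]; exists q => //; apply: sub_path pq => u v /adjP[e].
rewrite mem_open_in joins_val => /andP[_ we] /eqP ev.
by apply/asboolP; exists e.
Qed.

Lemma openX_subset X X' w : {subset X <= X'} -> (openX X w `<=` openX X' w)%fset.
Proof.
move=> XX'; apply/fsubsetP => e; rewrite !mem_open_in !mem_edges.
by move=> /andP[/andP[/XX' -> /XX' ->] ->].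
Qed.

Lemma open_connected_box w x y : open_connected w x y ->
  exists N, forall n, (N <= n)%N -> conn (openX (box n) w) x y /\ y \in box n.
Proof.
move=> [q pq ql].
have [N qN] := sub_box [fset z in x :: q]%fset.
exists N => n Nn.
have qn z : z \in x :: q -> z \in box n.
  by move=> zq; apply: (boxS Nn); apply: qN; rewrite !inE in zq *.
split; last by apply: qn; rewrite -ql mem_last.
apply/asboolP; exists q => //.
elim: q x pq {ql qN} qn => [//|z q IH] x /= /andP[xz pq] qn.
apply/andP; split; last by apply: IH => // u uq; apply: qn; rewrite inE uq orbT.
move: xz => /asboolP[e ev we]; apply/adjP.
have exz : joins src dst e x z by rewrite joins_val; apply/eqP.
exists e => //; rewrite mem_open_in mem_edges we andbT.
have xn := qn x (mem_head _ _).
have zn : z \in box n by apply: qn; rewrite !inE eqxx orbT.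
by move: exz => /orP[] /andP[/eqP-> /eqP->]; rewrite xn zn.
Qed.

Lemma openX_boxS m n w : (m <= n)%N -> (openX (box m) w `<=` openX (box n) w)%fset.
Proof. by move=> mn; apply: openX_subset; exact: boxS. Qed.

Lemma connected_bigcup x y : [set w | open_connected w x y] =
  \bigcup_n [set w : config d | conn (openX (box n) w) x y].
Proof.
apply/seteqP; split => w /=.
  by move=> /open_connected_box[N H]; exists N => //; have [] := H N (leqnn _).
by move=> [n _ /conn_open_connected].
Qed.

Lemma measurable_connected x y : measurable [set w : config d | open_connected w x y].
Proof.
rewrite connected_bigcup; apply: bigcupT_measurable => n.
exact: (measurable_cylinder (edges (box n)) (fun v => conn v x y)).
Qed.

Lemma big_cluster_bigcup x m : [set w | `I_m #<= open_cluster w x] =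
  \bigcup_n [set w : config d | (m <= csize (openX (box n) w) x (box n))%N].
Proof.
apply/seteqP; split => w /=.
  move=> /card_ge_fsetP[F FS mF].
  have [N NF] : exists N, forall y, y \in F -> conn (openX (box N) w) x y /\ y \in box N.
    have /choice[f fP] : forall y, exists N, y \in F ->
        forall n, (N <= n)%N -> conn (openX (box n) w) x y /\ y \in box n.
      move=> y; have [yF|yF] := boolP (y \in F); last by exists 0%N.
      by have [N H] := open_connected_box (FS y yF); exists N.
    exists (\max_(y <- F) f y)%N => y yF; apply: fP => //.
    exact: (leq_bigmax_seq (F := f)).
  exists N => //=; apply: leq_trans mF _; rewrite csizeE -size_filter.
  apply: uniq_leq_size; first exact: fset_uniq.
  by move=> y yF; rewrite mem_filter; have [-> ->] := NF y yF.
move=> [n _ /= mc]; apply/card_ge_fsetP.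
exists [fset y in box n | conn (openX (box n) w) x y]%fset.
  by move=> y /=; rewrite !inE => /andP[_ /conn_open_connected].
apply: leq_trans mc _; rewrite csizeE -size_filter.
apply: uniq_leq_size; first by rewrite filter_uniq // fset_uniq.
by move=> y; rewrite mem_filter !inE andbC.
Qed.

Lemma measurable_big_cluster x m : measurable [set w : config d | `I_m #<= open_cluster w x].
Proof.
rewrite big_cluster_bigcup; apply: bigcupT_measurable => n.
exact: (measurable_cylinder (edges (box n)) (fun v => (m <= csize v x (box n))%N)).
Qed.

Lemma P_bigcup_cylinder_le (A : forall n : nat, {fset edge d} -> bool) (c : R) N :
  nondecreasing_seq (fun n => [set w : config d | A n (openX (box n) w)]) ->
  (forall n, (N <= n)%N ->
    Pr (perc_prob J beta) (edges (@box d n)) (A n) <= c) ->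
  (P (\bigcup_n [set w : config d | A n (openX (box n) w)]) <= c%:E)%E.
Proof.
move=> nd H.
have mA n : measurable [set w : config d | A n (openX (box n) w)].
  exact: measurable_cylinder.
have cv := nondecreasing_cvg_mu (mu := P) mA (bigcupT_measurable _ mA) nd.
rewrite -(cvg_lim _ cv) //; apply: lime_le; first by apply/cvg_ex; eexists; exact: cv.
near=> n; rewrite /= (P_cylinder PJ) ?edges_uniq // lee_fin; apply: H.
by near: n; exact: nbhs_infty_ge.
Unshelve. all: by end_near. Qed.

Lemma P_big_cluster_le x m (c : R) :
  (forall X, x \in X -> tail J beta X x m <= c) ->
  (P [set w | `I_m #<= open_cluster w x] <= c%:E)%E.
Proof.
move=> H; rewrite big_cluster_bigcup.
have [N xN] := sub_box [fset x]%fset.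
apply: (@P_bigcup_cylinder_le (fun n v => (m <= csize v x (box n))%N) c N).
  move=> n1 n2 n12; apply/subsetPset => w /=; move=> /leq_trans; apply.
  apply: leq_trans (csizeS _ _ _ _ (openX_boxS w n12)) _.
  by apply: csize_subset; exact: boxS.
by move=> n Nn; apply: H; apply: (boxS Nn); apply: xN; rewrite inE.
Qed.

Lemma sum_P_connected_le n (c : R) :
  (forall X, {subset box n <= X} ->
    Ex (perc_prob J beta) (edges X) (fun v => (csize v 0 (box n))%:R) <= c) ->
  (\sum_(x <- @box d n) P [set w | open_connected w 0%R x] <= c%:E)%E.
Proof.
move=> H.
pose F x k := [set w : config d | conn (openX (box k) w) 0 x].
have mF x k : measurable (F x k).
  exact: (measurable_cylinder (edges (box k)) (fun v => conn v 0 x)).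
have cv : (\sum_(x <- @box d n) P (F x k) @[k --> \oo] -->
   \sum_(x <- @box d n) P [set w | open_connected w 0%R x])%E.
  apply: cvg_nnesum => x _; first by apply: nearW => k; exact: measure_ge0.
  rewrite connected_bigcup; apply: nondecreasing_cvg_mu => //.
    by apply: bigcupT_measurable => k; exact: mF.
  move=> n1 n2 n12; apply/subsetPset => w /=; apply: connS; exact: openX_boxS.
rewrite -(cvg_lim _ cv) //; apply: lime_le; first by apply/cvg_ex; eexists; exact: cv.
near=> k.
rewrite (eq_bigr (fun x => (Pr (perc_prob J beta) (edges (@box d k)) (fun v => conn v 0 x))%:E)); last first.
  move=> x _; exact: (P_cylinder PJ (fun v => conn v 0 x) (edges_uniq _)).
rewrite sumEFin lee_fin -Ex_csize_Pr; apply: H; apply: boxS.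
by near: k; exact: nbhs_infty_ge.
Unshelve. all: by end_near. Qed.

Lemma ae_no_infinite_cluster :
  (forall x (eps : R), 0 < eps -> exists m, forall X, x \in X -> tail J beta X x m <= eps) ->
  {ae P, forall w, no_infinite_cluster w}.
Proof.
move=> H.
pose F k := if (choice.unpickle k : option V) is Some x then
  [set w : config d | ~ finite_set (open_cluster w (x : V))] else set0.
apply: (negligibleS (A := \bigcup_k F k)).
  move=> w /= /existsNP[x nfin]; exists (choice.pickle x) => //=.
  by rewrite /F choice.pickleK.
apply: negligible_bigcup => k; rewrite /F.
case: (choice.unpickle k : option V) => [x|]; last exact: negligible_set0.
pose B := \bigcap_m [set w : config d | `I_m #<= open_cluster w x].
have mB : measurable B.
  by apply: bigcapT_measurable => m; exact: measurable_big_cluster.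
apply: (negligibleS (A := B)).
  move=> w /= nf m _ /=; apply/card_ge_fsetP; exact: infinite_set_fset.
apply/negligibleP => //; apply/eqP; rewrite -measure_le0.
apply/lee_addgt0Pr => eps eps0; rewrite add0e.
have [m Hm] := H x eps eps0.
apply: le_trans (P_big_cluster_le Hm); apply: le_measure; rewrite ?inE //.
  exact: measurable_big_cluster.
by move=> w; exact.
Qed.

(** The events that 0 is connected to the outside of a box decrease with the box, so their
    intersection has probability at least [delta]; there the cluster of 0 lies in no box. *)
Lemma percolates_of_escape (delta : R) : 0 < delta ->
  (forall n, exists X, delta <=
    Pr (perc_prob J beta) (edges X) (fun v => escapes src dst X (box n) v 0)) ->
  ~ {ae P, forall w, no_infinite_cluster w}.
Proof.
move=> d0 H [N [mN PN NN]].
pose B n := [set w : config d | exists2 z : V, z \notin box n & open_connected w 0 z].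
have mB n : measurable (B n).
  have -> : B n = \bigcup_k (if (choice.unpickle k : option V) is Some z then
      if z \notin @box d n then [set w : config d | open_connected w 0 z] else set0 else set0).
    apply/seteqP; split => w /=.
      by move=> [z zn c]; exists (choice.pickle z) => //=; rewrite choice.pickleK zn.
    move=> [k _]; case: (choice.unpickle k : option V) => [z|] //; case: ifP => // zn c.
    by exists z.
  apply: bigcupT_measurable => k; case: (choice.unpickle k : option V) => [z|] //.
  by case: ifP => // _; exact: measurable_connected.
have PB n : (delta%:E <= P (B n))%E.
  have [X HX] := H n.
  apply: (@le_trans _ _ (P [set w : config d | escapes src dst X (box n) (openX X w) 0])).
    rewrite (P_cylinder PJ (fun v => escapes src dst X (box n) v 0) (edges_uniq X)) lee_fin.
    exact: HX.
  apply: le_measure; rewrite ?inE //.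
    exact: (measurable_cylinder (edges X) (fun v => escapes src dst X (box n) v 0)).
  move=> w /= /hasP[z zX /andP[zn /conn_open_connected c]]; by exists z.
have cv : (P \o B @ \oo --> P (\bigcap_n B n))%E.
  apply: nonincreasing_cvg_mu => //.
  - by rewrite ltey_eq fin_num_measure.
  - exact: bigcapT_measurable.
  move=> n1 n2 n12; apply/subsetPset => w /= [z zn c]; exists z => //.
  by apply: contra zn; exact: boxS.
have : (delta%:E <= P (\bigcap_n B n))%E.
  rewrite -(cvg_lim _ cv) //; apply: lime_ge; first by apply/cvg_ex; eexists; exact: cv.
  by apply: nearW => n; exact: PB.
have : (P (\bigcap_n B n) <= P N)%E.
  apply: le_measure; rewrite ?inE //; first exact: bigcapT_measurable.
  move=> w Bw; apply: NN => /= fin.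
  have /finite_fsetP[X clX] := fin 0.
  have [n Xn] := sub_box X.
  have [z zn c] := Bw n I.
  have : [set` X] z by rewrite -clX.
  by move=> /= /Xn; rewrite (negbTE zn).
rewrite [X in (_ <= X)%E]PN => h1 h2; have := le_trans h2 h1.
by rewrite lee_fin leNgt d0.
Qed.

End InfiniteVolume.

(** * Critical bounds *)

Section Finale.
Context {R : realType} {d : nat} (J : Zlattice d -> R).
Local Notation V := (Zlattice d).
Context (J_gt0 : forall x : V, 0 < J x) (J_sym : forall x : V, J (- x) = J x).
Context (th : R) (th0 : 0 < th) (th1 : th <= 2^-1).
Implicit Types (X S : {fset V}) (beta A : R).

Local Notation csize := (csize src dst).
Local Notation conn := (conn src dst).
Local Notation perc_prob := (perc_prob J).
Local Notation tail := (tail J).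
Local Notation power_tail := (power_tail J th).

(** Markov's inequality gives the tail M / m, which suffices since th <= 1. *)
Lemma power_tail_of_mean beta M : 0 <= beta -> 0 <= M ->
  (forall X o, o \in X -> Ex (perc_prob beta) (edges X) (fun w => (csize w o X)%:R) <= M) ->
  power_tail beta M.
Proof.
have h1 := th1.
move=> b0 M0 H X x m xX m0; have p01 := perc_prob01 J_gt0 b0.
have m0R : 0 < m%:R :> R by rewrite ltr0n.
apply: (@le_trans _ _ (M * m%:R^-1)).
  rewrite ler_pdivlMr // mulrC; apply: le_trans (H X x xX).
  rewrite -ExZ; apply: Ex_le => // w _; case: leqP => h /=; last by rewrite mulr0.
  by rewrite mulr1 ler_nat.
apply: ler_wpM2l => //; rewrite -powR_inv1 ?ler0n //; apply: ler_powR; last by lra.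
by rewrite ler1n.
Qed.

Lemma power_tail_le beta A A' : A <= A' -> power_tail beta A -> power_tail beta A'.
Proof.
move=> AA PT X x m xX m0; apply: le_trans (PT X x m xX m0) _.
by apply: ler_wpM2r => //; exact: powR_ge0.
Qed.

Lemma exists_powRN_le A (eps : R) : 0 <= A -> 0 < eps ->
  exists2 m : nat, (0 < m)%N & A * m%:R `^ (- th) <= eps.
Proof.
move=> A0 e0; set y := A / eps.
have y0 : 0 <= y by rewrite divr_ge0 // ltW.
exists (Num.truncn (y `^ th^-1)).+1 => //.
set m := _.+1; have m0 : 0 < m%:R :> R by rewrite ltr0n.
rewrite powRN ler_pdivrMr ?powR_gt0 // mulrC -ler_pdivrMr // -/y.
have -> : y = (y `^ th^-1) `^ th by rewrite -powRrM mulVf ?powRr1 // gt_eqF.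
apply: ge0_ler_powR; rewrite ?nnegrE ?powR_ge0 ?ler0n //; first exact: ltW.
by apply/ltW; exact: truncnS_gt.
Qed.

Lemma ae_no_infinite_of_power_tail beta A (P : probability (config d) R) :
  percolation_law J beta P -> 0 <= A -> power_tail beta A ->
  {ae P, forall w, no_infinite_cluster w}.
Proof.
move=> PJ A0 PT; apply: (ae_no_infinite_cluster PJ) => x eps e0.
have [m m0 Hm] := exists_powRN_le A0 e0.
by exists m => X xX; apply: le_trans (PT X x m xX m0) Hm.
Qed.

(** Either some finite set has [phi] at most kappa < 1 uniformly in the region, and the mean is
    finite; or every finite set containing 0 has [phi] at least 1/2 in large boxes, and then
    percolation occurs at [b1 > beta]. Any number strictly between 0 and 1 could replace 1/2. *)
Lemma mean_finite_subcritical beta b1 (P : probability (config d) R) :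
  0 < beta -> beta < b1 -> percolation_law J b1 P ->
  {ae P, forall w, no_infinite_cluster w} ->
  exists2 M : R, 0 <= M & forall X o, o \in X ->
    Ex (perc_prob beta) (edges X) (fun w => (csize w o X)%:R) <= M.
Proof.
move=> b0 bb1 PJ noinf; have b0' := ltW b0.
have [[S [kappa [S0 k1 H]]]|D2] := pselect (exists S (kappa : R),
   [/\ 0 \in S, kappa < 1 & forall X, phiX J beta X S 0 <= kappa]).
  exists (#|` S|%:R / (1 - kappa)); first by rewrite divr_ge0 // subr_ge0 ltW.
  exact: Ex_csize_of_phi.
exfalso.
have b10 : 0 < b1 by exact: lt_trans bb1.
apply: (percolates_of_escape PJ (delta := 1 - expR (- (2^-1 / b1 * (b1 - beta))))) noinf.
  rewrite subr_gt0 -expR0 ltr_expR oppr_lt0.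
  by rewrite mulr_gt0 ?divr_gt0 ?subr_gt0.
have /choice[f fP] : forall S, exists N : nat, 0 \in S ->
    forall n, (N <= n)%N -> 2^-1 <= phiX J beta (box n) S 0.
  move=> S; have [S0|_] := boolP (0 \in S); last by exists 0%N.
  have [X HX] : exists X, 2^-1 < phiX J beta X S 0.
    apply: contrapT => nX; apply: D2; exists S, 2^-1; split => //; first by lra.
    by move=> X; rewrite leNgt; apply/negP => h; apply: nX; exists X.
  have [N XN] := sub_box X; exists N => _ n Nn.
  apply: le_trans (ltW HX) _; apply: phiX_subset => // z /XN.
  exact: boxS.
(* One box serves all of the finitely many subsets of [box n]. *)
move=> n; pose N := maxn n (\max_(S <- fpowerset (@box d n)) f S)%N.
exists (box N).
apply: Pr_escape_ge => //.
- by move=> e; exact: (ltW (J_gt0 _)).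
- exact: edges_uniq.
- exact: box0.
- exact: edges_endpoints.
- exact: ltW.
move=> S Sn S0; apply: (fP S S0); rewrite /N leq_max; apply/orP; right.
by apply: (leq_bigmax_seq (F := f)) => //; rewrite fpowersetE.
Qed.

(** [m0] is about (6 A D)^(1/(1 + th)), the least value allowed, and (1 - th)/(1 + th) = 1 - 2 th/(1
    + th) splits off the factor D. In 144 = 4 6 6, the 4 is from the tightness bound, one 6 from 3
    m0 <= 6 y and the other from (6 A)^k <= 6 A. *)
Lemma mean_box_le beta A n : (1 <= d)%N -> 0 <= beta -> 1 <= A -> (1 <= n)%N ->
  power_tail beta A -> forall X, {subset box n <= X} ->
  Ex (perc_prob beta) (edges X) (fun w => (csize w 0 (box n))%:R) <=
  144 * A ^+ 2 * n%:R `^ (- (d%:R * (2 * th / (1 + th)))) * (n.*2.+1 ^ d)%:R.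
Proof.
have h0 := th0; have h1 := th1.
move=> d1 b0 A1 n1 PT X nX.
have A0 : 0 < A by lra.
set D : R := (n.*2.+1 ^ d)%:R.
have n0R : 0 < n%:R :> R by rewrite ltr0n.
have D1 : 1 <= D by rewrite ler1n expn_gt0.
have D0 : 0 < D by lra.
set y := (6 * A * D) `^ (1 + th)^-1.
have AD1 : 1 <= 6 * A * D by nra.
have y1 : 1 <= y.
  rewrite /y -[leLHS](powRr0 (6 * A * D)); apply: ler_powR => //.
  by rewrite invr_ge0; lra.
set m0 := (Num.truncn y).+1.
have ym0 : y <= m0%:R by apply/ltW; exact: truncnS_gt.
have m0y : m0%:R <= 2 * y.
  by rewrite /m0 -natr1; have := truncn_le y; rewrite (_ : 0 <= y); lra.
have m0A : 6 * A * #|` @box d n|%:R <= m0%:R `^ (1 + th).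
  rewrite card_box -/D.
  have -> : 6 * A * D = y `^ (1 + th).
    by rewrite /y -powRrM mulVf ?powRr1 //; [lra|rewrite gt_eqF //; lra].
  by apply: ge0_ler_powR; rewrite ?nnegrE ?powR_ge0 ?ler0n //; lra.
have th01 : 0 <= th <= 2^-1 by rewrite th1 ltW.
apply: le_trans (Ex_csize_power_tail J_gt0 th01 b0 A0 PT (nX _ (box0 _)) nX (ltn0Sn _) m0A) _.
pose k := (1 - th) / (1 + th).
have k1 : k <= 1 by rewrite /k ler_pdivrMr; lra.
have yk : y `^ (1 - th) <= 6 * A * (D * n%:R `^ (- (d%:R * (2 * th / (1 + th))))).
  rewrite /y -powRrM (_ : (1 + th)^-1 * (1 - th) = k); last by rewrite mulrC.
  rewrite powRM; [|by lra|by lra].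
  apply: ler_pM; [exact: powR_ge0|exact: powR_ge0|by apply: ler1_powR; lra|].
  have -> : D `^ k = D * D `^ (- (2 * th / (1 + th))).
    rewrite -[X in X * _](powRr1 (ltW D0)) -powR_addr //; congr powR.
    by rewrite /k; field; rewrite gt_eqF //; lra.
  apply: ler_wpM2l; first exact: ltW.
  have -> : n%:R `^ (- (d%:R * (2 * th / (1 + th)))) =
      (n%:R ^+ d) `^ (- (2 * th / (1 + th))).
    by rewrite -powR_mulrn ?ler0n // -powRrM mulrN.
  have t0 : 0 <= 2 * th / (1 + th) by rewrite divr_ge0 //; lra.
  have nd0 : 0 < n%:R ^+ d :> R by exact: exprn_gt0.
  rewrite !powRN lef_pV2 ?posrE ?powR_gt0 //.
  apply: ge0_ler_powR => //; rewrite ?nnegrE; [exact: ltW|exact: ltW|].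
  by rewrite -natrX ler_nat leq_exp2r // leq_double_succ.
have m0k : (3 * m0)%:R `^ (1 - th) <= 6 * y `^ (1 - th).
  apply: (@le_trans _ _ ((6 * y) `^ (1 - th))).
    apply: ge0_ler_powR; rewrite ?nnegrE ?ler0n ?natrM //; lra.
  rewrite powRM; [|by lra|by lra].
  by apply: ler_wpM2r; [exact: powR_ge0|apply: ler1_powR; lra].
apply: (@le_trans _ _ (4 * A * (6 * (6 * A * (D * n%:R `^ (- (d%:R * (2 * th / (1 + th))))))))).
  apply: ler_wpM2l; first lra.
  by apply: le_trans m0k _; apply: ler_wpM2l => //; lra.
by rewrite le_eqVlt; apply/orP; left; apply/eqP; ring.
Qed.

(** This will rule out an infinite [beta_c]. For large [beta] all edges of a box are open with
    probability at least 1/2. *)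
Lemma tail_large_beta n : (1 <= d)%N ->
  exists beta X, [/\ 0 <= beta, 0 \in X & 2^-1 <= tail beta X 0 n].
Proof.
move=> d1; set X := @box d n; set s := edges X.
set mu := \big[Num.min/1]_(e <- s) edge_rate J e.
have mu0 : 0 < mu.
  by rewrite /mu; elim/big_ind: _ => // [u v u0 v0|e _]; rewrite ?lt_min ?u0 //; exact: J_gt0.
have muP e : e \in s -> mu <= edge_rate J e.
  by move=> es; rewrite /mu; exact: (@ge_bigmin_seq _ R _ _ 1 e xpredT (edge_rate J)).
(* Each edge is then closed with probability at most 1 / (2 (size s + 1)), so a union bound over the
   edges costs at most 1/2. *)
set beta := 2 * ((size s)%:R + 1) / mu.
have s0 : 0 < (size s)%:R + 1 :> R by rewrite ltr_wpDl.
have b0 : 0 < beta by rewrite /beta divr_gt0 // mulr_gt0.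
exists beta, X; split; [exact: ltW|exact: box0|].
have p01 := perc_prob01 J_gt0 (ltW b0).
suff : 1 - \sum_(e <- s) 2^-1 / ((size s)%:R + 1) <= tail beta X 0 n.
  apply: le_trans; rewrite big_const_seq iter_addr addr0 count_predT -[(_ / _) *+ _]mulr_natr.
  have : 2^-1 / ((size s)%:R + 1) * (size s)%:R <= 2^-1 :> R.
    by rewrite mulrAC ler_pdivrMr // ler_pM2l // lerDl.
  lra.
rewrite lerBlDr -lerBlDl.
have -> : 1 - tail beta X 0 n = Pr (perc_prob beta) s (fun w => ~~ (n <= csize w 0%R X)%N).
  rewrite -[1](Ex_cst (perc_prob beta) s) -ExB; apply: Ex_eq => w _.
  by case: (_ <= _)%N => /=; rewrite ?subrr ?subr0.
apply: (@le_trans _ _ (\sum_(e <- s) Pr (perc_prob beta) s (fun w => e \notin w))).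
  apply: Pr_exists => // w ws; rewrite -ltnNge => h.
  apply/hasP; rewrite -[has _ _]negbK; apply: contraL h => /hasPn nh.
  rewrite -leqNgt csizeE (_ : count _ _ = #|` X|).
    rewrite /X card_box; apply: leq_trans (leq_double_succ n) _.
    by rewrite -{1}(expn1 n.*2.+1) leq_pexp2l.
  apply/eqP; rewrite -all_count; apply/allP => y yX.
  have [->|y0] := eqVneq y 0; first exact: conn_refl.
  have [e e0y] : exists e : edge d, joins src dst e 0 y by apply: edge_between; rewrite eq_sym.
  have es : e \in s.
    by rewrite mem_edges; move: e0y => /orP[] /andP[/eqP-> /eqP->]; rewrite ?yX ?box0.
  by apply: (conn_joins _ e0y); have := nh e es; rewrite negbK.
rewrite !big_seq; apply: ler_sum => e es.
have -> : Pr (perc_prob beta) s (fun w => e \notin w) = expR (- (beta * edge_rate J e)).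
  rewrite /Pr (Ex_rem _ _ es) /=.
  rewrite (@Ex_eq _ _ _ _ _ (fun=> 0)); last by move=> w _; rewrite !inE eqxx.
  rewrite [X in _ + _ * X](@Ex_eq _ _ _ _ _ (fun=> 1)); last first.
    move=> w ws; rewrite (_ : e \notin w) //; apply/negP => /ws.
    by rewrite mem_rem_uniqF // edges_uniq.
  by rewrite !Ex_cst /perc_prob /open_prob; ring.
have bJ : 2 * ((size s)%:R + 1) <= beta * edge_rate J e.
  by rewrite /beta mulrAC ler_pdivlMr // ler_pM2l ?mulr_gt0 // muP.
rewrite expRN -invfM lef_pV2 ?posrE ?expR_gt0 ?mulr_gt0 //.
apply: le_trans bJ _; apply: le_trans (expR_ge1Dx _); lra.
Qed.

(** In a fixed finite region the tail is continuous in the parameter, so a violation at [b] would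
    already occur slightly below it. *)
Lemma power_tail_left_limit A (b : R) : 0 < b ->
  (forall beta, 0 <= beta -> beta < b -> power_tail beta A) -> power_tail b A.
Proof.
move=> b0 H X x m xX m0; rewrite leNgt; apply/negP => lt.
have cont := @continuous_Ex _ _ (edge_rate J) (edges X)
  (fun w => (m <= csize w x X)%N%:R) (edges_uniq X) b.
have N : nbhs b (fun t => A * m%:R `^ (- th) < tail t X x m) := cvgr_gt _ cont _ lt.
have [e /= e0 be] := (nbhs_ballP b _).1 (N (nbhs_filter b)).
pose t := b - Num.min e b / 2.
have m_gt0 : 0 < Num.min e b by rewrite lt_min e0.
have m_le : Num.min e b <= e by rewrite ge_min lexx.
have m_le' : Num.min e b <= b by rewrite ge_min lexx orbT.
have tb : ball b e t.
  by rewrite /ball /= /t opprD addrA subrr add0r opprK ger0_norm; lra.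
have := be t tb; rewrite /= ltNge => /negP[]; apply: (H t) => //; rewrite /t; lra.
Qed.

End Finale.

Lemma lattice_box_truncn (R : realType) (d : nat) (r : R) : 0 <= r ->
  lattice_box d r = [set` (@box d (Num.truncn r))].
Proof.
move=> r0; apply/seteqP; split => x /=.
  move=> H; apply/mem_box => i; have := H i.
  by rewrite -abszE -pmulrn -truncn_ge_nat.
move=> /mem_box H i; have := H i.
by rewrite -abszE lez_nat truncn_ge_nat // -pmulrn.
Qed.

Lemma sum_fset_le_esum (R : realType) (T : choiceType) (f : T -> R) (F : {fset T}) :
  (forall x, 0 <= f x) -> (\esum_(x in [set: T]) (f x)%:E < +oo)%E ->
  \sum_(x <- F) f x <= fine (\esum_(x in [set: T]) (f x)%:E)%E.
Proof.
move=> f0 fin; rewrite -lee_fin fineK; last first.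
  by rewrite ge0_fin_numE //; apply: esum_ge0 => x _; rewrite lee_fin.
apply: esum_ge; exists [set` F]; first by split => //; exact: finite_fset.
by rewrite -fsbig_seq ?fset_uniq // sumEFin.
Qed.

Lemma uniform_power_tail (R : realType) (d : nat) (J : Zlattice d -> R)
    (alpha c r0 : R) (P : R -> probability (config d) R)
    (d_ge1 : (1 <= d)%N)
    (J_gt0 : forall x : Zlattice d, 0 < J x)
    (J_sym : forall x : Zlattice d, J (- x) = J x)
    (J_int : (\esum_(x in [set: Zlattice d]) (J x)%:E < +oo)%E)
    (alpha_lt_d : alpha < d%:R)
    (c_gt0 : 0 < c)
    (J_lb : forall x : Zlattice d, r0 <= lattice_norm1 R x ->
       c * lattice_norm1 R x `^ (- d%:R - alpha) <= J x)
    (P_law : forall beta : R, 0 <= beta -> percolation_law J beta (P beta)) :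
  [/\ 0 <= alpha, exists2 A : R, 1 <= A &
   (forall beta : R, 0 <= beta -> (beta%:E <= beta_c P)%E ->
     power_tail J (theta alpha (d := d)) beta A) &
   exists2 b : R, 0 < b & beta_c P = b%:E].
Proof.
set Jtot := fine (\esum_(x in [set: Zlattice d]) (J x)%:E)%E.
have Jsum (F : {fset Zlattice d}) : \sum_(x <- F) J x <= Jtot.
  by apply: sum_fset_le_esum => // x; exact: ltW.
have Jtot0 : 0 < Jtot.
  by apply: lt_le_trans (Jsum [fset 0]%fset); rewrite big_seq_fset1.
have a0 := alpha_ge0 d_ge1 c_gt0 J_lb Jsum.
have [c1 c10 J_box'] := J_power_lb d_ge1 J_gt0 c_gt0 J_lb.
have J_box := J_box' (addr_ge0 (ler0n R d) a0).
set th := theta alpha.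
have th_gt0 : 0 < th := theta_gt0 d_ge1 a0 alpha_lt_d.
have th_half : th <= 2^-1 := theta_le_half d_ge1 a0 alpha_lt_d.
(* Up to [beta0] the product of the parameter with the total intensity is at most 1/2, so the mean
   cluster size is at most 2. *)
set beta0 := (2 * Jtot)^-1.
have beta00 : 0 < beta0 by rewrite invr_gt0 mulr_gt0.
have [C3 C31 HC3] := power_tail_universal J_gt0 J_sym d_ge1 a0 alpha_lt_d c10 beta00 J_box.
have small beta : 0 <= beta -> beta <= beta0 -> power_tail J th beta 2.
  move=> b0 bb; apply: (power_tail_of_mean J_gt0 th_half) => //.
  apply: (Ex_csize_small J_gt0 J_sym Jsum b0).
  apply: (@le_trans _ _ (beta0 * Jtot)); first by apply: ler_wpM2r => //; exact: ltW.
  by rewrite /beta0 invfM -mulrA mulVf ?mulr1 // gt_eqF.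
set S := [set beta%:E | beta in [set beta : R | 0 <= beta /\
  {ae P beta, forall w, no_infinite_cluster w}]].
have bcE : beta_c P = ereal_sup S by [].
have beta0c : (beta0%:E <= beta_c P)%E.
  apply: ereal_sup_ubound; exists beta0 => //=; split; first exact: ltW.
  have b0 := ltW beta00.
  exact: (ae_no_infinite_of_power_tail th_gt0 (P_law _ b0) _ (small _ b0 (lexx _))).
set A := Num.max C3 2.
have below beta : 0 <= beta -> (beta%:E < beta_c P)%E -> power_tail J th beta A.
  move=> b0 bc; have [bb|bb] := leP beta beta0.
    by apply: (power_tail_le (A := 2)); [rewrite /A le_max lexx orbT|exact: small].
  (* The supremum provides a larger parameter without infinite clusters, which sharpness compares
     with [beta]. *)
  move: bc; rewrite bcE => /ereal_sup_gt[_ [b1 [b10 noinf] <-]]; rewrite lte_fin => bb1.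
  have bpos : 0 < beta by exact: lt_trans bb.
  have [M M0 HM] := mean_finite_subcritical J_gt0 J_sym bpos bb1 (P_law _ b10) noinf.
  apply: (power_tail_le (A := C3)); first by rewrite /A le_max lexx.
  apply: (HC3 beta M); first exact: ltW.
  exact: (power_tail_of_mean J_gt0 th_half).
have A1 : 1 <= A by rewrite /A le_max C31.
(* An infinite [beta_c] would give the uniform tail at every parameter, hence a tail at most 1/4
   where [tail_large_beta] has at least 1/2. *)
have [b bE] : exists b : R, beta_c P = b%:E.
  case E : (beta_c P) => [b| |]; first by exists b.
    have A0 : 0 <= A by lra.
    have h4 : 0 < 4^-1 :> R by lra.
    have [m m0 Hm] := exists_powRN_le th_gt0 A0 h4.
    have [beta [X [b0 X0 HX]]] := tail_large_beta J_gt0 m d_ge1.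
    have bl : (beta%:E < beta_c P)%E by rewrite E ltry.
    have h := below beta b0 bl X 0 m X0 m0.
    by have := le_trans HX (le_trans h Hm); lra.
  by move: beta0c; rewrite E leeNy_eq.
have b_pos : 0 < b by apply: lt_le_trans beta00 _; rewrite -lee_fin -bE.
split => //; last by exists b.
exists A => // beta b0; rewrite le_eqVlt => /orP[/eqP bc|]; last exact: below.
have -> : beta = b by move: bc; rewrite bE => -[].
apply: power_tail_left_limit => // t t0 tb; apply: below => //.
by rewrite bE lte_fin.
Qed.

Unset Implicit Arguments.
Set Strict Implicit.
Set Printing Implicit Defensive.

Theorem theorem1p1 (R : realType) (d : nat) (J : Zlattice d -> R)
    (alpha c r0 : R) (P : R -> probability (config d) R)
    (d_ge1 : (1 <= d)%N)
    (J_gt0 : forall x : Zlattice d, 0 < J x)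
    (J_sym : forall x : Zlattice d, J (- x) = J x)
    (J_int : (\esum_(x in [set: Zlattice d]) (J x)%:E < +oo)%E)
    (alpha_lt_d : alpha < d%:R)
    (c_gt0 : 0 < c)
    (J_lb : forall x : Zlattice d, r0 <= lattice_norm1 R x ->
       c * lattice_norm1 R x `^ (- d%:R - alpha) <= J x)
    (P_law : forall beta : R, 0 <= beta -> percolation_law J beta (P beta)) :
  (exists C : R,
     forall beta : R, 0 <= beta -> (beta%:E <= beta_c P)%E ->
       (forall n : nat, (1 <= n)%N ->
          (P beta [set w | `I_n #<= open_cluster w 0%R] <=
           (C * n%:R `^ (- ((d%:R - alpha) / (2 * d%:R + alpha))))%:E)%E) /\
       (forall r : R, 1 <= r ->
          (((#|` fset_set (lattice_box d r)|%:R)^-1)%:E *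
             \sum_(x \in lattice_box d r) P beta [set w | open_connected w 0%R x] <=
           (C * r `^ (- (2 * (d%:R - alpha) / 3)))%:E)%E)) /\
  (exists2 b : R, beta_c P = b%:E &
     {ae P b, forall w, no_infinite_cluster w}).
Proof.
have [a0 [A A1 PT] [b b0 bE]] := uniform_power_tail d_ge1 J_gt0 J_sym J_int
  alpha_lt_d c_gt0 J_lb P_law.
set th := theta alpha in PT.
have th_gt0 : 0 < th := theta_gt0 d_ge1 a0 alpha_lt_d.
have th_half : th <= 2^-1 := theta_le_half d_ge1 a0 alpha_lt_d.
have A0 : 0 <= A by lra.
split; last first.
  exists b => //; have b0' := ltW b0.
  apply: (ae_no_infinite_of_power_tail th_gt0 (P_law _ b0') A0).
  by apply: PT => //; rewrite bE.
have d1 : 1 <= d%:R :> R by rewrite ler1n.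
set gam := 2 * (d%:R - alpha) / 3.
have gam0 : 0 <= gam by rewrite /gam; lra.
have gamE : d%:R * (2 * th / (1 + th)) = gam.
  rewrite /th /theta /gam; field.
  by apply/andP; split; rewrite gt_eqF //; lra.
(* The factor 2^gam pays for replacing the real radius r by its integer part, which is at least
   r/2. *)
exists (Num.max A (144 * A ^+ 2 * 2 `^ gam)) => beta bt0 btc.
have PTb := PT beta bt0 btc; have law := P_law beta bt0; split.
  move=> n n1; apply: (P_big_cluster_le law) => X xX.
  apply: le_trans (PTb X 0 n xX n1) _.
  by apply: ler_wpM2r; [exact: powR_ge0|rewrite le_max lexx].
move=> r r1; have r0' : 0 <= r by lra.
set n := Num.truncn r.
have n1 : (1 <= n)%N by rewrite /n truncn_gt0.
have n0R : 0 < n%:R :> R by rewrite ltr0n.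
rewrite (lattice_box_truncn _ r0') -/n set_fsetK fsbig_finite; last exact: finite_fset.
rewrite set_fsetK card_box.
set D : R := (n.*2.+1 ^ d)%:R.
have D0 : 0 < D by rewrite ltr0n expn_gt0.
have H := sum_P_connected_le law (mean_box_le J_gt0 th_gt0 th_half d_ge1 bt0 A1 n1 PTb).
apply: (@le_trans _ _ (D^-1%:E * (144 * A ^+ 2 * n%:R `^ (- gam) * D)%:E)%E).
  apply: lee_wpmul2l; first by rewrite lee_fin invr_ge0 ltW.
  by rewrite -gamE; exact: H.
rewrite -EFinM lee_fin mulrC mulfK ?gt_eqF //.
have nr : n%:R `^ (- gam) <= 2 `^ gam * r `^ (- gam).
  have -> : 2 `^ gam * r `^ (- gam) = (r / 2) `^ (- gam).
    rewrite powRM ?invr_ge0 // mulrC; congr (_ * _).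
    by rewrite -powR_inv1 // -powRrM mulN1r opprK.
  rewrite !powRN lef_pV2 ?posrE ?powR_gt0 ?divr_gt0 //; last by lra.
  apply: ge0_ler_powR => //; rewrite ?nnegrE; [by lra|exact: ltW|].
  have := truncnS_gt r; rewrite -/n -natr1.
  have : 1 <= n%:R :> R by rewrite ler1n.
  by lra.
apply: (@le_trans _ _ (144 * A ^+ 2 * (2 `^ gam * r `^ (- gam)))).
  by apply: ler_wpM2l => //; rewrite mulr_ge0 // sqr_ge0.
rewrite mulrA; apply: ler_wpM2r; first exact: powR_ge0.
by rewrite ?/A le_max lexx orbT.
Qed.
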